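(* Let $R>0$, $A>0$, $d\in\left(0,\frac{B_1^2}{B_1^2+5\pi^2/4}\right)$, $\alpha\in(0,1)$, and let $(p,q)$ be a data pair (as defined in the context) with $\|p(\cdot,\cdot,B_2,\cdot)\|_{C^1(\overline\Gamma_u\times[0,\pi])}\le A$, $\|q\|_{C^1(\overline G\times[0,\pi])}\le A$. For $\lambda>0$ let $$J_{\lambda,\alpha}(Q)=e^{-2\lambda B_1}\int_{B_1}^{B_2}\left|Q(z)-\mathcal F_{p,q}(Q)(z)-\widehat v_0-\widehat q(z)\right|^2e^{2\lambda z}\,dz+\alpha\|Q\|^2_{H^1(B_1,B_2)}.$$ Let $\overline\lambda=\overline\lambda(G,N,K,A,R,d)>1$ be a number such that for all $\lambda\ge\overline\lambda$ and all $Q_1,Q_2\in\overline{B(R,q,d)}$ $$J_{\lambda,\alpha}(Q_2)-J_{\lambda,\alpha}(Q_1)-J'_{\lambda,\alpha}(Q_1)(Q_2-Q_1)\ge\frac18\|Q_2-Q_1\|^2_{L_2(B_1,B_2)}+\alpha\|Q_2-Q_1\|^2_{H^1(B_1,B_2)}.$$ Let $\lambda\ge\overline\lambda$ and let $Q_{\min}$ be the unique minimizer of $J_{\lambda,\alpha}$ on $\overline{B(R,q,d)}$. Let $T:H_0^1(B_1,B_2)\to\overline{B(R,q,d)}$ be the orthogonal projection operator onto the closed convex set $\overline{B(R,q,d)}$, let $\kappa\in(0,1)$, let $Q^{(0)}\in B(R,q,d)$ be arbitrary, and define $$Q^{(n)}=T\left(Q^{(n-1)}-\kappa J'_{\lambda,\alpha}(Q^{(n-1)})\right),\quad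 n=1,2,\dots$$ Then there exists a number $\overline\kappa=\overline\kappa(G,N,K,A,R,d,\lambda)\in(0,1)$, depending only on the listed parameters, such that for every $\kappa\in(0,\overline\kappa)$ there exists a number $\theta=\theta(\kappa)\in(0,1)$ such that $$\|Q^{(n)}-Q_{\min}\|_{H^1(B_1,B_2)}\le\theta^n\|Q^{(0)}-Q_{\min}\|_{H^1(B_1,B_2)},\quad n=1,2,\dots$$
   Context: Fix throughout $0<B_1<B_2$, integers $N,K\ge1$ and $\beta>0$. Points of $\mathbb R^3$ are $\mathbf u=(x,y,z)$; $G=(0,\pi)^2\times(B_1,B_2)$, $\Gamma_l=\{0<x,y<\pi,\ z=B_1\}$, $\Gamma_u=\{0<x,y<\pi,\ z=B_2\}$, $\partial_1G=\partial G\setminus(\Gamma_l\cup\Gamma_u)$. Basis: $\varphi_0,\dots,\varphi_{N-1}$ are obtained by Gram-Schmidt orthonormalization in $L_2(0,\pi)$ of the functions $(a+\beta)^ne^a$, $n=0,\dots,N-1$. It is a known fact that the $N\times N$ matrix of numbers $\int_0^\pi\varphi_n'\varphi_l\,da$ is invertible. Put $v_0(x,y,a)=\dfrac{B_1^2}{(x-a)^2+(y-\pi/2)^2+B_1^2}$. Data pair $(p,q)$: $p=p(\mathbf u,a)$ is a function on $(\partial G\setminus\Gamma_l)\times[0,\pi]$ (travel time data for the source $(a,\pi/2,0)$), with $p(\cdot,\cdot,B_2,\cdot)\in C^1(\overline\Gamma_u\times[0,\pi])$ and differentiable in $z$ on $\partial_1G\times(0,\pi)$; and $q\in C^1(\overline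 G\times[0,\pi])$ satisfies $q=\overline p$ on $\partial_1G\times(0,\pi)$, where $\overline p=(\partial_zp)^2-v_0$, and $q(x,y,B_1,a)=0$ for $(x,y,a)\in(0,\pi)^3$. For an $NK^2$-dimensional vector function $Q(z)=(w_{n,km}(z))$, $0\le n\le N-1$, $1\le k,m\le K$, continuous on $[B_1,B_2]$, put $$V_Q(\mathbf u,a)=\sum_{n=0}^{N-1}\sum_{k,m=1}^Kw_{n,km}(z)\varphi_n(a)\sin(kx)\sin(my),\qquad v_{Q,q}(\mathbf u,a)=v_0(x,y,a)+q(\mathbf u,a)+V_Q(\mathbf u,a).$$ When $v=v_{Q,q}>0$ on $\overline G\times[0,\pi]$, put $$E^x_{p,q,Q}(x,y,z,a)=-\int_z^{B_2}\frac{v_x}{2\sqrt v}(x,y,s,a)\,ds+p_x(x,y,B_2,a),$$ $$E^y_{p,q,Q}(x,y,z,a)=-\int_z^{B_2}\frac{v_y}{2\sqrt v}(x,y,s,a)\,ds+p_y(x,y,B_2,a).$$ For a function $h(x,y,a)$ on $[0,\pi]^3$ let $\Lambda h=((\Lambda h)_{n,km})\in\mathbb R^{NK^2}$ be the unique solution of $$\frac{\pi^2}{4}\sum_{n=0}^{N-1}\Big(\int_0^\pi\varphi_n'\varphi_l\,da\Big)(\Lambda h)_{n,km}=-\int_0^\pi\!\int_0^\pi\!\int_0^\pi\partial_ah(x,y,a)\sin(kx)\sin(my)\varphi_l(a)\,da\,dx\,dy,$$ for $0\le l\le N-1$, $1\le k,m\le K$; if $h$ is merely continuous, the inner integral $\int_0^\pi\partial_ah\,\varphi_l\,da$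 is understood as $[h\varphi_l]_{a=0}^{a=\pi}-\int_0^\pi h\varphi_l'\,da$. Define $$\mathcal F_{p,q}(Q)(z)=\Lambda\big((E^x_{p,q,Q})^2+(E^y_{p,q,Q})^2\big)(z),\qquad\widehat v_0=\Lambda v_0,\qquad\widehat q(z)=\Lambda q(\cdot,\cdot,z,\cdot),$$ where $\Lambda$ is applied in the variables $(x,y,a)$ for fixed $z$. Norms of vector functions are square roots of sums of squared norms of components. $H_0^1(B_1,B_2)=\{Q\in H^1(B_1,B_2):Q(B_1)=0\}$ ($NK^2$-dimensional vector functions), with the $H^1$ scalar product, and $$B(R,q,d)=\{Q\in H_0^1(B_1,B_2):\ \|Q\|_{H^1(B_1,B_2)}<R,\ q+V_Q>-d\text{ on }\overline G\times[0,\pi]\}.$$ The closure $\overline{B(R,q,d)}$ is taken in $H^1_0(B_1,B_2)$. Since $v_0\ge B_1^2/(B_1^2+5\pi^2/4)$ on $[0,\pi]^3$, $v_{Q,q}$ is bounded below by a positive constant on this set. The functional $J_{\lambda,\alpha}$ is defined by its formula on the open set of all $Q\in H_0^1(B_1,B_2)$ with $v_{Q,q}>0$ on $\overline G\times[0,\pi]$, which contains $\overline{B(R,q,d)}$; $J'_{\lambda,\alpha}$ is its Fréchet derivative in $H_0^1(B_1,B_2)$, identified with an element of $H_0^1(B_1,B_2)$ by the Riesz theorem. *)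

(* Defs.v *)
From HB Require Import structures.
From mathcomp Require Import all_boot all_order all_algebra.
From mathcomp Require Import all_classical all_reals all_analysis.
From mathcomp Require Import measurable_realfun.
From mathcomp Require Import ring lra.

Set Implicit Arguments.
Unset Strict Implicit.
Unset Printing Implicit Defensive.

Import Order.TTheory GRing.Theory Num.Theory.
Import numFieldNormedType.Exports.

Local Open Scope classical_set_scope.
Local Open Scope ring_scope.

Section SobolevSpace.
Context (R : realType) (a b : R) (I : finType).
Local Notation mu := (@lebesgue_measure R).

(* g is in L_2(a,b) *)
Definition sqint (g : R -> R) : Prop :=
  measurable_fun `[a, b] g /\
  mu.-integrable `[a, b] (EFin \o (fun s => g s ^+ 2)).

(* u is the absolutely continuous representative of an element of H^1(a,b) that
   vanishes at a, and g is its derivative in L_2(a,b).  The truncation extends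
   u by constants outside [a,b], so that two representatives which agree on
   [a,b] are equal as functions on R. *)
Definition weak_deriv (u g : R -> R) : Prop :=
  sqint g /\ u = (fun z => \int[mu]_(s in `[a, Num.min z b]) g s).

Definition H10_pred : pred (I -> R -> R) :=
  fun Q => `[< forall i, exists g, weak_deriv (Q i) g >].

Lemma sqint0 : sqint (fun=> 0).
Proof.
split=> //.
rewrite (_ : _ \o _ = cst 0%E); last by apply/funext => x /=; rewrite expr0n.
exact: integrable0.
Qed.

Lemma sqintM f g : sqint f -> sqint g ->
  mu.-integrable `[a, b] (EFin \o (fun s => f s * g s)).
Proof.
move=> [mf f2] [mg g2].
have mi : measurable (`[a, b]%classic : set (measurableTypeR R)) by [].
have := integrableD mi f2 g2.
apply: le_integrable => //.
  by apply/measurable_EFinP; exact: measurable_funM.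
move=> x _ /=; rewrite lee_fin [leRHS]ger0_norm ?addr_ge0 ?sqr_ge0//.
rewrite normrM -(real_normK (num_real (f x))) -(real_normK (num_real (g x))).
have := normr_ge0 (f x); have := normr_ge0 (g x).
set p := `|f x|; set q := `|g x| => ? ?; have := sqr_ge0 (p - q); nra.
Qed.

Lemma sqint_continuous (f : R -> R) : {within `[a, b], continuous f} -> sqint f.
Proof.
move=> cf; split; first exact: subspace_continuous_measurable_fun.
apply: continuous_compact_integrable; first exact: segment_compact.
by move=> x; apply: cvgM; exact: cf.
Qed.

Lemma sqint_cst (c : R) : sqint (cst c).
Proof. by apply: sqint_continuous => x; exact: cvg_cst. Qed.

Lemma sqint_int g : sqint g -> mu.-integrable `[a, b] (EFin \o g).
Proof.
move=> g2; have := sqintM g2 (sqint_cst 1).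
by congr integrable; apply/funext => x /=; rewrite mulr1.
Qed.

Lemma sqintD c f g : sqint f -> sqint g -> sqint (fun s => c * f s + g s).
Proof.
move=> sf sg; have [mf f2] := sf; have [mg g2] := sg; split.
  by apply: measurable_funD => //; apply: measurable_funM => //; exact: measurable_cst.
have := sqintM sf sg => fg.
have mi : measurable (`[a, b]%classic : set (measurableTypeR R)) by [].
have := integrableD mi (integrableZl mi (c ^+ 2) f2)
  (integrableD mi (integrableZl mi (c *+ 2) fg) g2).
congr integrable; apply/funext => x /=; rewrite -!EFinM -!EFinD; congr EFin; ring.
Qed.

Lemma integrable_minr g z : sqint g ->
  mu.-integrable `[a, Num.min z b] (EFin \o g).
Proof.
move=> /sqint_int; apply: integrableS => //.
by apply: subset_itvl; rewrite bnd_simp ge_min lexx orbT.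
Qed.

Lemma weak_derivD c u v f g : weak_deriv u f -> weak_deriv v g ->
  weak_deriv (fun s => c * u s + v s) (fun s => c * f s + g s).
Proof.
move=> [sf ->] [sg ->]; split; first exact: sqintD.
apply/funext => z.
have fi := integrable_minr z sf; have gi := integrable_minr z sg.
have mi : measurable (`[a, Num.min z b]%classic : set (measurableTypeR R)) by [].
rewrite RintegralD// ?RintegralZl//.
have := integrableZl mi c fi.
by congr integrable; apply/funext => x /=; rewrite EFinM.
Qed.

Lemma weak_deriv0 : weak_deriv (fun=> 0) (fun=> 0).
Proof.
split; first exact: sqint0.
by apply/funext => z; rewrite Rintegral_cst// mul0r.
Qed.

Lemma H10_submod_closed : submod_closed H10_pred.
Proof.
split.
  by apply/asboolP => i; exists (fun=> 0); exact: weak_deriv0.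
move=> c Q P /asboolP hQ /asboolP hP; apply/asboolP => i.
have [f hf] := hQ i; have [g hg] := hP i.
by exists (fun s => c * f s + g s); exact: weak_derivD.
Qed.

End SobolevSpace.
HB.instance Definition _ (R : realType) (a b : R) (I : finType) :=
  GRing.isSubmodClosed.Build R (I -> R -> R) (@H10_pred R a b I)
    (@H10_submod_closed R a b I).

(* Vector functions in H^1(a,b), with components indexed by I, vanishing at a. *)
Record H10 (R : realType) (a b : R) (I : finType) := MkH10 {
  H10val :> I -> R -> R;
  H10valP : H10val \in @H10_pred R a b I }.

HB.instance Definition _ (R : realType) (a b : R) (I : finType) :=
  [isSub for @H10val R a b I].
HB.instance Definition _ (R : realType) (a b : R) (I : finType) :=
  [Choice of H10 a b I by <:].
HB.instance Definition _ (R : realType) (a b : R) (I : finType) :=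
  [SubChoice_isSubLmodule of H10 a b I by <:].

Section H10_norm.
Context (R : realType) (a b : R) (I : finType).
Local Notation mu := (@lebesgue_measure R).
Local Notation H := (H10 a b I).
Implicit Types (Q P S : H) (u v f g : R -> R).

Definition wderiv u : R -> R := xget (fun=> 0) (weak_deriv a b u).

Definition L2dot Q P : R := \sum_i \int[mu]_(z in `[a, b]) (Q i z * P i z).

Definition H1dot Q P : R :=
  L2dot Q P + \sum_i \int[mu]_(z in `[a, b]) (wderiv (Q i) z * wderiv (P i) z).

Definition L2norm Q : R := Num.sqrt (L2dot Q Q).
Definition H1norm Q : R := Num.sqrt (H1dot Q Q).

Lemma wderivP Q i : weak_deriv a b (Q i) (wderiv (Q i)).
Proof.
have /asboolP/(_ i)[g hg] := H10valP Q.
exact: (xgetPex (fun=> 0) (ex_intro _ g hg)).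
Qed.

Lemma sqint_H10 Q i : sqint a b (Q i).
Proof.
have [sg uE] := wderivP Q i; rewrite {}uE.
have [ab|ba] := leP a b; last first.
  rewrite /sqint set_itv_ge ?bnd_simp -?ltNge//.
  split; first exact: measurable_fun_set0.
  exact: integrable_set0.
have := parameterized_integral_continuous ab (sqint_int sg).
set F := (X in continuous X) => cF.
apply: sqint_continuous; apply: (@subspace_eq_continuous _ _ _ F) => //.
move=> z; rewrite inE/= in_itv/= => /andP[_ zb].
by rewrite /F/from_subspace/= /parameterized_integral (min_idPl zb).
Qed.

Lemma weak_deriv0_ae f : weak_deriv a b (fun=> 0) f ->
  {ae mu, forall x, `[a, b]%classic x -> f x = 0}.
Proof.
move=> [sf /esym f0].
have mab : measurable (`[a, b]%classic : set (measurableTypeR R)) by [].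
have fi := sqint_int sf.
pose k := f \_ `[a, b].
have ki D : measurable D -> mu.-integrable D (EFin \o k).
  move=> mD; rewrite /k -restrict_EFin; apply/integrable_restrict => //.
  by apply: integrableS fi => //; exact: measurableI.
have kloc : locally_integrable [set: R] k by exact: integrable_locally.
have := FTC1 (a := BLeft a) (fun y => ki _ (measurable_itv _)) kloc.
have F0 : (fun x => \int[mu]_(t in `[a, x]) k t) = cst 0.
  apply/funext => x; rewrite /k -Rintegral_mkcondr.
  rewrite -(congr1 (fun h => h x) f0); congr Rintegral.
  rewrite eqEsubset; split => t/=; rewrite !in_itv/= le_min.
    by move=> [/andP[-> ->] /andP[_ ->]].
  by move=> /and3P[-> -> ->].
rewrite /= F0 => H.
have aN : {ae mu, forall x, x != a}.
  exists [set a]; split => //; first exact: lebesgue_measure_set1.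
  by move=> x /= /negP; rewrite negbK => /eqP.
have FF := ae_filter_ringOfSetsType mu.
apply: filterS2 H aN => x H xa; rewrite in_itv/= => /andP[ax xb].
have [|_] := H; first by rewrite lte_fin lt_neqAle eq_sym xa.
by rewrite derive1_cst /k patchE mem_set//= in_itv/= ax.
Qed.

Lemma weak_deriv_ae u f g : weak_deriv a b u f -> weak_deriv a b u g ->
  {ae mu, forall x, `[a, b]%classic x -> f x = g x}.
Proof.
move=> uf ug; have := weak_derivD (- 1) ug uf.
rewrite (_ : (fun s => - 1 * u s + u s) = fun=> 0); last first.
  by apply/funext => s; rewrite mulN1r addNr.
have FF := ae_filter_ringOfSetsType mu.
move=> /weak_deriv0_ae; apply: filterS => x + xab => /(_ xab).
by rewrite mulN1r addrC => /subr0_eq.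
Qed.

Lemma weak_deriv_int u f g h : weak_deriv a b u f -> weak_deriv a b u g ->
  sqint a b h ->
  \int[mu]_(z in `[a, b]) (f z * h z) = \int[mu]_(z in `[a, b]) (g z * h z).
Proof.
move=> uf ug sh; congr fine; apply: ae_eq_integral => //.
- by apply: (measurable_int mu); exact: (sqintM uf.1 sh).
- by apply: (measurable_int mu); exact: (sqintM ug.1 sh).
have FF := ae_filter_ringOfSetsType mu.
by apply: filterS (weak_deriv_ae uf ug) => x /= fg /fg ->.
Qed.

Lemma L2dotC Q P : L2dot Q P = L2dot P Q.
Proof.
by apply: eq_bigr => i _; apply: eq_Rintegral => x _; rewrite mulrC.
Qed.

Lemma H1dotC Q P : H1dot Q P = H1dot P Q.
Proof.
rewrite /H1dot L2dotC; congr (_ + _).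
by apply: eq_bigr => i _; apply: eq_Rintegral => x _; rewrite mulrC.
Qed.

Lemma sqint_dot c f g h : sqint a b f -> sqint a b g -> sqint a b h ->
  \int[mu]_(z in `[a, b]) ((c * f z + g z) * h z) =
  c * \int[mu]_(z in `[a, b]) (f z * h z) + \int[mu]_(z in `[a, b]) (g z * h z).
Proof.
move=> sf sg sh.
have mab : measurable (`[a, b]%classic : set (measurableTypeR R)) by [].
have fh := sqintM sf sh; have gh := sqintM sg sh.
rewrite -RintegralZl// -RintegralD//.
  by apply: eq_Rintegral => x _; rewrite mulrDl mulrA.
by have := integrableZl mab c fh; congr integrable; apply/funext => x /=.
Qed.

Lemma L2dotDl c Q P S : L2dot (c *: Q + P) S = c * L2dot Q S + L2dot P S.
Proof.
rewrite /L2dot mulr_sumr -big_split/=; apply: eq_bigr => i _.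
by rewrite -sqint_dot//; exact: sqint_H10.
Qed.

Lemma H1dotDl c Q P S : H1dot (c *: Q + P) S = c * H1dot Q S + H1dot P S.
Proof.
rewrite /H1dot L2dotDl mulrDr addrACA; congr (_ + _).
rewrite mulr_sumr -big_split/=; apply: eq_bigr => i _.
have [[Q' P'] S'] := (wderivP Q i, wderivP P i, wderivP S i).
rewrite -(sqint_dot _ Q'.1 P'.1 S'.1).
have D : weak_deriv a b ((c *: Q + P) i)
    (fun s => c * wderiv (Q i) s + wderiv (P i) s) := weak_derivD c Q' P'.
exact: (weak_deriv_int (wderivP _ _) D S'.1).
Qed.

Lemma L2dot_ge0 Q : 0 <= L2dot Q Q.
Proof.
by apply: sumr_ge0 => i _; apply: Rintegral_ge0 => x _; exact: sqr_ge0.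
Qed.

Lemma H1dot_ge0 Q : 0 <= H1dot Q Q.
Proof.
apply: addr_ge0; first exact: L2dot_ge0.
by apply: sumr_ge0 => i _; apply: Rintegral_ge0 => x _; exact: sqr_ge0.
Qed.

Lemma H1dot_eq0 Q : H1dot Q Q = 0 -> Q = 0.
Proof.
rewrite /H1dot => /eqP; rewrite paddr_eq0 ?L2dot_ge0//; last first.
  by apply: sumr_ge0 => i _; apply: Rintegral_ge0 => x _; exact: sqr_ge0.
move=> /andP[_]; rewrite psumr_eq0; last first.
  by move=> i _; apply: Rintegral_ge0 => x _; exact: sqr_ge0.
move=> /allP/= D0; apply: val_inj; apply/funext => i.
have mab : measurable (`[a, b]%classic : set (measurableTypeR R)) by [].
have := D0 i; rewrite mem_index_enum => /(_ isT)/eqP {}D0.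
have [sg uE] := wderivP Q i.
have D2 := sqintM sg sg.
have I0 : (\int[mu]_(z in `[a, b]) `|(wderiv (Q i) z * wderiv (Q i) z)%:E| = 0)%E.
  transitivity (\int[mu]_(z in `[a, b]) (wderiv (Q i) z * wderiv (Q i) z)%:E)%E.
    by apply: eq_integral => x _; rewrite gee0_abs// lee_fin -expr2 sqr_ge0.
  by rewrite -[LHS]fineK ?integrable_fin_num//; congr EFin; exact: D0.
move: I0 => /(ae_eq_integral_abs _ mab (measurable_int _ D2)) ae0.
rewrite /= uE; apply/funext => z.
transitivity (\int[mu]_(s in `[a, Num.min z b]) (0 : R)); last first.
  by rewrite Rintegral_cst// mul0r.
congr fine; apply: ae_eq_integral => //.
  by apply: (measurable_int mu); exact: integrable_minr.
have FF := ae_filter_ringOfSetsType mu.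
apply: filterS ae0 => x /= D x_ab.
have /D[/eqP] : `[a, b]%classic x.
  move: x_ab; rewrite /= !in_itv/= => /andP[->]; rewrite le_min => /andP[_ ->].
  by [].
by rewrite mulf_eq0 orbb => /eqP ->.
Qed.

Lemma H1norm_sqr Q : H1norm Q ^+ 2 = H1dot Q Q.
Proof. exact/sqr_sqrtr/H1dot_ge0. Qed.

Lemma H1dotDr c Q P S : H1dot S (c *: Q + P) = c * H1dot S Q + H1dot S P.
Proof. by rewrite H1dotC H1dotDl !(H1dotC S). Qed.

Lemma H1dot_le Q P : H1dot Q P <= H1norm Q * H1norm P.
Proof.
have [P0|Pn0] := eqVneq (H1norm P) 0.
  have -> : P = 0 by apply: H1dot_eq0; rewrite -H1norm_sqr P0 expr0n.
  have -> : H1dot Q 0 = 0.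
    have := H1dotDr 1 0 0 Q; rewrite scaler0 addr0 mul1r => /eqP.
    by rewrite addrC -subr_eq0 opprD addrA subrr sub0r oppr_eq0 => /eqP.
  by rewrite mulr_ge0 ?sqrtr_ge0.
have p0 : 0 < H1norm P by rewrite lt_def Pn0 sqrtr_ge0.
have q0 : 0 <= H1norm Q by exact: sqrtr_ge0.
have := H1dot_ge0 (- (H1dot Q P / H1norm P ^+ 2) *: P + Q).
rewrite H1dotDl !H1dotDr -!H1norm_sqr (H1dotC P Q).
set d := H1dot Q P; set p := H1norm P in p0 Pn0 *; set q := H1norm Q in q0 *.
rewrite (_ : _ + _ = q ^+ 2 - d ^+ 2 / p ^+ 2); last by field.
rewrite subr_ge0 ler_pdivrMr ?exprn_gt0// -exprMn => dpq.
apply: (le_trans (ler_norm d)).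
by rewrite -(@ler_pXn2r _ 2)// ?nnegrE ?mulr_ge0 ?(ltW p0)// real_normK ?num_real.
Qed.

Lemma ler_H1normD Q P : H1norm (Q + P) <= H1norm Q + H1norm P.
Proof.
have q0 : 0 <= H1norm Q by exact: sqrtr_ge0.
have p0 : 0 <= H1norm P by exact: sqrtr_ge0.
rewrite -(@ler_pXn2r _ 2)// ?nnegrE ?addr_ge0 ?sqrtr_ge0// H1norm_sqr.
rewrite -[Q in H1dot (Q + _)]scale1r -[Q in H1dot _ (Q + _)]scale1r.
rewrite H1dotDl !H1dotDr -!H1norm_sqr (H1dotC P Q).
have := H1dot_le Q P; nra.
Qed.

Lemma H1normZ c Q : H1norm (c *: Q) = `|c| * H1norm Q.
Proof.
rewrite /H1norm -sqrtr_sqr -sqrtrM ?sqr_ge0//; congr Num.sqrt.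
have Z0 S : H1dot 0 S = 0.
  have := H1dotDl 1 0 0 S; rewrite scaler0 addr0 mul1r => /eqP.
  by rewrite addrC -subr_eq0 opprD addrA subrr sub0r oppr_eq0 => /eqP.
rewrite -[c *: Q]addr0 H1dotDl H1dotDr (H1dotC Q 0) !Z0 !addr0.
by rewrite mulrA expr2.
Qed.

Lemma H1norm_eq0 Q : H1norm Q = 0 -> Q = 0.
Proof. by move=> Q0; apply: H1dot_eq0; rewrite -H1norm_sqr Q0 expr0n. Qed.

End H10_norm.

HB.instance Definition _ (R : realType) (a b : R) (I : finType) :=
  @Lmodule_isNormed.Build R (H10 a b I) (@H1norm R a b I)
    (@ler_H1normD R a b I) (@H1normZ R a b I) (@H1norm_eq0 R a b I).

Section FrechetGradient.
Context (R : realType) (a b : R) (I : finType).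
Local Notation H := (H10 a b I).

(* Riesz representative, for the H^1 scalar product, of the Frechet
   derivative of J at Q (0 when there is none). *)
Definition gradient (J : H -> R) (Q : H) : H :=
  xget 0 [set g | differentiable J Q /\ forall h, 'd J Q h = H1dot g h].

Definition unique_minimizer (J : H -> R) (S : set H) (Q : H) : Prop :=
  [/\ S Q, forall P, S P -> J Q <= J P
    & forall P, S P -> (forall P', S P' -> J P <= J P') -> P = Q].

Definition orthogonal_projection (S : set H) (T : H -> H) : Prop :=
  forall Q, S (T Q) /\ forall P, S P -> `|Q - T Q| <= `|Q - P|.

End FrechetGradient.

Section C1onBox.
Context (R : realType) (n : nat) (lo hi : 'rV[R]_n).

Definition cbox : set 'rV[R]_n := [set u | forall i, lo 0 i <= u 0 i <= hi 0 i].
Definition obox : set 'rV[R]_n := [set u | forall i, lo 0 i < u 0 i < hi 0 i].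

(* C^1 up to the boundary: the partial derivatives exist in the open box and
   extend continuously to the closed one. *)
Definition C1box (f : 'rV[R]_n -> R) : Prop :=
  {within cbox, continuous f} /\
  forall i : 'I_n, exists2 g : 'rV[R]_n -> R, {within cbox, continuous g} &
    forall u, obox u ->
      derivable f u (delta_mx 0 i) /\ 'D_(delta_mx 0 i) f u = g u.

(* Suprema over the open box: for f in C1box they equal those of the continuous
   extensions over the closed box. *)
Definition C1norm (f : 'rV[R]_n -> R) : R :=
  Num.max (sup [set `|f u| | u in cbox])
    (\big[Num.max/0]_(i < n) sup [set `|'D_(delta_mx 0 i) f u| | u in obox]).

End C1onBox.

Section Problem.
Context (R : realType) (B1 B2 beta : R) (N K : nat).
Local Notation mu := (@lebesgue_measure R).
Local Notation idx := ('I_N * 'I_K * 'I_K)%type.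
Local Notation H := (H10 B1 B2 idx).

Definition G : set (R * R * R) :=
  [set u | [/\ 0 < u.1.1 < pi, 0 < u.1.2 < pi & B1 < u.2 < B2]].
Definition clG : set (R * R * R) :=
  [set u | [/\ 0 <= u.1.1 <= pi, 0 <= u.1.2 <= pi & B1 <= u.2 <= B2]].
Definition Gamma_l : set (R * R * R) :=
  [set u | [/\ 0 < u.1.1 < pi, 0 < u.1.2 < pi & u.2 = B1]].
Definition Gamma_u : set (R * R * R) :=
  [set u | [/\ 0 < u.1.1 < pi, 0 < u.1.2 < pi & u.2 = B2]].
Definition bd1G : set (R * R * R) := (clG `\` G) `\` (Gamma_l `|` Gamma_u).

Definition int0pi (f : R -> R) : R := \int[mu]_(s in `]0, pi[) f s.

(* Gram-Schmidt in L_2(0,pi); the list is [:: phi_0; ...; phi_(n-1)]. *)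
Fixpoint gram_schmidt (n : nat) : seq (R -> R) :=
  if n isn't n'.+1 then [::] else
  let s := gram_schmidt n' in
  let e := fun a => (a + beta) ^+ n' * expR a in
  let r := fun a => e a - \sum_(f <- s) int0pi (fun t => e t * f t) * f a in
  rcons s (fun a => r a / Num.sqrt (int0pi (fun t => r t ^+ 2))).

Definition phi (n : nat) : R -> R := nth (fun=> 0) (gram_schmidt n.+1) n.

Definition v0 (x y a : R) : R :=
  B1 ^+ 2 / ((x - a) ^+ 2 + (y - pi / 2) ^+ 2 + B1 ^+ 2).

Definition VQ (Q : H) (x y z a : R) : R :=
  \sum_(n < N) \sum_(k < K) \sum_(m < K)
    Q (n, k, m) z * phi n a * sin (k.+1%:R * x) * sin (m.+1%:R * y).

Definition vQq (q : R -> R -> R -> R -> R) (Q : H) (x y z a : R) : R :=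
  v0 x y a + q x y z a + VQ Q x y z a.

Definition Ex (p q : R -> R -> R -> R -> R) (Q : H) (x y z a : R) : R :=
  (- (\int[mu]_(s in `[z, B2])
      ((fun t => vQq q Q t y s a)^`()%classic x / (2 * Num.sqrt (vQq q Q x y s a)))))
  + (fun t => p t y B2 a)^`()%classic x.

Definition Ey (p q : R -> R -> R -> R -> R) (Q : H) (x y z a : R) : R :=
  (- (\int[mu]_(s in `[z, B2])
      ((fun t => vQq q Q x t s a)^`()%classic y / (2 * Num.sqrt (vQq q Q x y s a)))))
  + (fun t => p x t B2 a)^`()%classic y.

Definition phi_mx : 'M[R]_N :=
  \matrix_(l, n) int0pi (fun a => (phi n)^`()%classic a * phi l a).

(* c_(n,km) = Lambda h, where [mom l x y] stands for the inner integral
   int_0^pi d_a h phi_l da. *)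
Definition Lambda_solve (mom : 'I_N -> R -> R -> R) (i : idx) : R :=
  let: (n, k, m) := i in
  (invmx ((pi ^+ 2 / 4) *: phi_mx) *m
   \col_l - int0pi (fun y => int0pi (fun x =>
       sin (k.+1%:R * x) * sin (m.+1%:R * y) * mom l x y))) n 0.

Definition Lambda (h : R -> R -> R -> R) : idx -> R :=
  Lambda_solve (fun l x y => int0pi (fun a => (h x y)^`()%classic a * phi l a)).

(* Lambda for h that is only continuous. *)
Definition Lambda_cont (h : R -> R -> R -> R) : idx -> R :=
  Lambda_solve (fun l x y => h x y pi * phi l pi - h x y 0 * phi l 0
    - int0pi (fun a => h x y a * (phi l)^`()%classic a)).

Definition Fpq (p q : R -> R -> R -> R -> R) (Q : H) (z : R) : idx -> R :=
  Lambda_cont (fun x y a => Ex p q Q x y z a ^+ 2 + Ey p q Q x y z a ^+ 2).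

Definition v0hat : idx -> R := Lambda v0.

Definition qhat (q : R -> R -> R -> R -> R) (z : R) : idx -> R :=
  Lambda (fun x y a => q x y z a).

Definition Jfun (lam alpha : R) (p q : R -> R -> R -> R -> R) (Q : H) : R :=
  expR (- 2 * lam * B1) *
    \int[mu]_(z in `[B1, B2])
      ((\sum_i (Q i z - Fpq p q Q z i - v0hat i - qhat q z i) ^+ 2)
       * expR (2 * lam * z))
  + alpha * `|Q| ^+ 2.

Definition ball_set (r : R) (q : R -> R -> R -> R -> R) (d : R) : set H :=
  [set Q | `|Q| < r /\
    forall x y z a, clG (x, y, z) -> 0 <= a <= pi ->
      q x y z a + VQ Q x y z a > - d].

Definition lo4 : 'rV[R]_4 := \row_i [:: 0; 0; B1; 0]`_i.
Definition hi4 : 'rV[R]_4 := \row_i [:: pi; pi; B2; pi]`_i.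
Definition lo3 : 'rV[R]_3 := const_mx 0.
Definition hi3 : 'rV[R]_3 := const_mx pi.

Definition vec4 (q : R -> R -> R -> R -> R) (u : 'rV[R]_4) : R :=
  q (u 0 0) (u 0 1) (u 0 2%:R) (u 0 3%:R).

Definition top3 (p : R -> R -> R -> R -> R) (u : 'rV[R]_3) : R :=
  p (u 0 0) (u 0 1) B2 (u 0 2%:R).

(* Derivative in z relative to [B1,B2]: one-sided at the end points. *)
Definition dz_within (f : R -> R) (z D : R) : Prop :=
  (fun t => (f t - f z) / (t - z)) @ within `[B1, B2] z^' --> D.

Definition data_pair (p q : R -> R -> R -> R -> R) : Prop :=
  [/\ C1box lo3 hi3 (top3 p),
      C1box lo4 hi4 (vec4 q),
      forall x y z a, bd1G (x, y, z) -> 0 < a < pi ->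
        exists2 D, dz_within (fun t => p x y t a) z D
                 & q x y z a = D ^+ 2 - v0 x y a
    & forall x y a, 0 < x < pi -> 0 < y < pi -> 0 < a < pi ->
        q x y B1 a = 0].

End Problem.

(* Main.v *)
From HB Require Import structures.
Require Import Defs.
From mathcomp Require Import all_boot all_order all_algebra.
From mathcomp Require Import all_classical all_reals all_analysis.
From mathcomp Require Import measurable_realfun.
From mathcomp Require Import ring lra.

Set Implicit Arguments.
Unset Strict Implicit.
Unset Printing Implicit Defensive.

Import Order.TTheory GRing.Theory Num.Theory.
Import numFieldNormedType.Exports.

Local Open Scope classical_set_scope.
Local Open Scope ring_scope.

(** Write J for J_(lambda,alpha), C for the closure of B(R,q,d) and y for the
    minimizer. One step x' = T(x - k J'(x)) contracts the distance to y for two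
    reasons. The hypothesis says that J is strongly convex on C with modulus
    2 alpha. Conversely J admits a quadratic upper bound
      J(x') - J(x) - J'(x)(x' - x) <= M |x' - x|^2   on C.
    If k M <= 1/2, these two inequalities, the minimality of y and the
    variational inequality of the projection give
      |x' - y|^2 <= (1 - 2 alpha k) |x - y|^2
    ([gradient_step_contracts]), so theta = sqrt (1 - 2 alpha k). Comparing
    values of J rather than gradients matters: the usual contraction estimate
    for x |-> x - k J'(x) would need k of the order of alpha, whereas here k is
    limited by M alone, and M has to be independent of alpha, p and q.

    The existence of M, together with the differentiability of J, comes from a
    calculus of second order expansions with uniform constants ([expands]). The
    map Q |-> V_Q is linear and bounded from H^1 to continuous functions, and
    J is built from it by sums, products, integrals with respect to one
    variable, and v |-> 1 / sqrt v on a set where v is bounded below; all of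
    these preserve uniform expansions ([expandsM], [expands_invsqrt],
    [expands_lower_int]). The term alpha |Q|^2 only adds alpha < 1 to M.

    Three further facts are needed. The functions under the iterated integrals
    have to be continuous in all variables, including on the faces of the box:
    a C^1 function on the box has continuous partial derivatives along each
    face parallel to the direction ([C1box_partial]), and clamping the
    coordinates makes them continuous everywhere ([expands_JC], [Jfun_clamp]).
    The derivative of J is represented by a gradient because the space is
    complete ([rapid_cauchy_L2], [H10_riesz]). Finally v stays bounded below on
    a neighbourhood of C ([closure_ball_admissible]), so that J is expanded
    around each of its points. *)

(** * Continuous functions and integrals with parameters *)

Section ContinuousFunctions.

Lemma continuous_pair (X Y Z : topologicalType) (f : X -> Y) (g : X -> Z) :
  continuous f -> continuous g -> continuous (fun x => (f x, g x)).
Proof. by move=> cf cg x; apply: cvg_pair; [exact: cf|exact: cg]. Qed.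

Lemma continuous_fst (X Y Z : topologicalType) (f : X -> Y * Z) :
  continuous f -> continuous (fun x => (f x).1).
Proof. by move=> cf x; apply: cvg_comp; [exact: cf|exact: cvg_fst]. Qed.

Lemma continuous_snd (X Y Z : topologicalType) (f : X -> Y * Z) :
  continuous f -> continuous (fun x => (f x).2).
Proof. by move=> cf x; apply: cvg_comp; [exact: cf|exact: cvg_snd]. Qed.

Lemma continuous_idfun (X : topologicalType) : continuous (fun x : X => x).
Proof. by move=> x; exact: cvg_id. Qed.

Lemma continuous_comp_fun (X Y Z : topologicalType) (f : X -> Y) (g : Y -> Z) :
  continuous f -> continuous g -> continuous (fun x => g (f x)).
Proof. by move=> cf cg x; apply: continuous_comp; [exact: cf|exact: cg]. Qed.

Lemma continuous_slice (X Y Z : topologicalType) (f : X * Y -> Z) x :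
  continuous f -> continuous (fun y => f (x, y)).
Proof.
move=> cf; apply: continuous_comp_fun cf.
by apply: continuous_pair; [exact: cst_continuous|exact: continuous_idfun].
Qed.

Context {R : realType} (X : topologicalType).
Implicit Types f g : X -> R.

Lemma continuous_add f g :
  continuous f -> continuous g -> continuous (fun x => f x + g x).
Proof. by move=> cf cg x; apply: cvgD; [exact: cf|exact: cg]. Qed.

Lemma continuous_sub f g :
  continuous f -> continuous g -> continuous (fun x => f x - g x).
Proof. by move=> cf cg x; apply: cvgB; [exact: cf|exact: cg]. Qed.

Lemma continuous_mul f g :
  continuous f -> continuous g -> continuous (fun x => f x * g x).
Proof. by move=> cf cg x; apply: cvgM; [exact: cf|exact: cg]. Qed.

End ContinuousFunctions.

Section ClampedIntegrals.
Context {R : realType}.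
Local Notation mu := (@lebesgue_measure R).
Implicit Types a b z : R.

(** Composition with [clamp a b] turns a function that is only controlled on
    [a, b] into one that is continuous and bounded on the whole line; integrals
    over [a, b] do not see the difference. *)
Definition clamp a b z : R := Num.max a (Num.min z b).

Lemma clamp_itv a b z : a <= b -> a <= clamp a b z <= b.
Proof. by move=> ab; rewrite le_max lexx/= ge_max ab ge_min lexx orbT. Qed.

Lemma clamp_id a b z : a <= z <= b -> clamp a b z = z.
Proof. by move=> /andP[az zb]; rewrite /clamp (min_idPl zb) (max_idPr az). Qed.

Lemma clamp_continuous a b : continuous (clamp a b).
Proof.
move=> z; apply: (@continuous_max _ _ (cst a) (fun z => Num.min z b)) => //.
  exact: cst_continuous.
apply: (@continuous_min _ _ id (cst b)) => //.
exact: cst_continuous.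
Qed.

Lemma within_comp_continuous (X Y Z : topologicalType) (A : set Y) (f : Y -> Z)
    (c : X -> Y) : {within A, continuous f} -> continuous c ->
  (forall x, A (c x)) -> continuous (f \o c).
Proof.
move=> cf cc Ac x.
have /subspace_continuousP/(_ _ (Ac x)) fA := cf.
have cA : c @ x --> within A (nbhs (c x)).
  move=> U WU; have WU' : nbhs (c x) [set y | A y -> U y] by exact: WU.
  have : nbhs x (c @^-1` [set y | A y -> U y]) := cc x _ WU'.
  by apply: (@filterS _ (nbhs x)) => y /=; apply; exact: Ac.
have fA' : f @ within A (nbhs (c x)) --> f (c x) := fA.
exact: (@cvg_comp _ _ _ c f _ _ _ cA fA').
Qed.

Lemma continuous_itv_integrable (f : R -> R) a b : continuous f ->
  mu.-integrable `[a, b] (EFin \o f).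
Proof.
move=> cf; apply: continuous_compact_integrable; first exact: segment_compact.
exact: continuous_subspaceT.
Qed.

Lemma continuous_openitv_integrable (f : R -> R) a b : continuous f ->
  mu.-integrable `]a, b[ (EFin \o f).
Proof.
move=> cf; apply: integrableS (continuous_itv_integrable a b cf) => //.
exact: subset_itv_oo_cc.
Qed.

Lemma Rintegral_oo_cc (f : R -> R) a b : continuous f ->
  \int[mu]_(s in `]a, b[) f s = \int[mu]_(s in `[a, b]) f s.
Proof.
move=> cf; rewrite Rintegral_itv_bndo_bndc; last first.
  exact: continuous_openitv_integrable.
rewrite Rintegral_itv_obnd_cbnd//.
apply: integrableS (continuous_itv_integrable a b cf) => //.
exact: subset_itv_oc_cc.
Qed.

Lemma Rintegral_itv_cst a b (c : R) : a <= b ->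
  \int[mu]_(s in `[a, b]) c = c * (b - a).
Proof.
move=> ab; rewrite Rintegral_cst//=; congr (_ * _).
rewrite lebesgue_measure_itv/= lte_fin; case: ltP => //= ba.
by apply/esym/eqP; rewrite subr_eq0 eq_le ab ba.
Qed.

Lemma normr_Rintegral_le (f : R -> R) a b (M : R) : continuous f -> a <= b ->
  (forall s, a <= s <= b -> `|f s| <= M) ->
  `|\int[mu]_(s in `[a, b]) f s| <= M * (b - a).
Proof.
move=> cf ab fM.
have fi := continuous_itv_integrable a b cf.
apply: (le_trans (le_normr_Rintegral _ fi)) => //.
rewrite -Rintegral_itv_cst//; apply: le_Rintegral => //.
- by move: fi => /integrable_norm; congr integrable.
- by apply: continuous_itv_integrable; exact: cst_continuous.
Qed.

(** Compactness of the segment makes the continuity in the parameter uniform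
    along the segment. *)
Lemma near_uniform_itv (X : topologicalType) (f : X * R -> R) a b (x0 : X) e :
  continuous f -> 0 < e ->
  \forall x \near x0, forall s, a <= s <= b -> `|f (x, s) - f (x0, s)| < e.
Proof.
move=> cf e0.
have /compact_near_coveringP/near_covering_withinP cK : compact `[a,
  b]%classic := @segment_compact R a b.
suff H : \forall x \near x0,
    `[a, b]%classic `<=` (fun s => `|f (x, s) - f (x0, s)| < e).
  by apply: filterS H => x xK s sab; apply: xK; rewrite /= in_itv.
apply: cK => s sab.
have /cvgrPdist_lt/(_ (e / 2)) := cf (x0, s); rewrite divr_gt0// => /(_ isT).
case=> -[U V] /= [Ux0 Vs] UV.
exists (V, U) => //= -[t x] /= [Vt Ux] _.
have H1 : `|f (x0, s) - f (x, t)| < e / 2 by apply: (UV (x, t)).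
have H2 : `|f (x0, s) - f (x0, t)| < e / 2.
  by apply: (UV (x0, t)); split => //=; exact: nbhs_singleton.
have -> : f (x, t) - f (x0, t) = (f (x0, s) - f (x0, t)) - (f (x0, s) - f (x,
  t)).
  by ring.
by rewrite (le_lt_trans (ler_normB _ _))// (splitr e) ltrD.
Qed.

(** The increment is split into a change of the parameter, small by the uniform
    continuity along the segment, and a change of the lower limit only. *)
Lemma Rintegral_lower_continuous (X : topologicalType) (f : X * R -> R) a b :
  a <= b -> continuous f ->
  continuous (fun w : X * R => \int[mu]_(s in `[clamp a b w.2, b]) f (w.1, s)).
Proof.
move=> ab cf [x0 z0].
have cfx x : continuous (fun s => f (x, s)) by exact: continuous_slice.
have lowE z x : \int[mu]_(s in `[clamp a b z, b]) f (x, s) =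
    \int[mu]_(s in `[a, b]) f (x, s) -
    \int[mu]_(s in `[a, clamp a b z]) f (x, s).
  have /andP[az zb] := clamp_itv z ab.
  rewrite Rintegral_itvB ?bnd_simp//; last exact: continuous_itv_integrable.
  rewrite Rintegral_itv_obnd_cbnd//.
  apply: integrableS (continuous_itv_integrable (clamp a b z) b (cfx x)) => //.
  exact: subset_itv_oc_cc.
have clow : continuous (fun z => \int[mu]_(s in `[clamp a b z, b]) f (x0, s)).
  rewrite (_ : (fun z => _) = fun z => \int[mu]_(s in `[a, b]) f (x0, s) -
    \int[mu]_(s in `[a, clamp a b z]) f (x0, s)); last first.
    by apply/funext => z; exact: lowE.
  move=> z; apply: cvgB; first exact: cst_continuous.
  apply: (@within_comp_continuous _ _ _ `[a, b]%classic
    (fun z => \int[mu]_(s in `[a, z]) f (x0, s)) (clamp a b)) => //.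
  - apply: (@parameterized_integral_continuous R a b (fun s => f (x0, s))) =>
    //.
    exact: continuous_itv_integrable.
  - exact: clamp_continuous.
  - by move=> y; rewrite /= in_itv/= clamp_itv.
apply/cvgrPdist_le => /= e e0.
have c0 : 0 < b - a + 1 by rewrite ltr_wpDl// subr_ge0.
have e1 : 0 < e / 2 / (b - a + 1) by rewrite !divr_gt0.
have tube := near_uniform_itv a b x0 cf e1.
have /cvgrPdist_lt/(_ (e / 2)) := clow z0; rewrite divr_gt0// => /(_ isT) zz.
exists ([set x | forall s, a <= s <= b -> `|f (x, s) - f (x0,
  s)| < e / 2 / (b - a + 1)],
   [set z | `|\int[mu]_(s in `[clamp a b z0, b]) f (x0, s) -
     \int[mu]_(s in `[clamp a b z, b]) f (x0, s)| < e / 2]) => //=.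
move=> [x z] /= [xs zs].
set I0 := \int[mu]_(_ in _) _ in zs *.
set I1 := \int[mu]_(_ in _) _ in zs *.
set I2 := \int[mu]_(_ in _) _.
have -> : I0 - I2 = (I0 - I1) + (I1 - I2) by ring.
rewrite (le_trans (ler_normD _ _))// (splitr e) lerD// ?(ltW zs)//.
have /andP[az zb] := clamp_itv z ab.
rewrite /I1 /I2 -RintegralB//; [|exact: continuous_itv_integrable..].
apply: (@le_trans _ _ (e / 2 / (b - a + 1) * (b - clamp a b z))).
  apply: normr_Rintegral_le => //.
    by move=> s; apply: cvgB; exact: cfx.
  move=> s /andP[s1 s2]; rewrite distrC ltW// xs// s2 andbT.
  exact: le_trans s1.
rewrite mulrAC ler_pdivrMr// ler_wpM2l ?divr_ge0 ?(ltW e0)//; lra.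
Qed.

End ClampedIntegrals.

(** * Uniform second order expansions *)

Section SecondOrderCalculus.
Context {R : realType} {V : normedModType R} {P : Type} (D : P -> set V).
Local Notation mu := (@lebesgue_measure R).

(** [L] is the derivative of [F] at [Q], taken pointwise in the parameter [x].
    A single constant bounds the value, the derivative and the remainder, so
    that it can be propagated through sums, products and integrals. *)
Definition quad_expansion (X : topologicalType) (M : R) (S : set V)
    (F : V -> X -> R) (Q : V) (L : V -> X -> R) : Prop :=
  [/\ continuous (F Q) /\ (forall x, `|F Q x| <= M),
      forall h, continuous (L h),
      forall c h k x, L (c *: h + k) x = c * L h x + L k x,
      forall h x, `|L h x| <= M * `|h|
    & forall h x, S (Q + h) ->
        `|F (Q + h) x - F Q x - L h x| <= M * `|h| ^+ 2].

(** The index [t] stands for the data of the problem: the constant is chosen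
    before [t], which is what makes the final step size independent of the
    data and of the regularization parameter. *)
Definition expands (X : topologicalType) (F : P -> V -> X -> R) : Prop :=
  exists2 M, 0 <= M & forall t Q, D t Q ->
    exists L, quad_expansion M (D t) (F t) Q L.

Lemma quad_expansion_le (X : topologicalType) M M' S (F : V -> X -> R) Q L :
  M <= M' -> quad_expansion M S F Q L -> quad_expansion M' S F Q L.
Proof.
move=> MM' [[cF FM] cL lL LM rem]; split => //.
- by split => // x; exact: le_trans MM'.
- by move=> h x; rewrite (le_trans (LM h x))// ler_wpM2r.
- by move=> h x /rem - /(_ x) H; rewrite (le_trans H)// ler_wpM2r// sqr_ge0.
Qed.

Lemma expands2 (X Y : topologicalType) (F : P -> V -> X -> R)
    (G : P -> V -> Y -> R) : expands F -> expands G ->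
  exists2 M, 0 <= M & forall t Q, D t Q ->
    exists L L', quad_expansion M (D t) (F t) Q L /\
                 quad_expansion M (D t) (G t) Q L'.
Proof.
move=> [M M0 HF] [M' M'0 HG]; exists (M + M'); first exact: addr_ge0.
move=> t Q DQ; have [L FL] := HF t Q DQ; have [L' GL'] := HG t Q DQ.
exists L, L'; split.
  by apply: quad_expansion_le FL; rewrite lerDl.
by apply: quad_expansion_le GL'; rewrite lerDr.
Qed.

(** For |h| <= 1 this is the expansion itself, and for |h| > 1 it follows from
    the bound 2 M of the difference. *)
Lemma lipschitz_expansion (X : topologicalType) M (S : set V)
    (F : V -> X -> R) Q L h L' :
  quad_expansion M S F Q L -> quad_expansion M S F (Q + h) L' -> S (Q + h) ->
  forall x, `|F (Q + h) x - F Q x| <= 2 * M * `|h|.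
Proof.
move=> [[_ FM] _ _ LM rem] [[_ FM'] _ _ _ _] Sh x.
have M0 : 0 <= M by apply: le_trans (FM x).
have [h1|h1] := leP `|h| 1.
  have -> : F (Q + h) x - F Q x = (F (Q + h) x - F Q x - L h x) + L h x by ring.
  rewrite (le_trans (ler_normD _ _))//.
  rewrite (le_trans (lerD (rem h x Sh) (LM h x)))//.
  have -> : 2 * M * `|h| = M * `|h| * 1 + M * `|h| by ring.
  by rewrite lerD2r expr2 mulrA ler_wpM2l// mulr_ge0.
rewrite (le_trans (ler_normB _ _))// (le_trans (lerD (FM' x) (FM x)))//.
have -> : M + M = 2 * M * 1 by ring.
by rewrite ler_wpM2l ?mulr_ge0// ltW.
Qed.

Lemma expands_cst (X : topologicalType) (f : P -> X -> R) :
  (exists M, forall t Q, D t Q ->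
     continuous (f t) /\ forall x, `|f t x| <= M) ->
  expands (fun t _ => f t).
Proof.
move=> [M fM]; exists (Num.max 0 M); first by rewrite le_max lexx.
move=> t Q DQ; exists (fun _ _ => 0); have [cf {}fM] := fM t Q DQ.
split=> //.
- by split=> // x; rewrite le_max fM orbT.
- by move=> h; exact: cst_continuous.
- by move=> *; rewrite mulr0 addr0.
- by move=> h x; rewrite normr0 mulr_ge0// le_max lexx.
- move=> h x _; rewrite subrr subr0 normr0 mulr_ge0// ?sqr_ge0//.
  by rewrite le_max lexx.
Qed.

(** A linear map is its own derivative; the boundedness of the domains gives the
    bound of its values. *)
Lemma expands_lin (X : topologicalType) (T : V -> X -> R) C r :
  0 <= C -> 0 <= r -> (forall t Q, D t Q -> `|Q| <= r) ->
  (forall h, continuous (T h)) ->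
  (forall c h k x, T (c *: h + k) x = c * T h x + T k x) ->
  (forall h x, `|T h x| <= C * `|h|) ->
  expands (fun _ Q => T Q).
Proof.
move=> C0 r0 Dr cT lT TC; exists (C + C * r); first by rewrite addr_ge0//
  mulr_ge0.
move=> t Q DQ; exists T; split=> //.
- split=> // x; rewrite (le_trans (TC Q x))// -[leLHS]add0r lerD//.
  by rewrite ler_wpM2l//; exact: Dr DQ.
- move=> h x; rewrite (le_trans (TC h x))// ler_wpM2r// lerDl.
  exact: mulr_ge0.
- move=> h x _.
  have -> : T (Q + h) x = T Q x + T h x.
    by have := lT 1 Q h x; rewrite scale1r mul1r.
  have -> : T Q x + T h x - T Q x - T h x = 0 by ring.
  rewrite normr0 mulr_ge0// ?sqr_ge0//.
  by rewrite addr_ge0// mulr_ge0.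
Qed.

Lemma expands_comp (X Y : topologicalType) (g : Y -> X) (F : P -> V -> X -> R) :
  continuous g -> expands F -> expands (fun t Q y => F t Q (g y)).
Proof.
move=> cg [M M0 HF]; exists M => // t Q DQ; have [L [[cF FM] cL lL LM rem]] :=
  HF t Q DQ.
exists (fun h y => L h (g y)); split=> //.
- by split => //; exact: continuous_comp_fun cF.
- by move=> h; exact: continuous_comp_fun (cL h).
- by move=> h y; exact: rem.
Qed.

Lemma expandsD (X : topologicalType) (F G : P -> V -> X -> R) :
  expands F -> expands G -> expands (fun t Q x => F t Q x + G t Q x).
Proof.
move=> HF HG; have [M M0 FG] := expands2 HF HG.
exists (2 * M); first by rewrite mulr_ge0.
move=> t Q DQ.
have [L [L' [[[cF FM] cL lL LM rem] [[cG GM] cL' lL' LM' rem']]]] := FG t Q DQ.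
exists (fun h x => L h x + L' h x); split.
- split; first exact: continuous_add.
  move=> x; rewrite (le_trans (ler_normD _ _))//.
  by have := FM x; have := GM x; lra.
- by move=> h; exact: continuous_add.
- by move=> c h k x; rewrite lL lL'; ring.
- move=> h x; rewrite (le_trans (ler_normD _ _))//.
  by have := LM h x; have := LM' h x; lra.
- move=> h x Dh.
  have -> : F t (Q + h) x + G t (Q + h) x - (F t Q x + G t Q x) - (L h x + L' h
    x) =
    (F t (Q + h) x - F t Q x - L h x) + (G t (Q + h) x - G t Q x - L' h x) by
      ring.
  rewrite (le_trans (ler_normD _ _))//.
  by have := rem h x Dh; have := rem' h x Dh; lra.
Qed.

Lemma expandsM (X : topologicalType) (F G : P -> V -> X -> R) :
  expands F -> expands G -> expands (fun t Q x => F t Q x * G t Q x).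
Proof.
move=> HF HG; have [M M0 FG] := expands2 HF HG.
exists (4 * M ^+ 2); first by rewrite mulr_ge0// sqr_ge0.
move=> t Q DQ; have [L [L' [FL GL]]] := FG t Q DQ.
have [[cF FM] cL lL LM rem] := FL; have [[cG GM] cL' lL' LM' rem'] := GL.
exists (fun h x => F t Q x * L' h x + G t Q x * L h x); split.
- split; first exact: continuous_mul.
  move=> x; rewrite normrM (@le_trans _ _ (M * M))//; first by rewrite ler_pM.
  by rewrite -expr2 ler_peMl ?sqr_ge0// ler1n.
- by move=> h; apply: continuous_add; exact: continuous_mul.
- by move=> c h k x; rewrite lL lL'; ring.
- move=> h x; rewrite (le_trans (ler_normD _ _))// !normrM.
  rewrite (@le_trans _ _ (M * (M * `|h|) + M * (M * `|h|)))//.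
    by rewrite lerD// ler_pM.
  have -> : M * (M * `|h|) + M * (M * `|h|) = 2 * M ^+ 2 * `|h| by ring.
  by rewrite !ler_wpM2r ?sqr_ge0// ler_nat.
- move=> h x Dh; have [L1 [L2 [FL1 GL2]]] := FG t (Q + h) Dh.
  have [[_ GM'] _ _ _ _] := GL2.
  have lip := lipschitz_expansion GL GL2 Dh x.
  have -> : F t (Q + h) x * G t (Q + h) x - F t Q x * G t Q x -
      (F t Q x * L' h x + G t Q x * L h x) =
    (F t (Q + h) x - F t Q x - L h x) * G t (Q + h) x +
    F t Q x * (G t (Q + h) x - G t Q x - L' h x) +
    L h x * (G t (Q + h) x - G t Q x) by ring.
  rewrite (le_trans (ler_normD _ _))//.
  have -> : 4 * M ^+ 2 * `|h| ^+ 2 = (M * `|h| ^+ 2 * M + M * (M * `|h| ^+ 2)) +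
    M * `|h| * (2 * M * `|h|) by ring.
  rewrite lerD//; last by rewrite normrM ler_pM.
  by rewrite (le_trans (ler_normD _ _))// lerD// normrM ler_pM// ?rem ?rem'.
Qed.

Lemma expandsZ (X : topologicalType) c (F : P -> V -> X -> R) :
  expands F -> expands (fun t Q x => c * F t Q x).
Proof.
move=> HF; apply: (@expandsM X (fun _ _ _ => c)) => //.
apply: expands_cst; exists `|c| => t Q _; split => //.
exact: cst_continuous.
Qed.

Lemma expandsB (X : topologicalType) (F G : P -> V -> X -> R) :
  expands F -> expands G -> expands (fun t Q x => F t Q x - G t Q x).
Proof.
move=> HF /(expandsZ (- 1)) HG; have := expandsD HF HG.
by under eq_fun do under eq_fun do under eq_fun do rewrite mulN1r.
Qed.

Lemma expands_sum (X : topologicalType) (I : Type) (s : seq I)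
    (F : I -> P -> V -> X -> R) : (forall i, expands (F i)) ->
  expands (fun t Q x => \sum_(i <- s) F i t Q x).
Proof.
move=> HF; elim: s => [|i s IH].
  under eq_fun do under eq_fun do under eq_fun do rewrite big_nil.
  apply: (@expands_cst _ (fun _ _ => 0)); exists 0 => t Q _.
  by split; [exact: cst_continuous|move=> ?; rewrite normr0].
under eq_fun do under eq_fun do under eq_fun do rewrite big_cons.
exact: expandsD.
Qed.

Lemma expands_sqr (X : topologicalType) (F : P -> V -> X -> R) :
  expands F -> expands (fun t Q x => F t Q x ^+ 2).
Proof.
move=> HF; have := expandsM HF HF.
by under eq_fun do under eq_fun do under eq_fun do rewrite -expr2.
Qed.

(** Exact remainder of the first order expansion of v |-> 1 / sqrt v between
    v = r^2 and v' = r'^2. *)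
Lemma invsqrt_taylor (r r' : R) : 0 < r -> 0 < r' ->
  r'^-1 - r^-1 + (r' ^+ 2 - r ^+ 2) / (2 * r ^+ 3) =
  (r' ^+ 2 - r ^+ 2) ^+ 2 * ((r' + 2 * r) / ((r + r') ^+ 2 * (2 * r ^+ 3 *
    r'))).
Proof.
move=> r0 r'0; field.
by rewrite !gt_eqF// addr_gt0.
Qed.

(** The lower bound [e] keeps [F] away from the singularity of 1 / sqrt v; the
    remainder is that of the outer function plus the remainder of [F]
    multiplied by the derivative of the outer function. *)
Lemma expands_invsqrt (X : topologicalType) (e : R) (F : P -> V -> X -> R) :
  0 < e -> (forall t Q, D t Q -> forall x, e <= F t Q x) ->
  expands F -> expands (fun t Q x => (Num.sqrt (F t Q x))^-1).
Proof.
move=> e0 eF [M M0 HF]; pose s := Num.sqrt e.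
have s0 : 0 < s by rewrite sqrtr_gt0.
have sF t Q x : D t Q -> s <= Num.sqrt (F t Q x).
  by move=> DQ; rewrite ler_wsqrtr// eF.
have rF t Q x : D t Q -> Num.sqrt (F t Q x) ^+ 2 = F t Q x.
  by move=> DQ; rewrite sqr_sqrtr// (le_trans (ltW e0))// eF.
pose M' := s^-1 + M / (2 * s ^+ 3) + (2 * M) ^+ 2 / (2 * s ^+ 5).
have A1 : 0 <= s^-1 by rewrite invr_ge0 ltW.
have A2 : 0 <= M / (2 * s ^+ 3) by rewrite divr_ge0// mulr_ge0// exprn_ge0//
  ltW.
have A3 : 0 <= (2 * M) ^+ 2 / (2 * s ^+ 5).
  by rewrite divr_ge0 ?sqr_ge0// mulr_ge0// exprn_ge0// ltW.
exists M'; first by rewrite /M' !addr_ge0.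
move=> t Q DQ; have [L FL] := HF t Q DQ; have [[cF FM] cL lL LM rem] := FL.
have r0 x : 0 < Num.sqrt (F t Q x) by rewrite (lt_le_trans s0)// sF.
have s3 (r : R) : s <= r -> (2 * r ^+ 3)^-1 <= (2 * s ^+ 3)^-1.
  move=> sr; have {}r0 := lt_le_trans s0 sr.
  rewrite lef_pV2 ?posrE ?mulr_gt0 ?exprn_gt0//.
  by rewrite ler_pM2l// lerXn2r// ?nnegrE ltW.
have cV : continuous (fun x => (Num.sqrt (F t Q x))^-1).
  move=> x; apply: cvgV; first by rewrite gt_eqF.
  by apply: (continuous_comp_fun cF); exact: sqrt_continuous.
pose L1 (h : V) (x : X) : R := - (L h x / (2 * Num.sqrt (F t Q x) ^+ 3)).
exists L1; rewrite {}/L1; split.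
- split=> // x; rewrite ger0_norm ?invr_ge0 ?sqrtr_ge0//.
  rewrite (@le_trans _ _ s^-1)//; last by rewrite /M' -addrA lerDl addr_ge0.
  by rewrite lef_pV2 ?posrE// sF.
- move=> h.
  rewrite (_ : (fun x => _) = fun x =>
    - 2^-1 * (L h x * ((Num.sqrt (F t Q x))^-1 *
    ((Num.sqrt (F t Q x))^-1 * (Num.sqrt (F t Q x))^-1)))); last first.
    by apply/funext => x; field; rewrite gt_eqF.
  apply: continuous_mul; first exact: cst_continuous.
  by do 3 (apply: continuous_mul => //).
- by move=> c h k x; rewrite lL; ring.
- move=> h x; rewrite normrN normrM.
  rewrite (ger0_norm (x := _^-1)) ?invr_ge0 ?mulr_ge0 ?exprn_ge0 ?sqrtr_ge0//.
  rewrite (@le_trans _ _ (M * `|h| / (2 * s ^+ 3)))//.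
    by rewrite ler_pM// ?invr_ge0 ?mulr_ge0 ?exprn_ge0 ?sqrtr_ge0 ?s3 ?sF.
  rewrite mulrAC ler_wpM2r// /M'; lra.
- move=> h x Dh; have [L' FL'] := HF t (Q + h) Dh.
  have := lipschitz_expansion FL FL' Dh x.
  have := rem h x Dh.
  have sr := sF t Q x DQ; have sr' := sF t (Q + h) x Dh.
  have [r rE] : exists r, r = Num.sqrt (F t Q x) by eexists.
  have [r' r'E] : exists r, r = Num.sqrt (F t (Q + h) x) by eexists.
  have Er : F t Q x = r ^+ 2 by rewrite rE rF.
  have Er' : F t (Q + h) x = r' ^+ 2 by rewrite r'E rF.
  rewrite -rE -r'E Er Er'; rewrite -rE in sr; rewrite -r'E in sr'.
  have {}r0 : 0 < r := lt_le_trans s0 sr.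
  have r'0 : 0 < r' := lt_le_trans s0 sr'.
  move=> H1 H2.
  have -> : r'^-1 - r^-1 - - (L h x / (2 * r ^+ 3)) =
    (r'^-1 - r^-1 + (r' ^+ 2 - r ^+ 2) / (2 * r ^+ 3)) -
    (r' ^+ 2 - r ^+ 2 - L h x) / (2 * r ^+ 3) by ring.
  rewrite invsqrt_taylor// (le_trans (ler_normB _ _))//.
  rewrite (@le_trans _ _ ((2 * M * `|h|) ^+ 2 / (2 * s ^+ 5) + M * `|h| ^+ 2 /
    (2 * s ^+ 3)))//.
    rewrite lerD//.
      rewrite normrM normrX ler_pM//.
        by rewrite lerXn2r// ?nnegrE// ?mulr_ge0.
      rewrite ger0_norm; last first.
        by rewrite divr_ge0// ?mulr_ge0 ?exprn_ge0 ?addr_ge0// ?mulr_ge0// ltW.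
      rewrite ler_pdivrMr ?mulr_gt0 ?exprn_gt0 ?addr_gt0//.
      rewrite [leRHS]mulrC ler_pdivlMr ?mulr_gt0 ?exprn_gt0//.
      have -> : (r + r') ^+ 2 * (2 * r ^+ 3 * r') = 2 * (r + r') * ((r + r') *
        (r ^+ 3 * r')) by ring.
      have -> : (r' + 2 * r) * (2 * s ^+ 5) = (r' + 2 * r) * ((s + s) * (s ^+ 3
        * s)) by ring.
      rewrite ler_pM//.
      * by rewrite addr_ge0// ?mulr_ge0// ltW.
      * by rewrite !mulr_ge0// ?addr_ge0// ?mulr_ge0// ?exprn_ge0// ltW.
      * by lra.
      * rewrite ler_pM// ?lerD//.
        - by rewrite addr_ge0// ltW.
        - by rewrite mulr_ge0// ?exprn_ge0// ltW.
        - by rewrite ler_pM// ?exprn_ge0 ?(ltW s0)// lerXn2r// nnegrE ltW.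
    rewrite normrM ler_pM//.
    rewrite ger0_norm ?invr_ge0 ?mulr_ge0 ?exprn_ge0 ?(ltW r0)//.
    exact: s3.
  have -> : (2 * M * `|h|) ^+ 2 / (2 * s ^+ 5) + M * `|h| ^+ 2 / (2 * s ^+ 3) =
    ((2 * M) ^+ 2 / (2 * s ^+ 5) + M / (2 * s ^+ 3)) * `|h| ^+ 2 by ring.
  by rewrite ler_wpM2r ?sqr_ge0// /M'; lra.
Qed.

(** By linearity of the integral an expansion may be integrated term by term;
    the parametric continuity of the integral provides the integrability needed
    when further integrals are applied. *)
Lemma expands_lower_int (X : topologicalType) (F : P -> V -> X * R -> R) a b :
  a <= b -> expands F ->
  expands (fun t Q (w : X * R) =>
    \int[mu]_(s in `[clamp a b w.2, b]) F t Q (w.1, s)).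
Proof.
move=> ab [M M0 HF]; exists (M * (b - a)); first by rewrite mulr_ge0// subr_ge0.
move=> t Q DQ; have [L [[cF FM] cL lL LM rem]] := HF t Q DQ.
exists (fun h w => \int[mu]_(s in `[clamp a b w.2, b]) L h (w.1, s)).
have cs (f : X * R -> R) x : continuous f -> continuous (fun s => f (x, s)).
  exact: continuous_slice.
have bound (f : X * R -> R) (w : X * R) C : continuous f -> 0 <= C ->
    (forall s, `|f (w.1, s)| <= C) ->
    `|\int[mu]_(s in `[clamp a b w.2, b]) f (w.1, s)| <= C * (b - a).
  move=> cf C0 fC; have /andP[az zb] := clamp_itv w.2 ab.
  apply: (@le_trans _ _ (C * (b - clamp a b w.2))).
    by apply: normr_Rintegral_le => //; exact: cs.
  by rewrite ler_wpM2l// lerB.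
split.
- split; first exact: Rintegral_lower_continuous.
  by move=> w; exact: bound.
- by move=> h; exact: Rintegral_lower_continuous.
- move=> c h k w.
  rewrite -RintegralZl//; last exact/continuous_itv_integrable/cs.
  rewrite -RintegralD//; last 2 first.
  + apply: continuous_itv_integrable; apply: continuous_mul; last exact: cs.
    exact: cst_continuous.
  + exact/continuous_itv_integrable/cs.
  by apply: eq_Rintegral => s _; rewrite lL.
- move=> h w; rewrite -mulrA [X in _ * X]mulrC mulrA.
  by apply: bound => //; rewrite mulr_ge0.
- move=> h w Dh; have [L' [[cF' _] _ _ _ _]] := HF t (Q + h) Dh.
  rewrite -RintegralB//; [|exact/continuous_itv_integrable/cs..].
  rewrite -RintegralB//; last 2 first.
  + by apply: continuous_itv_integrable; apply: continuous_sub; exact: cs.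
  + exact/continuous_itv_integrable/cs.
  rewrite -mulrA [X in _ * X]mulrC mulrA.
  apply: (bound (fun u => F t (Q + h) u - F t Q u - L h u)).
  + by do 2 (apply: continuous_sub => //).
  + by rewrite mulr_ge0// sqr_ge0.
  + by move=> s; exact: rem.
Qed.

Lemma expands_int (X : topologicalType) (F : P -> V -> X * R -> R) a b :
  a <= b -> expands F ->
  expands (fun t Q (x : X) => \int[mu]_(s in `[a, b]) F t Q (x, s)).
Proof.
move=> ab /(expands_lower_int ab) HF.
have caa : clamp a b a = a by rewrite clamp_id// lexx.
have cg : continuous (fun x : X => (x, a)).
  by apply: continuous_pair; [exact: continuous_idfun|exact: cst_continuous].
by have := expands_comp cg HF; rewrite /= caa.
Qed.

End SecondOrderCalculus.

(** * Completeness of L_2 on a segment *)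

Section RieszFischer.
Context {R : realType}.
Local Notation mu := (@lebesgue_measure R).

(** With d_j = f_(j+1) - f_j, the weights 2^j let the single sum of 2^j d_j^2
    control all the tails of the telescoping sum at once, by (u + v)^2 <=
    2 u^2 + 2 v^2 at each step. *)
Lemma weighted_telescope (f : nat -> R) (k n : nat) :
  (f (k + n)%N - f k) ^+ 2 <=
  2 * 2^-1 ^+ k * \sum_(k <= j < k + n) 2 ^+ j * (f j.+1 - f j) ^+ 2.
Proof.
elim: n k => [|n IH] k.
  by rewrite addn0 subrr expr0n big_geq// mulr0.
rewrite big_ltn ?addnS ?ltnS ?leq_addr// -addSn.
set S := \sum_(_ <= _ < _) _.
have : (f (k.+1 + n)%N - f k.+1) ^+ 2 <= 2 * 2^-1 ^+ k.+1 * S := IH k.+1.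
have -> : f (k.+1 + n)%N - f k = (f (k.+1 + n)%N - f k.+1) + (f k.+1 - f k) by
  ring.
move: (f _ - f k.+1) (f k.+1 - f k) => u v.
have e2 : 2^-1 ^+ k * 2 ^+ k = 1 :> R by rewrite -exprMn mulVf ?expr1n.
have -> : 2 * 2^-1 ^+ k.+1 * S = 2^-1 ^+ k * S by rewrite exprS; field.
have -> : 2 * 2^-1 ^+ k * (2 ^+ k * v ^+ 2 + S) =
  2 * v ^+ 2 * (2^-1 ^+ k * 2 ^+ k) + 2 * (2^-1 ^+ k * S) by ring.
rewrite e2 mulr1 => uS.
have := sqr_ge0 (u - v); nra.
Qed.

Lemma sum_half_le n : \sum_(0 <= j < n) 2^-1 ^+ j <= (2 : R).
Proof.
suff -> : \sum_(0 <= j < n) 2^-1 ^+ j = 2 - 2 * 2^-1 ^+ n :> R.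
  by rewrite gerBl mulr_ge0// exprn_ge0.
elim: n => [|n IH]; first by rewrite big_geq// expr0 mulr1 subrr.
by rewrite big_nat_recr//= IH exprS; field.
Qed.

Lemma half_pow_cvg0 : (fun n => 2^-1 ^+ n) @ \oo --> (0 : R).
Proof.
by apply: cvg_expr; rewrite ger0_norm ?invr_ge0// invf_lt1// ltr1n.
Qed.

Lemma half_pow_small (c e : R) : 0 <= c -> 0 < e -> exists n, c * 2^-1 ^+ n < e.
Proof.
move=> c0 e0.
have c1 : 0 < c + 1 by lra.
have /cvgrPdist_lt/(_ (e / (c + 1))) := half_pow_cvg0.
rewrite divr_gt0// => /(_ isT)[n _ /(_ n (leqnn n))].
rewrite sub0r normrN ger0_norm ?exprn_ge0 ?invr_ge0// ltr_pdivlMr// => nP.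
exists n; apply: le_lt_trans nP; rewrite mulrC ler_wpM2l ?exprn_ge0 ?invr_ge0//.
lra.
Qed.

Lemma weighted_cauchy (f : nat -> R) (s : R) :
  (forall n, \sum_(0 <= j < n) 2 ^+ j * (f j.+1 - f j) ^+ 2 <= s) ->
  exists l, f @ \oo --> l /\
    forall k, (l - f k) ^+ 2 <= 2 * 2^-1 ^+ k * s.
Proof.
move=> fs.
have s0 : 0 <= s by have := fs 0%N; rewrite big_geq.
have step k n : (k <= n)%N -> (f n - f k) ^+ 2 <= 2 * 2^-1 ^+ k * s.
  move=> /subnKC <-; apply: le_trans (weighted_telescope f k (n - k)) _.
  rewrite ler_wpM2l ?mulr_ge0 ?exprn_ge0 ?invr_ge0//.
  apply: le_trans (fs (k + (n - k))%N).
  rewrite (@big_cat_nat _ _ _ k 0)//= ?leq_addr// lerDr.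
  by apply: sumr_ge0 => j _; rewrite mulr_ge0 ?sqr_ge0// exprn_ge0.
have fc : cvg (f @ \oo).
  apply/cauchy_cvgP/cauchy_exP => e e0.
  have [k kP] := @half_pow_small (2 * s) (e ^+ 2) (mulr_ge0 (ler0n R 2) s0)
    (exprn_gt0 2 e0).
  exists (f k); exists k => // n /= kn; rewrite /ball/= distrC.
  rewrite -(@ltr_pXn2r _ 2)// ?nnegrE ?(ltW e0)// real_normK ?num_real//.
  by apply: le_lt_trans kP; rewrite mulrAC; exact: step.
exists (lim (f @ \oo)); split => // k.
have H : (f n - f k) ^+ 2 @[n --> \oo] --> (lim (f @ \oo) - f k) ^+ 2.
  under eq_fun do rewrite expr2; rewrite expr2.
  by apply: cvgM; (apply: cvgB; [exact: fc|exact: cvg_cst]).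
rewrite -(cvg_lim _ H)//; apply: limr_le; first exact: cvgP H.
by exists k => // n /= kn; exact: step.
Qed.

(** Riesz-Fischer for a rapidly Cauchy sequence. The function
    S = sum of 2^j (f_(j+1) - f_j)^2 has a finite integral, hence is finite
    almost everywhere; where it is finite the sequence converges and its
    distance to the limit is controlled pointwise by S. *)
Lemma rapid_cauchy_L2 (a b C : R) (f : nat -> R -> R) : 0 <= C ->
  (forall n, sqint a b (f n)) ->
  (forall n, \int[mu]_(x in `[a, b]) (f n.+1 x - f n x) ^+ 2 <=
     C * (2^-1 ^+ n * 2^-1 ^+ n)) ->
  exists2 g, sqint a b g & forall n,
    \int[mu]_(x in `[a, b]) (g x - f n x) ^+ 2 <= 4 * C * 2^-1 ^+ n.
Proof.
move=> C0 sf fC.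
pose D : set (measurableTypeR R) := `[a, b]%classic.
have mD : measurable D by exact: measurable_itv.
have mf n : measurable_fun D (f n) := (sf n).1.
have sB u v : sqint a b u -> sqint a b v -> sqint a b (fun x => u x - v x).
  move=> su sv; have := sqintD (- 1) sv su.
  by congr sqint; apply/funext => x; rewrite mulN1r addrC.
have iB u v : sqint a b u -> sqint a b v ->
    mu.-integrable D (EFin \o (fun x => (u x - v x) ^+ 2)).
  by move=> su sv; have [] := sB u v su sv.
pose w j x : \bar R := (2 ^+ j * (f j.+1 x - f j x) ^+ 2)%:E.
have w0 j x : D x -> (0 <= w j x)%E.
  by move=> _; rewrite lee_fin mulr_ge0 ?sqr_ge0// exprn_ge0.
have mw j : measurable_fun D (w j).
  apply/measurable_EFinP/measurable_funM; first exact: measurable_cst.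
  by have /measurable_int/measurable_EFinP := iB _ _ (sf j.+1) (sf j).
pose S x := (\sum_(j <oo) w j x)%E.
have S0 x : (0 <= S x)%E.
  by apply: nneseries_ge0 => j _ _; rewrite lee_fin mulr_ge0 ?sqr_ge0//
    exprn_ge0.
have mS : measurable_fun D S.
  exact: (ge0_emeasurable_sum (P := xpredT) (fun j x Dx _ =>
    w0 j x Dx) (fun j _ => mw j)).
have IS : (\int[mu]_(x in D) S x <= (2 * C)%:E)%E.
  rewrite integral_nneseries//; apply: lime_le.
    by apply: is_cvg_nneseries => j _ _; apply: integral_ge0 => x; exact: w0.
  apply: nearW => n.
  apply: (@le_trans _ _ (\sum_(0 <= j < n) (C * 2^-1 ^+ j)%:E)%E); last first.
    rewrite sumEFin lee_fin -mulr_sumr mulrC ler_wpM2r//; exact: sum_half_le.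
  apply: lee_sum => j _.
  have ij := iB _ _ (sf j.+1) (sf j).
  rewrite /w; under eq_integral do rewrite EFinM.
  rewrite integralZl//=.
  rewrite -[X in (_ * X)%E]fineK; last exact: integrable_fin_num.
  rewrite -EFinM lee_fin.
  apply: (@le_trans _ _ (2 ^+ j * (C * (2^-1 ^+ j * 2^-1 ^+ j)))).
    by rewrite ler_wpM2l ?exprn_ge0//; exact: fC.
  have e2 : 2 ^+ j * 2^-1 ^+ j = 1 :> R by rewrite -exprMn mulfV ?expr1n.
  have -> : 2 ^+ j * (C * (2^-1 ^+ j * 2^-1 ^+ j)) =
    C * 2^-1 ^+ j * (2 ^+ j * 2^-1 ^+ j) by ring.
  by rewrite e2 mulr1.
have iS : mu.-integrable D S.
  apply/integrableP; split => //.
  under eq_integral do rewrite gee0_abs//.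
  exact: le_lt_trans IS (ltry _).
have lS x : S x \is a fin_num -> exists l, f ^~ x @ \oo --> l /\
    forall k, (l - f k x) ^+ 2 <= 2 * 2^-1 ^+ k * fine (S x).
  move=> Sx; apply: weighted_cauchy => n.
  rewrite -lee_fin fineK//.
  apply: le_trans (nneseries_lim_ge (m := 0) (P := xpredT) n _) => [|j _ _].
    by rewrite -sumEFin lexx.
  by rewrite lee_fin mulr_ge0 ?sqr_ge0// exprn_ge0.
pose E := [set x | D x /\ S x \is a fin_num].
have mE : measurable E.
  have -> : E = D `&` S @^-1` [set y | y \is a fin_num] by [].
  apply: mS => //.
  rewrite (_ : [set _ | _] = ~` [set -oo%E] `&` ~` [set +oo%E]).
    by apply: measurableI; exact: measurableC.
  apply/seteqP; split => y /=; rewrite fin_numE.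
    by move=> /andP[/eqP ? /eqP ?].
  by move=> [/eqP yN /eqP yP]; rewrite yN yP.
(* S is infinite on a negligible set only;
  the value 0 there keeps g measurable *)
pose g x := if x \in E then lim (f ^~ x @ \oo) else 0.
have gE x k : E x -> (g x - f k x) ^+ 2 <= 2 * 2^-1 ^+ k * fine (S x).
  move=> Ex; rewrite /g mem_set//; have [l [fl lk]] := lS x Ex.2.
  by rewrite (cvg_lim _ fl).
have mg : measurable_fun D g.
  apply: (@measurable_fun_cvg _ _ _ D (fun n x => f n x * \1_E x)).
    by move=> m; apply: measurable_funM => //; exact: measurable_indic.
  move=> x Dx; rewrite /g; case: ifPn => [xE|xE].
    have [l [fl lk]] := lS x (set_mem xE).2.
    rewrite (cvg_lim _ fl)// indicE xE/=.
    by under eq_fun do rewrite mulr1.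
  rewrite indicE (negbTE xE)/=.
  by under eq_fun do rewrite mulr0; exact: cvg_cst.
have Ig k : (\int[mu]_(x in D) ((g x - f k x) ^+ 2)%:E <= (4 * C * 2^-1 ^+
  k)%:E)%E.
  apply: (@le_trans _ _ (\int[mu]_(x in D) ((2 * 2^-1 ^+ k)%:E * S x))%E).
    apply: ae_ge0_le_integral => //.
    + by move=> x _; rewrite lee_fin sqr_ge0.
    + by apply/measurable_EFinP/measurable_funX/measurable_funB.
    + move=> x _; rewrite mule_ge0// lee_fin mulr_ge0// exprn_ge0//.
    + by apply: emeasurable_funM => //; exact: measurable_cst.
    have FF := ae_filter_ringOfSetsType mu.
    apply: filterS (integrable_ae mD iS) => x xS Dx.
    rewrite -(fineK (xS Dx)) -EFinM lee_fin; apply: gE; split => //.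
    exact: xS.
  rewrite integralZl//.
  rewrite -[X in (_ * X)%E]fineK; last exact: integrable_fin_num.
  rewrite -EFinM lee_fin.
  have -> : 4 * C * 2^-1 ^+ k = 2 * 2^-1 ^+ k * (2 * C) by ring.
  rewrite ler_wpM2l ?mulr_ge0 ?exprn_ge0// -lee_fin fineK//.
  exact: integrable_fin_num.
have mgf k : measurable_fun D (fun x => (g x - f k x) ^+ 2).
  by apply/measurable_funX/measurable_funB.
have igf k : mu.-integrable D (EFin \o (fun x => (g x - f k x) ^+ 2)).
  apply/integrableP; split; first exact/measurable_EFinP.
  under eq_integral do rewrite gee0_abs ?lee_fin ?sqr_ge0//.
  exact: le_lt_trans (Ig k) (ltry _).
have sgf : sqint a b (fun x => g x - f 0%N x).
  by split; [apply: measurable_funB => //; exact: mf|exact: igf].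
exists g.
  have := sqintD 1 sgf (sf 0%N).
  by congr sqint; apply/funext => x; rewrite mul1r subrK.
move=> n; rewrite -lee_fin /Rintegral fineK; first exact: Ig.
exact: (integrable_fin_num mD (igf n)).
Qed.

End RieszFischer.

(** * Riesz representation and projected gradient steps *)

Section InnerProduct.
Context {R : realType} {V : normedModType R} (dot : V -> V -> R).
Context (dotC : forall u v, dot u v = dot v u).
Context (dotDl : forall c u v w, dot (c *: u + v) w = c * dot u w + dot v w).
Context (dot_norm : forall u, `|u| ^+ 2 = dot u u).
Implicit Types u v w h k : V.

Lemma dotD1 u v w : dot (u + v) w = dot u w + dot v w.
Proof. by have := dotDl 1 u v w; rewrite scale1r mul1r. Qed.

Lemma dot0l w : dot 0 w = 0.
Proof. by have := dotDl 1 0 0 w; rewrite scaler0 addr0 mul1r; lra. Qed.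

Lemma dotZl c u w : dot (c *: u) w = c * dot u w.
Proof. by rewrite -[c *: u]addr0 dotDl dot0l addr0. Qed.

Lemma dotBl u v w : dot (u - v) w = dot u w - dot v w.
Proof. by rewrite dotD1 -scaleN1r dotZl mulN1r. Qed.

Lemma dotBr u v w : dot w (u - v) = dot w u - dot w v.
Proof. by rewrite dotC dotBl !(dotC w). Qed.

Lemma normsqD u v : `|u + v| ^+ 2 = `|u| ^+ 2 + 2 * dot u v + `|v| ^+ 2.
Proof.
rewrite !dot_norm dotD1 !(dotC _ (u + v)) !dotD1 (dotC v u); ring.
Qed.

Lemma normsqB u v : `|u - v| ^+ 2 = `|u| ^+ 2 - 2 * dot u v + `|v| ^+ 2.
Proof.
by rewrite normsqD normrN -scaleN1r dotC dotZl (dotC v); ring.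
Qed.

Lemma normsqZ c u : `|c *: u| ^+ 2 = c ^+ 2 * `|u| ^+ 2.
Proof. by rewrite normrZ exprMn real_normK ?num_real. Qed.

Lemma dot_le u v : dot u v <= `|u| * `|v|.
Proof.
have : `|u + v| ^+ 2 <= (`|u| + `|v|) ^+ 2.
  by rewrite lerXn2r ?nnegrE ?addr_ge0// ler_normD.
by rewrite normsqD; lra.
Qed.

Lemma norm_dot_le u v : `|dot u v| <= `|u| * `|v|.
Proof.
rewrite ler_norml dot_le andbT lerNl.
have := dot_le (- u) v.
by rewrite normrN -scaleN1r dotZl mulN1r.
Qed.

(** The representative minimizes |h|^2 / 2 - l h: the parallelogram identity
    makes a minimizing sequence Cauchy, and the first variation vanishes at its
    limit. The first hypothesis is completeness for rapidly Cauchy sequences. *)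
Theorem riesz_representation (l : V -> R) (C : R) :
  (forall (un : nat -> V) (c : R), 0 <= c ->
    (forall n, `|un n.+1 - un n| ^+ 2 <= c * (2^-1 ^+ n * 2^-1 ^+ n)) ->
    exists (u : V) (c' : R), 0 <= c' /\ forall n,
      `|u - un n| ^+ 2 <= c' * 2^-1 ^+ n) ->
  (forall c h k, l (c *: h + k) = c * l h + l k) ->
  (forall h, `|l h| <= C * `|h|) ->
  exists g, forall h, l h = dot g h.
Proof.
move=> rapid lL lC.
have l1 h k : l (h + k) = l h + l k by have := lL 1 h k; rewrite scale1r mul1r.
pose F h := `|h| ^+ 2 / 2 - l h.
have Flb h : - (C ^+ 2 / 2) <= F h.
  have := lC h; rewrite ler_norml => /andP[_ lh].
  have := sqr_ge0 (C - `|h|); rewrite /F; nra.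
have Finf : has_inf (range F).
  by split; [exists (F 0), 0|exists (- (C ^+ 2 / 2)) => _ [h _ <-]].
pose m := inf (range F).
have mF h : m <= F h.
  by apply: ge_inf; [exact: Finf.2|exists h].
have e0 n : 0 < 2^-1 ^+ n * 2^-1 ^+ n :> R by rewrite mulr_gt0// exprn_gt0.
have minseq n : exists h, F h < m + 2^-1 ^+ n * 2^-1 ^+ n.
  by have [_ [h _ <-] hm] := inf_adherent (e0 n) Finf; exists h.
have [hn hnP] := choice minseq.
have par h k : `|h - k| ^+ 2 = 4 * (F h + F k) - 8 * F (2^-1 *: (h + k)).
  have Z0 : l 0 = 0 by have := l1 0 0; rewrite addr0; lra.
  have lZ c h' : l (c *: h') = c * l h' by rewrite -[c *: h']addr0 lL Z0 addr0.
  by rewrite /F normsqZ normsqB normsqD lZ l1; field.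
have [||Q [C' [C'0 Qlim]]] := @rapid hn 8.
- by [].
- move=> n; rewrite par.
  have := hnP n; have := hnP n.+1; have := mF (2^-1 *: (hn n.+1 + hn n)).
  have -> : 2^-1 ^+ n.+1 * 2^-1 ^+ n.+1 = 4^-1 * (2^-1 ^+ n * 2^-1 ^+ n) :> R.
    by rewrite !exprS; field.
  by have := e0 n; lra.
exists Q => v.
(* first variation at the approximate minimizer h_n in the direction t v *)
have var t n : 0 <= t * (dot (hn n) v - l v) + t ^+ 2 * `|v| ^+ 2 / 2 + 2^-1 ^+
  n.
  have := mF (t *: v + hn n); have := hnP n.
  rewrite /F lL normsqD normsqZ dotZl dotC.
  have : 2^-1 ^+ n * 2^-1 ^+ n <= 2^-1 ^+ n :> R.
    by rewrite ler_piMr ?exprn_ge0 ?exprn_ile1// invf_le1// ler1n.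
  by lra.
have limt t : 0 <= t * (dot Q v - l v) + t ^+ 2 * `|v| ^+ 2 / 2.
  apply/ler_addgt0Pr => e ep.
  pose K := `|t| * `|v|.
  have K0 : 0 <= K by rewrite mulr_ge0.
  have CK0 : 0 <= K ^+ 2 * C' by rewrite mulr_ge0// sqr_ge0.
  have ep2 : 0 < (e / 2) ^+ 2 by rewrite exprn_gt0// divr_gt0.
  have [n1 n1P] := half_pow_small CK0 ep2.
  have ep3 : 0 < e / 2 by rewrite divr_gt0.
  have [n2 n2P] := half_pow_small (ler01 : 0 <= 1 :> R) ep3.
  pose n := maxn n1 n2.
  have mono (k : nat) : (k <= n)%N -> 2^-1 ^+ n <= 2^-1 ^+ k :> R.
    by move=> kn; rewrite ler_wiXn2l// invf_le1// ler1n.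
  have := var t n.
  have d1 : K * `|hn n - Q| < e / 2.
    have Kn : K * `|Q - hn n| \is Num.nneg by rewrite nnegrE mulr_ge0.
    have en : e / 2 \is Num.nneg by rewrite nnegrE ltW.
    rewrite distrC -(@ltr_pXn2r _ 2)//.
    apply: le_lt_trans n1P; rewrite [leLHS]exprMn -[leRHS]mulrA.
    apply: ler_wpM2l; first exact: sqr_ge0.
    by rewrite (le_trans (Qlim n))// ler_wpM2l// mono// leq_maxl.
  have d2 : t * dot (hn n - Q) v <= K * `|hn n - Q|.
    rewrite (le_trans (ler_norm _))// normrM /K -mulrA ler_wpM2l// mulrC.
    exact: norm_dot_le.
  have d3 := dotBl (hn n) Q v.
  rewrite d3 in d2.
  have := mono n2 (leq_maxr _ _).
  rewrite mul1r in n2P.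
  by lra.
move: limt; set d := dot Q v - l v => limt.
suff : d = 0 by rewrite /d; lra.
apply/eqP; apply/negPn/negP => d0.
have dd : 0 < d ^+ 2 by rewrite lt_def sqr_ge0 sqrf_eq0 d0.
have v0 : 0 <= `|v| ^+ 2 by exact: sqr_ge0.
(* this step would decrease the functional strictly if d were not 0 *)
have := limt (- d / (`|v| ^+ 2 + 1)).
have v1 : 0 < `|v| ^+ 2 + 1 by lra.
have -> : - d / (`|v| ^+ 2 + 1) * d + (- d / (`|v| ^+ 2 + 1)) ^+ 2 * `|v| ^+ 2
  / 2 =
  - (d ^+ 2 * (`|v| ^+ 2 + 2) / (2 * (`|v| ^+ 2 + 1) ^+ 2)).
  by field; rewrite gt_eqF.
suff H : 0 < d ^+ 2 * (`|v| ^+ 2 + 2) / (2 * (`|v| ^+ 2 + 1) ^+ 2) by lra.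
have v2 : 0 < `|v| ^+ 2 + 2 by lra.
apply: divr_gt0; first exact: mulr_gt0.
by apply: mulr_gt0 => //; exact: exprn_gt0.
Qed.

(** Otherwise a small step from [p] towards [y] would come closer to [x]. *)
Lemma projection_dot_le (S : set V) (x y p : V) :
  (forall u v t, S u -> S v -> 0 < t <= 1 -> S (u + t *: (v - u))) ->
  S p -> S y -> (forall z, S z -> `|x - p| <= `|x - z|) ->
  dot (x - p) (y - p) <= 0.
Proof.
move=> cS Sp Sy pmin; rewrite leNgt; apply/negP => d0.
set d := dot _ _ in d0.
pose W := `|y - p| ^+ 2.
have W0 : 0 <= W by exact: sqr_ge0.
have W1 : 0 < W + 1 by lra.
(* any t in (0, 1] with t |y - p|^2 < 2 d contradicts the minimality *)
pose t := Num.min 1 (d / (W + 1)).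
have t0 : 0 < t by rewrite lt_min ltr01 divr_gt0.
have t1 : t <= 1 by rewrite ge_min lexx.
have tW : t * (W + 1) <= d by rewrite -ler_pdivlMr// ge_min lexx orbT.
have := pmin _ (cS p y t Sp Sy _); rewrite t0 t1 => /(_ isT).
have -> : x - (p + t *: (y - p)) = (x - p) - t *: (y - p) by rewrite opprD
  addrA.
rewrite -(@ler_pXn2r _ 2)// ?nnegrE// (normsqB (x - p)) normsqZ.
rewrite (dotC _ (t *: _)) dotZl (dotC (y - p)) -/d -/W.
by nra.
Qed.

(** One step of the projected gradient method. The quadratic upper bound at the
    new point [x'], the strong convexity at the minimizer [y] and J y <= J x'
    are added to the variational inequality of the projection; what remains is
    the contraction. Only the constant [M] of the upper bound restricts the
    step [k], while the convexity modulus [al] enters the rate alone. *)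
Lemma gradient_step_contracts (J : V -> R) (g x x' y : V) (M al k : R) :
  0 < k -> k * M <= 2^-1 ->
  J x' - J x - dot g (x' - x) <= M * `|x' - x| ^+ 2 ->
  al * `|y - x| ^+ 2 <= J y - J x - dot g (y - x) ->
  J y <= J x' ->
  dot (x - k *: g - x') (y - x') <= 0 ->
  `|x' - y| ^+ 2 <= (1 - 2 * al * k) * `|x - y| ^+ 2.
Proof.
move=> k0 kM desc conv Jy.
rewrite !dotBl dotZl.
have e1 : `|x' - y| ^+ 2 = `|y - x| ^+ 2 - 2 * dot (y - x) (x' - x) + `|x' - x|
  ^+ 2.
  by rewrite -normsqB distrC opprB addrA subrK.
have e2 : `|x - y| = `|y - x| by rewrite distrC.
have e3 : dot x (y - x') - dot x' (y - x') =
   `|x' - x| ^+ 2 - dot (y - x) (x' - x).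
  have -> : y - x' = (y - x) - (x' - x) by rewrite opprB addrA subrK.
  rewrite -dotBl -(opprB x' x) dotBr -scaleN1r !dotZl -dot_norm.
  by rewrite (dotC _ (y - x)); ring.
have e4 : dot g (y - x') = dot g (y - x) - dot g (x' - x).
  by rewrite -dotBr opprB addrA subrK.
rewrite e1 e2 (_ : _ - k * _ - _ = (dot x (y - x') - dot x' (y - x')) - k * dot
  g (y - x')); last by ring.
rewrite e3 e4.
move: desc conv.
set dd := dot (y - x) _; set a := dot g _; set b := dot g _.
set n1 := `|x' - x| ^+ 2; set n2 := `|y - x| ^+ 2.
have n10 : 0 <= n1 by exact: sqr_ge0.
move=> desc conv vi.
have H1 : k * (al * n2 + b - a) <= k * (M * n1) by rewrite ler_pM2l//; lra.
have H2 : k * (M * n1) <= 2^-1 * n1 by rewrite mulrA ler_wpM2r.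
lra.
Qed.

End InnerProduct.

Section ProjectedGradient.
Context {R : realType} {V : normedModType R} (dot : V -> V -> R).
Context (dotC : forall u v, dot u v = dot v u).
Context (dotDl : forall c u v w, dot (c *: u + v) w = c * dot u w + dot v w).
Context (dot_norm : forall u, `|u| ^+ 2 = dot u u).
Implicit Types (u v w x y z : V) (S : set V).

Definition is_convex S : Prop :=
  forall u v t, S u -> S v -> 0 < t <= 1 -> S (u + t *: (v - u)).

Lemma closure_normP S u :
  closure S u <-> forall e : R, 0 < e -> exists2 v, S v & `|u - v| < e.
Proof.
split => [Su e e0|H U /nbhs_ballP[e /= e0 eU]].
  have [v [Sv uv]] := Su _ (nbhsx_ballx u e e0).
  by exists v => //; move: uv; rewrite -ball_normE.
have [v Sv uv] := H e e0; exists v; split => //; apply: eU.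
by rewrite -ball_normE.
Qed.

Lemma convex_norm_lt u v (t e : R) : 0 < t <= 1 -> `|u| < e -> `|v| < e ->
  `|u + t *: (v - u)| < e.
Proof.
move=> /andP[t0 t1] ue ve; have t1' : 0 <= 1 - t by rewrite subr_ge0.
have -> : u + t *: (v - u) = (1 - t) *: u + t *: v.
  by rewrite scalerBr scalerBl scale1r -[RHS]addrA (addrC (- (t *: u))).
rewrite (le_lt_trans (ler_normD _ _))// !normrZ (gtr0_norm t0) (ger0_norm t1').
have H1 : (1 - t) * `|u| <= (1 - t) * e by rewrite ler_wpM2l// ltW.
have H2 : t * `|v| < t * e by rewrite ltr_pM2l.
by apply: (lt_le_trans (ler_ltD H1 H2)); rewrite -mulrDl subrK mul1r.
Qed.

Lemma closure_convex S : is_convex S -> is_convex (closure S).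
Proof.
move=> cS u v t /closure_normP Su /closure_normP Sv t01.
apply/closure_normP => e e0.
have [u' Su' uu'] := Su e e0; have [v' Sv' vv'] := Sv e e0.
exists (u' + t *: (v' - u')); first exact: cS.
have -> : u + t *: (v - u) - (u' + t *: (v' - u')) =
    (u - u') + t *: ((v - v') - (u - u')).
  rewrite opprD addrACA -scalerBr; congr (_ + _ *: _).
  by rewrite !opprB addrACA [RHS]addrACA [- u + _]addrC.
exact: convex_norm_lt.
Qed.

(** A quadratic remainder is in particular o(h). *)
Lemma differentiable_quadratic (J : V -> R) x (l : V -> R) (C M D : R) :
  (forall c h k, l (c *: h + k) = c * l h + l k) ->
  (forall h, `|l h| <= C * `|h|) -> 0 < D ->
  (forall h, `|h| < D -> `|J (x + h) - J x - l h| <= M * `|h| ^+ 2) ->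
  differentiable J x /\ forall h, 'd J x h = l h.
Proof.
move=> lL lC D0 rem.
pose L : {linear V -> R} := HB.pack_for {linear V -> R} l
  (GRing.isLinear.Build R V R *%R l lL).
have cL : continuous L.
  apply/bounded_linear_continuous/linear_boundedP.
  exists C; split; first exact: num_real.
  by move=> s Cs h; rewrite (le_trans (lC h))// ler_wpM2r// ltW.
have E : J \o shift x = cst (J x) + L +o_ 0 id.
  apply/eqaddoP => e e0; have M0 : 0 < `|M| + 1 by rewrite ltr_wpDl.
  have d0 : 0 < Num.min D (e / (`|M| + 1)) by rewrite lt_min D0 divr_gt0.
  apply/nbhs_ballP; exists (Num.min D (e / (`|M| + 1))) => //= h.
  rewrite -ball_normE /= sub0r normrN lt_min => /andP[hD he].
  rewrite -[X in `|X|]/(J (h + x) - (J x + l h)) opprD addrA [h + x]addrC.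
  apply: le_trans (rem h hD) _; rewrite expr2 mulrA ler_wpM2r//.
  rewrite (le_trans (ler_norm _))// normrM normr_id.
  rewrite ltr_pdivlMr// in he; rewrite mulrC; apply: le_trans (ltW he).
  by rewrite ler_wpM2l// lerDl.
have dE := diff_unique cL E.
split; last by move=> h; rewrite dE.
by apply/diff_locallyP; rewrite dE.
Qed.

Theorem projected_gradient_converges (J : V -> R) S (grad T : V -> V) y
    (M al k : R) :
  is_convex S -> S y -> (forall x, S x -> J y <= J x) ->
  (forall x, S (T x) /\ forall z, S z -> `|x - T x| <= `|x - z|) ->
  (forall x x', S x -> S x' ->
     J x' - J x - dot (grad x) (x' - x) <= M * `|x' - x| ^+ 2) ->
  (forall x, S x -> al * `|y - x| ^+ 2 <= J y - J x - dot (grad x) (y - x)) ->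
  0 < k -> k * M <= 2^-1 -> 0 <= 1 - 2 * al * k ->
  forall un : nat -> V, S (un 0%N) ->
    (forall n, un n.+1 = T (un n - k *: grad (un n))) ->
  forall n, `|un n - y| <= Num.sqrt (1 - 2 * al * k) ^+ n * `|un 0%N - y|.
Proof.
move=> cS Sy ymin proj desc conv k0 kM th0 un S0 unE.
have Sun n : S (un n) by case: n => [//|n]; rewrite unE;
  case: (proj (un n - k *: grad (un n))).
elim=> [|n IH]; first by rewrite expr0 mul1r.
rewrite exprS -mulrA; apply: (@le_trans _ _ (Num.sqrt (1 - 2 * al * k) * `|un n
  - y|)).
  have [Sx' pmin] := proj (un n - k *: grad (un n)).
  rewrite -unE in Sx' pmin.
  have vi := projection_dot_le dotC dotDl dot_norm cS Sx' Sy pmin.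
  have := gradient_step_contracts dotC dotDl dot_norm k0 kM
    (desc _ _ (Sun n) Sx') (conv _ (Sun n)) (ymin _ Sx') vi.
  move=> H; rewrite -(@ler_pXn2r _ 2)// ?nnegrE ?mulr_ge0 ?sqrtr_ge0//.
  by rewrite exprMn sqr_sqrtr.
by rewrite ler_wpM2l ?sqrtr_ge0.
Qed.

End ProjectedGradient.

(** * The Hilbert space H10 *)

Section RieszRepresentation.
Context {R : realType} (a b : R) (I : finType) (hab : a < b).
Local Notation mu := (@lebesgue_measure R).
Local Notation H := (H10 a b I).
Implicit Types Q P h k : H.

Lemma H10_normE Q : `|Q| = H1norm Q. Proof. by []. Qed.

Lemma H10_normsq Q : `|Q| ^+ 2 = H1dot Q Q.
Proof. by rewrite H10_normE H1norm_sqr. Qed.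

Lemma wderivB Q P i : weak_deriv a b ((Q - P) i)
  (fun s => wderiv a b (Q i) s - wderiv a b (P i) s).
Proof.
have := weak_derivD (- 1) (wderivP P i) (wderivP Q i).
congr weak_deriv; apply/funext => s; last by rewrite mulN1r addrC.
by rewrite mulN1r addrC.
Qed.

(** |u z| is at most the integral of |g|; the Cauchy-Schwarz inequality for that
    integral is obtained by integrating the square of |g| minus its mean. *)
Lemma weak_deriv_sup (u g : R -> R) z : weak_deriv a b u g ->
  u z ^+ 2 <= (b - a) * \int[mu]_(x in `[a, b]) (g x * g x).
Proof.
move=> [sg ->].
have mab : measurable (`[a, b]%classic : set (measurableTypeR R)) by [].
have gi := sqint_int sg.
have ngi : mu.-integrable `[a, b] (EFin \o (fun x => `|g x|)).
  by have /integrable_norm := gi; congr integrable.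
have ba : 0 < b - a by rewrite subr_gt0.
set t := \int[mu]_(x in `[a, b]) (g x * g x).
pose n := \int[mu]_(x in `[a, b]) `|g x|.
have n0 : 0 <= n by apply: Rintegral_ge0 => x _.
have H1 : `|\int[mu]_(s in `[a, Num.min z b]) g s| <= n.
  have giz := integrable_minr z sg.
  apply: (le_trans (le_normr_Rintegral _ giz)) => //.
  rewrite /n.
  have sub : `[a, Num.min z b]%classic `<=` `[a, b]%classic.
    by apply: subset_itvl; rewrite bnd_simp ge_min lexx orbT.
  rewrite -lee_fin /Rintegral !fineK; last 2 first.
  - exact: integrable_fin_num.
  - by apply: integrable_fin_num => //; exact: integrableS ngi.
  apply: ge0_subset_integral => //=.
  by have /measurable_int := ngi.
have sn : sqint a b (fun x => `|g x|).
  split; first by apply: measurableT_comp => //; exact: sg.1.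
  by have := sg.2; congr integrable; apply/funext => x /=;
    rewrite real_normK ?num_real.
have H2 : n ^+ 2 <= (b - a) * t.
  pose c := n / (b - a).
  have : 0 <= \int[mu]_(x in `[a, b]) ((`|g x| - c) * (`|g x| - c)).
    by apply: Rintegral_ge0 => x _; rewrite -expr2 sqr_ge0.
  have sc := sqint_cst a b (- c).
  have sgc : sqint a b (fun s => 1 * `|g s| + cst (- c) s) by exact: sqintD.
  rewrite (_ : \int[mu]_(x in _) _ = t - 2 * c * n + c ^+ 2 * (b - a)).
    have -> : t - 2 * c * n + c ^+ 2 * (b - a) = t - n ^+ 2 / (b - a).
      by rewrite /c; field; rewrite gt_eqF.
    by rewrite subr_ge0 ler_pdivrMr// mulrC.
  under eq_Rintegral => x _.
    rewrite (_ : _ * _ = (1 * `|g x| + cst (- c) x) * (`|g x| + - c));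
      last by rewrite mul1r.
    over.
  have e1 : \int[mu]_(z in `[a, b]) ((1 * `|g z| + cst (- c) z) * (`|g z| + -
    c)) =
    \int[mu]_(z in `[a, b]) ((1 * `|g z| + cst (- c) z) * (1 * `|g z| + cst (-
      c) z)).
    by apply: eq_Rintegral => x _; rewrite mul1r.
  rewrite e1 sqint_dot//.
  have e2 f : sqint a b f -> \int[mu]_(z in `[a,
    b]) (f z * (1 * `|g z| + cst (- c) z)) =
     \int[mu]_(z in `[a, b]) (`|g z| * f z) - c * \int[mu]_(z in `[a, b]) f z.
    move=> sf; under eq_Rintegral do rewrite mulrC.
    rewrite sqint_dot// mul1r; congr (_ + _).
    by rewrite RintegralZl ?mulNr//; exact: sqint_int.
  rewrite !e2//.
  rewrite Rintegral_itv_cst ?(ltW hab)//.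
  have e3 : \int[mu]_(z in `[a, b]) (`|g z| * cst (- c) z) = - c * n.
    under eq_Rintegral do rewrite mulrC.
    by rewrite RintegralZl.
  have e4 : \int[mu]_(z in `[a, b]) (`|g z| * `|g z|) = t.
    by apply: eq_Rintegral => x _; rewrite -normrM ger0_norm// -expr2 sqr_ge0.
  by rewrite e3 e4 -/n; ring.
apply: le_trans H2.
by rewrite -(real_normK (num_real (\int[mu]_(_ in _) _))) lerXn2r// nnegrE.
Qed.

Lemma wderiv_sq_le Q i :
  \int[mu]_(x in `[a, b]) (wderiv a b (Q i) x * wderiv a b (Q i) x) <= `|Q| ^+
    2.
Proof.
rewrite H10_normsq /H1dot (bigD1 i)//= addrCA lerDl addr_ge0 ?L2dot_ge0//.
by apply: sumr_ge0 => j _; apply: Rintegral_ge0 => x _; rewrite -expr2 sqr_ge0.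
Qed.

Lemma H10_sup Q i z : `|Q i z| <= Num.sqrt (b - a) * `|Q|.
Proof.
have ba : 0 <= b - a by rewrite subr_ge0 ltW.
rewrite -(@ler_pXn2r _ 2)// ?nnegrE ?mulr_ge0 ?sqrtr_ge0//.
rewrite real_normK ?num_real// exprMn sqr_sqrtr//.
apply: le_trans (weak_deriv_sup z (wderivP Q i)) _.
by rewrite ler_wpM2l// wderiv_sq_le.
Qed.

(** Poincare inequality: the derivative controls the whole norm because the
    functions vanish at [a]. *)
Lemma H10_normsq_le Q (C : R) :
  (forall i, \int[mu]_(x in `[a, b])
     (wderiv a b (Q i) x * wderiv a b (Q i) x) <= C) ->
  `|Q| ^+ 2 <= #|I|%:R * ((b - a) ^+ 2 + 1) * C.
Proof.
move=> QC; rewrite H10_normsq /H1dot /L2dot -big_split/=.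
rewrite [leRHS](_ : _ = \sum_(i : I) ((b - a) ^+ 2 + 1) * C); last first.
  by rewrite sumr_const -[RHS]mulr_natl mulrA.
apply: ler_sum => i _; rewrite mulrDl mul1r lerD//.
have ba : 0 < b - a by rewrite subr_gt0.
apply: (@le_trans _ _ (\int[mu]_(x in `[a, b]) ((b - a) * C))).
  apply: le_Rintegral => //.
  - by have [] := sqint_H10 Q i.
  - by apply: continuous_itv_integrable; exact: cst_continuous.
  - move=> x _; rewrite -expr2 (le_trans (weak_deriv_sup x (wderivP Q i)))//.
    by rewrite ler_wpM2l// ltW.
rewrite Rintegral_itv_cst ?(ltW hab)//.
by rewrite le_eqVlt; apply/orP; left; apply/eqP; ring.
Qed.

(** Completeness is inherited from L_2: the derivatives converge there, and the
    limit in the space is the primitive of their limit. *)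
Lemma H10_rapid_cauchy (Qn : nat -> H) (C : R) : 0 <= C ->
  (forall n, `|Qn n.+1 - Qn n| ^+ 2 <= C * (2^-1 ^+ n * 2^-1 ^+ n)) ->
  exists (Q : H) (C' : R), 0 <= C' /\ forall n,
    `|Q - Qn n| ^+ 2 <= C' * 2^-1 ^+ n.
Proof.
move=> C0 QC.
have wB Q P i : \int[mu]_(x in `[a,
  b]) (wderiv a b ((Q - P) i) x * wderiv a b ((Q - P) i) x) =
    \int[mu]_(x in `[a, b]) (wderiv a b (Q i) x - wderiv a b (P i) x) ^+ 2.
  have D1 := wderivP (Q - P) i; have D2 := wderivB Q P i.
  rewrite (weak_deriv_int D1 D2 D1.1).
  under eq_Rintegral do rewrite mulrC.
  by rewrite (weak_deriv_int D1 D2 D2.1); apply: eq_Rintegral => x _;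
    rewrite expr2.
have lim i : exists g, sqint a b g /\ forall n,
    \int[mu]_(x in `[a, b]) (g x - wderiv a b (Qn n i) x) ^+ 2 <= 4 * C * 2^-1
      ^+ n.
  have [|n|g sg gP] := @rapid_cauchy_L2 R a b C (fun n =>
    wderiv a b (Qn n i)) C0.
  - by move=> n; have [] := wderivP (Qn n) i.
  - by rewrite -wB (le_trans (wderiv_sq_le _ _)).
  - by exists g.
have [g gP] := choice lim.
pose Q0 (i : I) z := \int[mu]_(s in `[a, Num.min z b]) g i s.
have HQ : Q0 \in @H10_pred R a b I.
  by apply/asboolP => i; exists (g i); split => //; have [] := gP i.
pose Q : H := MkH10 HQ.
exists Q, (#|I|%:R * ((b - a) ^+ 2 + 1) * (4 * C)); split.
  by rewrite !mulr_ge0// addr_ge0// sqr_ge0.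
move=> n; rewrite -mulrA; apply: H10_normsq_le => i.
rewrite wB; have [sg gn] := gP i.
have wg : weak_deriv a b (Q i) (g i) by [].
have D := wderivP Q i.
apply: le_trans (gn n); rewrite le_eqVlt; apply/orP; left; apply/eqP.
have D1 := weak_derivD (- 1) (wderivP (Qn n) i) D.
have D2 := weak_derivD (- 1) (wderivP (Qn n) i) wg.
transitivity (\int[mu]_(x in `[a,
  b]) ((- 1 * wderiv a b (Qn n i) x + wderiv a b (Q i) x) *
   (- 1 * wderiv a b (Qn n i) x + wderiv a b (Q i) x))).
  by apply: eq_Rintegral => x _; ring.
rewrite (weak_deriv_int D1 D2 D1.1).
under eq_Rintegral do rewrite mulrC.
by rewrite (weak_deriv_int D1 D2 D2.1); apply: eq_Rintegral => x _; ring.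
Qed.

Theorem H10_riesz (l : H -> R) (C : R) :
  (forall c h k, l (c *: h + k) = c * l h + l k) ->
  (forall h, `|l h| <= C * `|h|) ->
  exists g, forall h, l h = H1dot g h.
Proof.
apply: (@riesz_representation R H (@H1dot R a b I)).
- exact: H1dotC.
- exact: H1dotDl.
- exact: H10_normsq.
- exact: H10_rapid_cauchy.
Qed.

End RieszRepresentation.

(** * C^1 functions up to the boundary of a box *)

Section BoxDerivatives.
Context {R : realType} {n : nat} (lo hi : 'rV[R]_n).
Context (lohi : forall j, lo 0 j < hi 0 j).
Local Notation e_ i := (delta_mx 0 i : 'rV[R]_n).
Implicit Types (u w c : 'rV[R]_n) (f g : 'rV[R]_n -> R).

Lemma continuous_row (X : topologicalType) (F : 'I_n -> X -> R) :
  (forall j, continuous (F j)) -> continuous (fun x => \row_j F j x).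
Proof.
move=> cF x U [P PU PsubU].
have : \forall y \near x, forall j, P 0 j (F j y).
  apply: filter_forall => j; apply: (cF j x).
  by have := PU 0 j; rewrite mxE.
apply: (@filterS _ (nbhs x)) => y yP; apply: PsubU => i j.
by rewrite ord1 mxE.
Qed.

Lemma cbox_compact : compact (cbox lo hi).
Proof.
exact: (@rV_compact R n (fun i => `[lo 0 i, hi 0 i]%classic)
  (fun i => @segment_compact R _ _)).
Qed.

Lemma obox_cbox u : obox lo hi u -> cbox lo hi u.
Proof. by move=> uo i; have /andP[/ltW -> /ltW ->] := uo i. Qed.

Definition clampv u : 'rV[R]_n := \row_j clamp (lo 0 j) (hi 0 j) (u 0 j).

Lemma clampv_cbox u : cbox lo hi (clampv u).
Proof. by move=> i; rewrite mxE; apply: clamp_itv; rewrite ltW. Qed.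

Lemma clampv_id u : cbox lo hi u -> clampv u = u.
Proof. by move=> uc; apply/rowP => j; rewrite mxE clamp_id. Qed.

Lemma clampv_continuous : continuous clampv.
Proof.
apply: continuous_row => j; apply: (@continuous_comp_fun _ _ _ (fun u =>
  u 0 j)).
  exact: coord_continuous.
exact: clamp_continuous.
Qed.

Lemma within_cbox_eps f u e : {within cbox lo hi, continuous f} ->
  cbox lo hi u -> 0 < e ->
  exists2 d, 0 < d & forall w, cbox lo hi w ->
    (forall j, `|u 0 j - w 0 j| < d) -> `|f u - f w| < e.
Proof.
move=> /subspace_continuousP/(_ u) + uc => /(_ uc) /cvgrPdist_lt + e0.
move=> /(_ e e0) /nbhs_ballP[d /= d0 dP]; exists d => // w wc uw.
apply: dP => //; split => // i j; rewrite ord1; exact: uw.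
Qed.

(** Together with the next lemma: points of the closed box are limits of
    interior points along segments. *)
Lemma shrink_obox u c e : cbox lo hi u -> obox lo hi c -> 0 < e <= 1 ->
  obox lo hi (u + e *: (c - u)).
Proof.
move=> uc co /andP[e0 e1] j; rewrite !mxE.
have /andP[u1 u2] := uc j; have /andP[c1 c2] := co j.
have -> : u 0 j + e * (c 0 j - u 0 j) = (1 - e) * u 0 j + e * c 0 j by ring.
have e1' : 0 <= 1 - e by rewrite subr_ge0.
have H1 := ler_wpM2l e1' u1; have H2 := ler_wpM2l e1' u2.
rewrite -(ltr_pM2l e0) in c1; rewrite -(ltr_pM2l e0) in c2.
by apply/andP; split; lra.
Qed.

Lemma shrink_near u c d : cbox lo hi u -> obox lo hi c -> 0 < d ->
  exists2 e, 0 < e <= 1 & forall j, `|u 0 j - (u + e *: (c - u)) 0 j| < d.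
Proof.
move=> uc co d0; pose W := \sum_j (hi 0 j - lo 0 j).
have W0 : 0 <= W by apply: sumr_ge0 => j _; rewrite subr_ge0 ltW.
have dW : 0 < d / (W + 1) by rewrite divr_gt0// ltr_wpDl.
exists (Num.min 1 (d / (W + 1)));
  first by rewrite lt_min ltr01 dW/= ge_min lexx.
move=> j; rewrite !mxE opprD addrA subrr sub0r normrN normrM.
have ucW : `|c 0 j - u 0 j| <= W.
  have /andP[u1 u2] := uc j; have /andP[c1 c2] := co j.
  apply: (@le_trans _ _ (hi 0 j - lo 0 j)); first by rewrite ler_norml; lra.
  rewrite /W (bigD1 j)//= lerDl; apply: sumr_ge0 => k _.
  by rewrite subr_ge0 ltW.
rewrite ger0_norm; last by rewrite le_min ler01 ltW.
apply: (@le_lt_trans _ _ (d / (W + 1) * W)).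
  by rewrite ler_pM ?le_min ?ler01 ?(ltW dW)//= ge_min lexx orbT.
by rewrite mulrAC ltr_pdivrMr ?ltr_wpDl// ltr_pM2l// ltrDl.
Qed.

Definition center : 'rV[R]_n := \row_j ((lo 0 j + hi 0 j) / 2).

Lemma center_obox : obox lo hi center.
Proof. by move=> j; rewrite mxE; have := lohi j; lra. Qed.

Lemma within_cbox_bounded f : {within cbox lo hi, continuous f} ->
  exists M, forall u, cbox lo hi u -> `|f u| <= M.
Proof.
move=> cf; have cc := obox_cbox center_obox.
have cn : {within cbox lo hi, continuous (fun u => `|f u|)}.
  by move=> u; apply: cvg_norm; exact: cf.
have [|c _ cP] := @compact_EVT_max _ R (fun u =>
  `|f u|) (cbox lo hi) _ cbox_compact cn.
  by exists center.
by exists `|f c| => u uc; apply: cP; rewrite inE.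
Qed.

Lemma within_cbox_le f A : {within cbox lo hi, continuous f} ->
  (forall u, obox lo hi u -> `|f u| <= A) ->
  forall u, cbox lo hi u -> `|f u| <= A.
Proof.
move=> cf fA u uc; apply/ler_addgt0Pr => e e0.
have [d d0 dP] := within_cbox_eps cf uc e0.
have [t t01 tP] := shrink_near uc center_obox d0.
have wo := shrink_obox uc center_obox t01.
have := dP _ (obox_cbox wo) tP; have := fA _ wo.
set w := u + _ => fw fuw.
have -> : f u = (f u - f w) + f w by ring.
by rewrite (le_trans (ler_normD _ _))//; lra.
Qed.

Lemma C1norm_ge_fun f A : C1box lo hi f -> C1norm lo hi f <= A ->
  forall u, cbox lo hi u -> `|f u| <= A.
Proof.
move=> [cf _]; rewrite /C1norm ge_max => /andP[fA _] u uc.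
apply: le_trans fA; apply: ub_le_sup; last by exists u.
have [M MP] := within_cbox_bounded cf.
by exists M => _ [w wc <-]; exact: MP.
Qed.

Lemma C1norm_ge_deriv f A i g : C1norm lo hi f <= A ->
  {within cbox lo hi, continuous g} ->
  (forall u, obox lo hi u -> 'D_(e_ i) f u = g u) ->
  forall u, cbox lo hi u -> `|g u| <= A.
Proof.
rewrite /C1norm ge_max => /andP[_ dA] cg gE.
apply: within_cbox_le => // u uo.
apply: le_trans dA; apply: le_trans (le_bigmax_cond _ _ (isT : xpredT i)).
apply: ub_le_sup; last by exists u; rewrite // gE.
have [M MP] := within_cbox_bounded cg.
by exists M => _ [w wo <-]; rewrite gE//; apply: MP; exact: obox_cbox.
Qed.

Lemma is_derive_line f w i (t x : R) : derivable f (w + (t - x) *: e_ i) (e_ i)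
  ->
  is_derive t 1 (fun s : R => f (w + (s - x) *: e_ i))
    ('D_(e_ i) f (w + (t - x) *: e_ i)).
Proof.
move=> df.
have E : (fun h : R => h^-1 *: (((fun s =>
  f (w + (s - x) *: e_ i)) \o shift t) (h *: (1 : R^o)) -
     f (w + (t - x) *: e_ i))) =
   (fun h : R => h^-1 *: ((f \o shift (w + (t - x) *: e_ i)) (h *: e_ i) -
     f (w + (t - x) *: e_ i))).
  apply/funext => h /=; congr (_ *: (f _ - _)).
  by rewrite [h *: 1](mulr1 h) [RHS]addrCA -scalerDl addrA.
by apply: DeriveDef; rewrite /derivable /derive E.
Qed.

(** Mean value theorem along the i-th direction. *)
Lemma increment_le f i g w (x h D e : R) : `|h| < D ->
  (forall s : R, `|s| < D -> obox lo hi (w + s *: e_ i)) ->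
  (forall u, obox lo hi u -> derivable f u (e_ i) /\ 'D_(e_ i) f u = g u) ->
  (forall s : R, `|s| < D -> `|g (w + s *: e_ i) - x| <= e) ->
  `|f (w + h *: e_ i) - f w - h * x| <= e * `|h|.
Proof.
move=> hD wo fg gx.
pose F (s : R) : R := f (w + (s - 0) *: e_ i).
have dF (s : R) : `|s| < D -> is_derive s 1 F (g (w + s *: e_ i)).
  move=> sD; have [df gE] := fg _ (wo s sD).
  rewrite -gE -[s in 'D__ _ (_ + s *: _)]subr0.
  by apply: is_derive_line; rewrite subr0.
have [s sD FE] : exists2 s : R, `|s| < D & F h - F 0 = g (w + s *: e_ i) * h.
  have cF (s : R) : `|s| < D -> {for s, continuous F}.
    by move=> /dF[dFs _]; exact/differentiable_continuous/derivable1_diffP.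
  have [h0|h0|h0] := ltgtP h 0.
  - have [||c] := @MVT R F (fun s => g (w + s *: e_ i)) h 0 h0.
    + move=> s; rewrite in_itv/= => /andP[s1 s2]; apply: dF.
      by rewrite ltr0_norm// (lt_trans _ hD)// ltr0_norm//; lra.
    + apply: continuous_in_subspaceT => s; rewrite inE/= in_itv/= =>
      /andP[s1 s2].
      by apply: cF; rewrite ler0_norm// (le_lt_trans _ hD)// ltr0_norm//; lra.
    + rewrite in_itv/= => /andP[c1 c2] cE; exists c.
        by rewrite ltr0_norm// (lt_trans _ hD)// ltr0_norm//; lra.
      by rewrite -opprB cE sub0r mulrN opprK.
  - have [||c] := @MVT R F (fun s => g (w + s *: e_ i)) 0 h h0.
    + move=> s; rewrite in_itv/= => /andP[s1 s2]; apply: dF.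
      by rewrite gtr0_norm// (lt_trans _ hD)// gtr0_norm//; lra.
    + apply: continuous_in_subspaceT => s; rewrite inE/= in_itv/= =>
      /andP[s1 s2].
      by apply: cF; rewrite ger0_norm// (le_lt_trans _ hD)// gtr0_norm//; lra.
    + rewrite in_itv/= => /andP[c1 c2] cE; exists c.
        by rewrite gtr0_norm// (lt_trans _ hD)// gtr0_norm//; lra.
      by rewrite cE subr0.
  - by exists h => //; rewrite h0 subrr mulr0.
move: FE; rewrite /F !subr0 scale0r addr0 => ->.
have -> : g (w + s *: e_ i) * h - h * x = (g (w + s *: e_ i) - x) * h by ring.
by rewrite normrM ler_wpM2r// gx.
Qed.

(** On a face parallel to the i-th axis the partial derivative is not assumed to
    exist. The mean value inequality holds at interior points close to the face,
    with a constant that depends only on the modulus of continuity of [g], and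
    passes to the limit. *)
Lemma increment_face_le f i g u (e : R) : C1box lo hi f ->
  {within cbox lo hi, continuous g} ->
  (forall u, obox lo hi u -> derivable f u (e_ i) /\ 'D_(e_ i) f u = g u) ->
  cbox lo hi u -> lo 0 i < u 0 i < hi 0 i -> 0 < e ->
  exists2 D, 0 < D & forall h : R, `|h| < D ->
    `|f (u + h *: e_ i) - f u - h * g u| <= e * `|h|.
Proof.
move=> [cf _] cg fg uc /andP[ui1 ui2] e0.
have [d d0 dP] := within_cbox_eps cg uc e0.
pose D := Num.min (d / 2) (Num.min (u 0 i - lo 0 i) (hi 0 i - u 0 i)).
have D0 : 0 < D by rewrite /D !lt_min divr_gt0//= !subr_gt0 ui1.
exists D => // h hD.
(* moving towards c leaves the i-th coordinate unchanged *)
pose c : 'rV[R]_n := \row_j (if j == i then u 0 i else center 0 j).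
have co : obox lo hi c.
  move=> j; rewrite mxE; case: eqP => [->|_]; first by rewrite ui1.
  exact: center_obox.
have line (w : 'rV[R]_n) (s : R) j : (w + s *: e_ i) 0 j = w 0 j + s * (j ==
  i)%:R.
  by rewrite !mxE eqxx.
have sD (s : R) : `|s| < D -> [/\ `|s| < d / 2,
  lo 0 i < u 0 i + s & u 0 i + s < hi 0 i].
  by rewrite /D !lt_min => /and3P[-> ]; rewrite !ltr_norml; split=> //; lra.
have uhc (s : R) : `|s| < D -> cbox lo hi (u + s *: e_ i).
  move=> /sD[_ s1 s2] j; rewrite line; case: eqP => [->|_].
    by rewrite mulr1 !ltW.
  by rewrite mulr0 addr0.
apply/ler_addgt0Pr => e1 e10.
have e12 : 0 < e1 / 2 by rewrite divr_gt0.
have [d1 d10 d1P] := within_cbox_eps cf uc e12.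
have [d2 d20 d2P] := within_cbox_eps cf (uhc h hD) e12.
have dd : 0 < Num.min (d / 2) (Num.min d1 d2) by rewrite !lt_min divr_gt0// d10.
have [t t01 tP] := shrink_near uc co dd.
set w := u + t *: (c - u) in tP.
have wi : w 0 i = u 0 i by rewrite !mxE eqxx subrr mulr0 addr0.
have wo : obox lo hi w by exact: shrink_obox.
have wso (s : R) : `|s| < D -> obox lo hi (w + s *: e_ i).
  move=> /sD[_ s1 s2] j; rewrite line; case: eqP => [->|_].
    by rewrite mulr1 wi s1.
  by rewrite mulr0 addr0.
have := @increment_le f i g w (g u) h D e hD wso fg.
have H (s : R) : `|s| < D -> `|g (w + s *: e_ i) - g u| <= e.
  move=> sD'; have [s1 _ _] := sD s sD'.
  rewrite distrC ltW//; apply: dP; first exact/obox_cbox/wso.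
  move=> j; rewrite line opprD addrA (le_lt_trans (ler_normB _ _))//.
  rewrite (splitr d) ltrD//.
    by have := tP j; rewrite !lt_min => /andP[].
  rewrite normrM (le_lt_trans _ s1)//; case: (j == i);
    first by rewrite normr1 mulr1.
  by rewrite normr0 mulr0.
move=> /(_ H) inc.
have f1 : `|f u - f w| < e1 / 2.
  apply: d1P; first exact: obox_cbox.
  by move=> j; have := tP j; rewrite !lt_min => /and3P[].
have f2 : `|f (u + h *: e_ i) - f (w + h *: e_ i)| < e1 / 2.
  apply: d2P; first exact/obox_cbox/wso.
  move=> j; rewrite !line.
  have -> : u 0 j + h * (j == i)%:R - (w 0 j + h * (j == i)%:R) = u 0 j - w 0 j
    by ring.
  by have := tP j; rewrite !lt_min => /and3P[].
have -> : f (u + h *: e_ i) - f u - h * g u =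
  (f (w + h *: e_ i) - f w - h * g u) + (f (u + h *: e_ i) - f (w + h *: e_ i))
  - (f u - f w) by ring.
rewrite (le_trans (ler_normB _ _))//
  (le_trans (lerD (ler_normD _ _) (lexx _)))//.
lra.
Qed.

Lemma is_derive_face f i g u (x : R) : C1box lo hi f ->
  {within cbox lo hi, continuous g} ->
  (forall u, obox lo hi u -> derivable f u (e_ i) /\ 'D_(e_ i) f u = g u) ->
  cbox lo hi u -> lo 0 i < u 0 i < hi 0 i ->
  is_derive x 1 (fun s : R => f (u + (s - x) *: e_ i)) (g u).
Proof.
move=> f1 cg fg uc ui.
have H : (fun h : R => h^-1 *: (((fun s : R =>
  f (u + (s - x) *: e_ i)) \o shift x)
    (h *: (1 : R^o)) - f (u + (x - x) *: e_ i))) @ 0^' --> g u.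
  apply/cvgrPdist_le => e e0.
  have [D D0 DP] := increment_face_le f1 cg fg uc ui e0.
  exists D => //= h; rewrite /ball/= sub0r normrN => hD h0.
  rewrite [h *: 1](mulr1 h) addrK subrr scale0r addr0.
  have hp : 0 < `|h| by rewrite normr_gt0.
  rewrite distrC -(ler_pM2r hp).
  rewrite -normrM.
  have -> : (h^-1 *: (f (u + h *: e_ i) - f u) - g u) * h =
     f (u + h *: e_ i) - f u - h * g u.
    by rewrite /GRing.scale/=; field.
  exact: DP.
by apply: DeriveDef; [exact: cvgP H|exact: cvg_lim H].
Qed.

(** The partial derivative extends to a continuous function on the whole space,
    bounded by the C^1 norm, which remains the partial derivative on all faces
    parallel to its direction. *)
Theorem C1box_partial f A i : C1box lo hi f -> C1norm lo hi f <= A ->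
  exists g, [/\ continuous g, forall u, `|g u| <= A &
    forall u (x : R), cbox lo hi u -> lo 0 i < u 0 i < hi 0 i ->
      is_derive x 1 (fun s : R => f (u + (s - x) *: e_ i)) (g u)].
Proof.
move=> f1 fA; have [_ /(_ i)[g cg gP]] := f1.
exists (g \o clampv); split.
- exact: within_comp_continuous cg clampv_continuous clampv_cbox.
- have gE w : obox lo hi w -> 'D_(e_ i) f w = g w by move=> /gP[].
  by move=> u; apply: (C1norm_ge_deriv fA cg gE); exact: clampv_cbox.
- move=> u x uc ui.
  have -> : (g \o clampv) u = g u by rewrite /= clampv_id.
  exact: (is_derive_face x f1 cg gP uc ui).
Qed.

Theorem C1box_clamp f A : C1box lo hi f -> C1norm lo hi f <= A ->
  continuous (f \o clampv) /\ forall u, `|f (clampv u)| <= A.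
Proof.
move=> f1 fA; split; last by move=> u; exact: C1norm_ge_fun (clampv_cbox u).
by have [cf _] := f1; exact: within_comp_continuous cf clampv_continuous
  clampv_cbox.
Qed.

End BoxDerivatives.

(** * Bounded continuous functions, the basis and point evaluations *)

Section BoundedContinuous.
Context {R : realType}.

Definition bcont (X : topologicalType) (f : X -> R) : Prop :=
  continuous f /\ exists M, forall x, `|f x| <= M.

Lemma bcont_cst (X : topologicalType) (c : R) : bcont (fun _ : X => c).
Proof. by split; [exact: cst_continuous|exists `|c|]. Qed.

Lemma bcont_comp (X Y : topologicalType) (g : Y -> X) (f : X -> R) :
  continuous g -> bcont f -> bcont (fun y => f (g y)).
Proof.
move=> cg [cf [M fM]]; split; first exact: continuous_comp_fun cf.
by exists M => y; exact: fM.
Qed.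

Lemma bcontM (X : topologicalType) (f g : X -> R) :
  bcont f -> bcont g -> bcont (fun x => f x * g x).
Proof.
move=> [cf [M fM]] [cg [N gN]]; split; first exact: continuous_mul.
by exists (M * N) => x; rewrite normrM ler_pM.
Qed.

Lemma bcontB (X : topologicalType) (f g : X -> R) :
  bcont f -> bcont g -> bcont (fun x => f x - g x).
Proof.
move=> [cf [M fM]] [cg [M' gM]]; split; first exact: continuous_sub.
by exists (M + M') => x; rewrite (le_trans (ler_normB _ _))// lerD.
Qed.

Lemma bcont_clamp (a b : R) (f : R -> R) : a <= b -> continuous f ->
  bcont (fun x => f (clamp a b x)).
Proof.
move=> ab cf; split; first by apply: continuous_comp_fun cf;
  exact: clamp_continuous.
have cn : {within `[a, b], continuous (fun x => `|f x|)}.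
  apply: continuous_subspaceT => x; apply: cvg_norm; exact: cf.
have [c _ cP] := EVT_max ab cn.
by exists `|f c| => x; apply: cP; rewrite in_itv/= clamp_itv.
Qed.

Lemma bcont_sin (c : R) : bcont (fun x => sin (c * x)).
Proof.
split; last first.
  by exists 1 => x; rewrite ler_norml sin_geN1 sin_le1.
apply: (@continuous_comp_fun _ _ _ (fun x => c * x));
  last exact: continuous_sin.
by apply: continuous_mul; [exact: cst_continuous|exact: continuous_idfun].
Qed.

Lemma bcont_cos (c : R) : bcont (fun x => cos (c * x)).
Proof.
split; last first.
  by exists 1 => x; rewrite ler_norml cos_geN1 cos_le1.
apply: (@continuous_comp_fun _ _ _ (fun x => c * x));
  last exact: continuous_cos.
by apply: continuous_mul; [exact: cst_continuous|exact: continuous_idfun].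
Qed.

Lemma expands_bcont {V : normedModType R} {P : Type} (D : P -> set V)
  (X : topologicalType) (f : X -> R) : bcont f -> expands D (fun _ _ => f).
Proof.
by move=> [cf [M fM]]; apply: (expands_cst (f := fun _ => f)); exists M =>
  t Q _.
Qed.

End BoundedContinuous.

Section GramSchmidtSmooth.
Context {R : realType} (beta : R).
Implicit Types f g : R -> R.

Definition smooth1 f : Prop :=
  (forall x, derivable f x 1) /\ continuous (f^`())%classic.

Lemma smooth1_is_derive f df :
  (forall x, is_derive x (1 : R) f (df x)) -> continuous df -> smooth1 f.
Proof.
move=> fd cdf; split; first by move=> x; case: (fd x).
by have -> : (f^`())%classic = df
  by apply/funext => x; rewrite derive1E; case: (fd x).
Qed.

Lemma smooth1_derive f x : smooth1 f -> is_derive x (1 : R) f ((f^`())%classic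
  x).
Proof. by move=> [df _]; rewrite derive1E; exact: derivableP. Qed.

Lemma smooth1_continuous f : smooth1 f -> continuous f.
Proof.
by move=> [df _] x; exact/differentiable_continuous/derivable1_diffP.
Qed.

Lemma smooth1M f g : smooth1 f -> smooth1 g -> smooth1 (fun x => f x * g x).
Proof.
move=> sf sg.
apply: (@smooth1_is_derive _ (fun x =>
  f x * (g^`())%classic x + g x * (f^`())%classic x)).
  by move=> x; exact: is_deriveM (smooth1_derive x sf) (smooth1_derive x sg).
have [cf cg] := (smooth1_continuous sf, smooth1_continuous sg).
by apply: continuous_add; apply: continuous_mul => //; [case: sg|case: sf].
Qed.

Lemma smooth1D f g : smooth1 f -> smooth1 g -> smooth1 (fun x => f x + g x).
Proof.
move=> sf sg.
apply: (@smooth1_is_derive _ (fun x => (f^`())%classic x + (g^`())%classic x)).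
  by move=> x; exact: is_deriveD (smooth1_derive x sf) (smooth1_derive x sg).
by apply: continuous_add; [case: sf|case: sg].
Qed.

Lemma smooth1_cst (c : R) : smooth1 (fun=> c).
Proof.
by apply: (@smooth1_is_derive _ (fun=> 0)); exact: cst_continuous.
Qed.

Lemma smooth1_id : smooth1 (fun x => x).
Proof.
by apply: (@smooth1_is_derive _ (fun=> 1)); exact: cst_continuous.
Qed.

Lemma smooth1X f n : smooth1 f -> smooth1 (fun x => f x ^+ n).
Proof.
move=> sf; elim: n => [|n IH]; first by under eq_fun do rewrite expr0;
  exact: smooth1_cst.
by under eq_fun do rewrite exprS; exact: smooth1M.
Qed.

Lemma smooth1_expR : smooth1 (@expR R).
Proof.
by apply: (@smooth1_is_derive _ expR); exact: continuous_expR.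
Qed.

Lemma smooth1_sum (I : Type) (s : seq I) (F : I -> R -> R) :
  (forall i, smooth1 (F i)) -> smooth1 (fun x => \sum_(i <- s) F i x).
Proof.
move=> sF; elim: s => [|i s IH].
  by under eq_fun do rewrite big_nil; exact: smooth1_cst.
by under eq_fun do rewrite big_cons; exact: smooth1D.
Qed.

Lemma gram_schmidt_smooth n i : smooth1 (nth (fun=> 0) (gram_schmidt beta n) i).
Proof.
elim: n i => [|n IH] i; first by rewrite nth_nil; exact: smooth1_cst.
rewrite /= nth_rcons; case: ifPn => // _; case: ifPn => // _;
  last exact: smooth1_cst.
apply: smooth1M; last exact: smooth1_cst.
apply: smooth1D.
  apply: smooth1M smooth1_expR; apply: smooth1X.
  by apply: smooth1D smooth1_id (smooth1_cst _).
under eq_fun do rewrite -mulN1r.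
apply: smooth1M; first exact: smooth1_cst.
under eq_fun do rewrite (big_nth (fun=> 0)) big_mkord.
by apply: smooth1_sum => j; apply: smooth1M; [exact: smooth1_cst|exact: IH].
Qed.

Lemma phi_smooth n : smooth1 (phi beta n).
Proof. exact: gram_schmidt_smooth. Qed.

End GramSchmidtSmooth.

Section Evaluation.
Context {R : realType} (a b : R) (I : finType) (hab : a < b).

Lemma H10_clamp_continuous (Q : H10 a b I) i :
  continuous (fun z => Q i (clamp a b z)).
Proof.
have [sg uE] := wderivP Q i.
apply: (@within_comp_continuous _ _ _ `[a, b]%classic (Q i) (clamp a b)).
- rewrite uE; have := parameterized_integral_continuous (ltW hab) (sqint_int
  sg).
  apply: subspace_eq_continuous => z; rewrite inE/= in_itv/= => /andP[_ zb].
  by rewrite /from_subspace/= /parameterized_integral (min_idPl zb).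
- exact: clamp_continuous.
- by move=> z; rewrite /= in_itv/= clamp_itv// ltW.
Qed.

(** Point evaluations are bounded linear functionals, by the Sobolev embedding
    [H10_sup]. *)
Lemma expands_eval {P : Type} (D : P -> set (H10 a b I)) (r : R) i :
  0 <= r -> (forall t Q, D t Q -> `|Q| <= r) ->
  expands D (fun _ Q z => Q i (clamp a b z)).
Proof.
move=> r0 Dr.
apply: (@expands_lin R (H10 a b I) P D R (fun Q z => Q i (clamp a b z))
  (Num.sqrt (b - a)) r) => //.
- by move=> h; exact: H10_clamp_continuous.
- by move=> h z; exact: H10_sup.
Qed.

End Evaluation.

(** * The functional in clamped coordinates *)

Section ClampedProblem.
Context (R : realType) (B1 B2 beta : R) (N K : nat).
Context (hB1 : 0 < B1) (hB12 : B1 < B2).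
Context (A r eps lam : R) (hr : 0 <= r) (heps : 0 < eps).
Local Notation mu := (@lebesgue_measure R).
Local Notation idx := ('I_N * 'I_K * 'I_K)%type.
Local Notation H := (H10 B1 B2 idx).
Local Notation fn := (R -> R -> R -> R -> R).
Local Notation R3 := (R * R * R)%type.
Local Notation R4 := (R * R * R * R)%type.

(** The domain on which J is expanded: for each data pair, a ball on which
    v_(Q,q) is bounded below. It is empty unless the data satisfy the
    assumptions. *)
Definition admissible (t : fn * fn) : set H :=
  [set Q | [/\ data_pair B1 B2 t.1 t.2,
    C1norm (lo3 R) (hi3 R) (top3 B2 t.1) <= A /\
    C1norm (lo4 B1) (hi4 B2) (vec4 t.2) <= A,
    `|Q| <= r &
    forall x y z a, clG B1 B2 (x, y, z) -> 0 <= a <= pi ->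
      eps <= vQq beta t.2 Q x y z a]].

Local Notation expands := (@expands R H (fn * fn)%type admissible).
Local Notation c := (clamp 0 pi).
Local Notation cz := (clamp B1 B2).

Let pi0 : 0 <= pi :> R := pi_ge0 R.
Let B12 : B1 <= B2 := ltW hB12.

Ltac proj_cont := repeat first [exact: continuous_idfun
  | apply: continuous_fst | apply: continuous_snd | apply: continuous_pair].

Lemma clamp_pi_bcont (X : topologicalType) (g : X -> R) (f : R -> R) :
  continuous g -> continuous f -> bcont (fun x => f (c (g x))).
Proof.
move=> cg cf; apply: (bcont_comp (f := fun x => f (c x)) cg).
exact: bcont_clamp.
Qed.

Definition row4 (x y z a : R) : 'rV[R]_4 := \row_i [:: x; y; z; a]`_i.
Definition row3 (x y a : R) : 'rV[R]_3 := \row_i [:: x; y; a]`_i.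

Lemma row4_continuous (X : topologicalType) (f g h k : X -> R) :
  continuous f -> continuous g -> continuous h -> continuous k ->
  continuous (fun x => row4 (f x) (g x) (h x) (k x)).
Proof.
move=> cf cg ch ck; rewrite /row4.
apply: (@continuous_row R 4 X (fun (i : 'I_4) x => [:: f x; g x; h x; k x]`_i)).
by case=> -[|[|[|[|i]]]].
Qed.

Lemma row3_continuous (X : topologicalType) (f g h : X -> R) :
  continuous f -> continuous g -> continuous h ->
  continuous (fun x => row3 (f x) (g x) (h x)).
Proof.
move=> cf cg ch; rewrite /row3.
apply: (@continuous_row R 3 X (fun (i : 'I_3) x => [:: f x; g x; h x]`_i)).
by case=> -[|[|[|i]]].
Qed.

Lemma lohi4 j : lo4 B1 0 j < hi4 B2 0 j.
Proof. by rewrite !mxE; case: j => -[|[|[|[|j]]]] //= _; exact: pi_gt0. Qed.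

Lemma lohi3 j : lo3 R 0 j < hi3 R 0 j.
Proof. by rewrite !mxE; exact: pi_gt0. Qed.

Lemma vec4_row4 (q : fn) x y z a : vec4 q (row4 x y z a) = q x y z a.
Proof. by rewrite /vec4 !mxE. Qed.

Lemma top3_row3 (p : fn) x y a : top3 B2 p (row3 x y a) = p x y B2 a.
Proof. by rewrite /top3 !mxE. Qed.

Lemma clampv_row4 x y z a :
  clampv (lo4 B1) (hi4 B2) (row4 x y z a) = row4 (c x) (c y) (cz z) (c a).
Proof. by apply/rowP => j; rewrite !mxE; case: j => -[|[|[|[|j]]]]. Qed.

(** The partial derivatives of v0, written with v0^2 instead of the squared
    denominator so that their boundedness is that of v0. *)
Definition v0x (x y a : R) : R := - 2 * (x - a) / B1 ^+ 2 * v0 B1 x y a ^+ 2.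
Definition v0y (x y a : R) : R :=
  - 2 * (y - pi / 2) / B1 ^+ 2 * v0 B1 x y a ^+ 2.

Lemma v0_den_gt0 (x y a : R) : 0 < (x - a) ^+ 2 + (y - pi / 2) ^+ 2 + B1 ^+ 2.
Proof.
have := sqr_ge0 (x - a); have := sqr_ge0 (y - pi / 2).
have : 0 < B1 ^+ 2 by rewrite exprn_gt0.
by lra.
Qed.

Lemma v0_bcont (X : topologicalType) (f g h : X -> R) :
  continuous f -> continuous g -> continuous h ->
  bcont (fun x => v0 B1 (f x) (g x) (h x)).
Proof.
move=> cf cg ch; split; last first.
  exists 1 => x; have D0 := v0_den_gt0 (f x) (g x) (h x).
  rewrite /v0 ger0_norm ?divr_ge0 ?sqr_ge0 ?(ltW D0)// ler_pdivrMr// mul1r.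
  by rewrite lerDr addr_ge0 ?sqr_ge0.
have sq (u : X -> R) : continuous u -> continuous (fun x => u x ^+ 2).
  by move=> cu; under eq_fun do rewrite expr2; exact: continuous_mul.
have cD : continuous (fun x => (f x - h x) ^+ 2 + (g x - pi / 2) ^+ 2 + B1 ^+
  2).
  apply: continuous_add; last exact: cst_continuous.
  apply: continuous_add; apply: sq; apply: continuous_sub => //.
  exact: cst_continuous.
apply: continuous_mul; first exact: cst_continuous.
by move=> x; apply: cvgV; [rewrite gt_eqF ?v0_den_gt0|exact: cD].
Qed.

Lemma v0x_bcont (X : topologicalType) (f g h : X -> R) :
  continuous f -> continuous g -> continuous h ->
  bcont (fun x => v0x (c (f x)) (c (g x)) (c (h x))).
Proof.
move=> cf cg ch; rewrite /v0x; under eq_fun do rewrite expr2.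
have cc u : continuous u -> continuous (fun x : X => c (u x)).
  by move=> cu; apply: continuous_comp_fun cu _; exact: clamp_continuous.
have bv : bcont (fun x => v0 B1 (c (f x)) (c (g x)) (c (h x))).
  by apply: v0_bcont; exact: cc.
apply: bcontM; last exact: bcontM.
apply: bcontM; last exact: bcont_cst.
apply: bcontM; first exact: bcont_cst.
by apply: bcontB; apply: (@clamp_pi_bcont _ _ id) => //;
  exact: continuous_idfun.
Qed.

Lemma v0y_bcont (X : topologicalType) (f g h : X -> R) :
  continuous f -> continuous g -> continuous h ->
  bcont (fun x => v0y (c (f x)) (c (g x)) (c (h x))).
Proof.
move=> cf cg ch; rewrite /v0y; under eq_fun do rewrite expr2.
have cc u : continuous u -> continuous (fun x : X => c (u x)).
  by move=> cu; apply: continuous_comp_fun cu _; exact: clamp_continuous.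
have bv : bcont (fun x => v0 B1 (c (f x)) (c (g x)) (c (h x))).
  by apply: v0_bcont; exact: cc.
apply: bcontM; last exact: bcontM.
apply: bcontM; last exact: bcont_cst.
apply: bcontM; first exact: bcont_cst.
apply: bcontB; last exact: bcont_cst.
by apply: (@clamp_pi_bcont _ _ id) => //; exact: continuous_idfun.
Qed.

Definition is_partial n (lo hi : 'rV[R]_n) (f : 'rV[R]_n -> R) (i : 'I_n)
    (g : 'rV[R]_n -> R) : Prop :=
  [/\ continuous g, forall u, `|g u| <= A &
      forall u (x : R), cbox lo hi u -> lo 0 i < u 0 i < hi 0 i ->
        is_derive x 1 (fun s : R => f (u + (s - x) *: delta_mx 0 i)) (g u)].

(** [dq] and [dp] choose the continuous extensions of the partial derivatives of
    q and of p(.,.,B2,.) given by [C1box_partial]. *)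
Definition dq (t : fn * fn) i : 'rV[R]_4 -> R :=
  xget (fun=> 0) (is_partial (lo4 B1) (hi4 B2) (vec4 t.2) i).
Definition dp (t : fn * fn) i : 'rV[R]_3 -> R :=
  xget (fun=> 0) (is_partial (lo3 R) (hi3 R) (top3 B2 t.1) i).

Lemma dqP t Q i : admissible t Q ->
  is_partial (lo4 B1) (hi4 B2) (vec4 t.2) i (dq t i).
Proof.
case=> [[_ q1 _ _] [_ qA] _ _].
have [g gP] := C1box_partial lohi4 i q1 qA.
exact: (xgetPex (fun=> 0) (ex_intro _ g gP)).
Qed.

Lemma dpP t Q i : admissible t Q ->
  is_partial (lo3 R) (hi3 R) (top3 B2 t.1) i (dp t i).
Proof.
case=> [[p1 _ _ _] [pA _] _ _].
have [g gP] := C1box_partial lohi3 i p1 pA.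
exact: (xgetPex (fun=> 0) (ex_intro _ g gP)).
Qed.

Lemma expands_dq (X : topologicalType) i (f g h k : X -> R) :
  continuous f -> continuous g -> continuous h -> continuous k ->
  expands (fun t _ x => dq t i (row4 (f x) (g x) (h x) (k x))).
Proof.
move=> cf cg ch ck; apply: expands_cst; exists A => t Q /(dqP i)[cd dA _].
by split=> // ; apply: continuous_comp_fun cd; exact: row4_continuous.
Qed.

Lemma expands_dp (X : topologicalType) i (f g h : X -> R) :
  continuous f -> continuous g -> continuous h ->
  expands (fun t _ x => dp t i (row3 (f x) (g x) (h x))).
Proof.
move=> cf cg ch; apply: expands_cst; exists A => t Q /(dpP i)[cd dA _].
by split=> // ; apply: continuous_comp_fun cd; exact: row3_continuous.
Qed.

Lemma expands_Qi (X : topologicalType) (g : X -> R) i : continuous g ->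
  expands (fun _ Q x => Q i (cz (g x))).
Proof.
move=> cg; apply: (expands_comp (F := fun (_ : fn * fn) (Q : H) z =>
  Q i (cz z)) cg).
by apply: (expands_eval hB12 i hr) => t Q [].
Qed.

(** Covers V_Q and its x and y derivatives, according to the choice of the two
    families [ex] and [ey]. *)
Definition Vgen (ex ey : nat -> R -> R) (Q : H) (w : R4) : R :=
  \sum_(n < N) \sum_(k < K) \sum_(m < K)
    Q (n, k, m) (cz w.2) * phi beta n (c w.1.2) * ex k (c w.1.1.1) * ey m (c
      w.1.1.2).

Lemma expands_Vgen (ex ey : nat -> R -> R) :
  (forall k, continuous (ex k)) -> (forall k, continuous (ey k)) ->
  expands (fun _ Q => Vgen ex ey Q).
Proof.
move=> cex cey.
apply: expands_sum => n; apply: expands_sum => k; apply: expands_sum => m.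
apply: expandsM; first apply: expandsM; first apply: expandsM.
- by apply: expands_Qi; proj_cont.
- apply: expands_bcont; apply: clamp_pi_bcont; first by proj_cont.
  exact/smooth1_continuous/phi_smooth.
- by apply: expands_bcont; apply: clamp_pi_bcont; first by proj_cont.
- by apply: expands_bcont; apply: clamp_pi_bcont; first by proj_cont.
Qed.

Definition sink (k : nat) (x : R) : R := sin (k.+1%:R * x).
Definition dsink (k : nat) (x : R) : R := k.+1%:R * cos (k.+1%:R * x).

Lemma sink_continuous k : continuous (sink k).
Proof. by have [] := bcont_sin (k.+1%:R : R). Qed.

Lemma dsink_continuous k : continuous (dsink k).
Proof.
apply: continuous_mul; first exact: cst_continuous.
by have [] := bcont_cos (k.+1%:R : R).
Qed.

(** The suffix C marks versions of the functions of the problem that are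
    continuous everywhere: coordinates are clamped to the closed box, and
    partial derivatives are replaced by their continuous extensions. Points
    (x, y, a, z) carry z last since it is the first variable of integration. *)
Definition vC (t : fn * fn) (Q : H) (w : R4) : R :=
  vQq beta t.2 Q (c w.1.1.1) (c w.1.1.2) (cz w.2) (c w.1.2).
Definition vxC (t : fn * fn) (Q : H) (w : R4) : R :=
  v0x (c w.1.1.1) (c w.1.1.2) (c w.1.2) +
  dq t 0 (row4 w.1.1.1 w.1.1.2 w.2 w.1.2) + Vgen dsink sink Q w.
Definition vyC (t : fn * fn) (Q : H) (w : R4) : R :=
  v0y (c w.1.1.1) (c w.1.1.2) (c w.1.2) +
  dq t 1 (row4 w.1.1.1 w.1.1.2 w.2 w.1.2) + Vgen sink dsink Q w.

Lemma expands_vC : expands vC.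
Proof.
apply: expandsD; first apply: expandsD.
- apply: expands_bcont; apply: v0_bcont;
    (apply: (@continuous_comp_fun _ _ _ _ c); last exact: clamp_continuous);
    by proj_cont.
- apply: (expands_cst (f := fun (t : fn * fn) (w : R4) =>
    t.2 (c w.1.1.1) (c w.1.1.2) (cz w.2) (c w.1.2))).
  exists A => t Q [[_ q1 _ _] [_ qA] _ _].
  have [cq qM] := C1box_clamp lohi4 q1 qA.
  have qE (w : R4) : t.2 (c w.1.1.1) (c w.1.1.2) (cz w.2) (c w.1.2) =
    (vec4 t.2 \o clampv (lo4 B1) (hi4 B2)) (row4 w.1.1.1 w.1.1.2 w.2 w.1.2).
    by rewrite /= clampv_row4 vec4_row4.
  split; last by move=> w; rewrite /= qE; exact: qM.
  rewrite /= (funext qE); apply: continuous_comp_fun cq.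
  by apply: row4_continuous; proj_cont.
- by apply: (expands_Vgen (ex := sink) (ey := sink)); exact: sink_continuous.
Qed.

Lemma expands_vxC : expands vxC.
Proof.
apply: expandsD; first apply: expandsD.
- by apply: expands_bcont; apply: v0x_bcont; proj_cont.
- by apply: expands_dq; proj_cont.
- by apply: expands_Vgen; [exact: dsink_continuous|exact: sink_continuous].
Qed.

Lemma expands_vyC : expands vyC.
Proof.
apply: expandsD; first apply: expandsD.
- by apply: expands_bcont; apply: v0y_bcont; proj_cont.
- by apply: expands_dq; proj_cont.
- by apply: expands_Vgen; [exact: sink_continuous|exact: dsink_continuous].
Qed.

(** E^x and E^y at once: [vd] is v_x or v_y, and [pd] is p_x or p_y at z = B2.
  *)
Definition EC (vd : fn * fn -> H -> R4 -> R) (pd : fn * fn -> R3 -> R)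
    (t : fn * fn) (Q : H) (w : R4) : R :=
  - (\int[mu]_(s in `[cz w.2, B2])
      (vd t Q (w.1, s) / (2 * Num.sqrt (vC t Q (w.1, s))))) + pd t w.1.

Lemma vC_ge t Q w : admissible t Q -> eps <= vC t Q w.
Proof.
case=> _ _ _; apply; rewrite ?clamp_itv//.
by split=> /=; rewrite clamp_itv.
Qed.

Lemma expands_ratio vd : expands vd ->
  expands (fun t Q w => vd t Q w / (2 * Num.sqrt (vC t Q w))).
Proof.
move=> evd.
have -> : (fun t Q w => vd t Q w / (2 * Num.sqrt (vC t Q w))) =
   (fun t Q w => 2^-1 * (vd t Q w * (Num.sqrt (vC t Q w))^-1)).
  apply/funext => t; apply/funext => Q; apply/funext => w.
  by rewrite invfM mulrCA.
apply: expandsZ; apply: expandsM => //.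
by apply: (expands_invsqrt heps) => [t Q DQ w|];
  [exact: vC_ge|exact: expands_vC].
Qed.

Lemma expands_EC vd pd : expands vd -> expands (fun t _ => pd t) ->
  expands (EC vd pd).
Proof.
move=> evd epd; rewrite /EC.
apply: expandsD; last first.
  by apply: (expands_comp (F := fun t _ => pd t)) => //; proj_cont.
under eq_fun do under eq_fun do under eq_fun do rewrite -mulN1r.
apply: expandsZ; apply: (expands_lower_int (F := fun t Q w =>
  vd t Q w / (2 * Num.sqrt (vC t Q w)))) => //.
exact: expands_ratio.
Qed.

Definition pxC (t : fn * fn) (w : R3) : R := dp t 0 (row3 w.1.1 w.1.2 w.2).
Definition pyC (t : fn * fn) (w : R3) : R := dp t 1 (row3 w.1.1 w.1.2 w.2).
Definition ExC := EC vxC pxC.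
Definition EyC := EC vyC pyC.

Lemma expands_ExC : expands ExC.
Proof.
apply: expands_EC; first exact: expands_vxC.
by apply: expands_dp; proj_cont.
Qed.

Lemma expands_EyC : expands EyC.
Proof.
apply: expands_EC; first exact: expands_vyC.
by apply: expands_dp; proj_cont.
Qed.

Definition hC (t : fn * fn) (Q : H) (w : R4) : R :=
  ExC t Q w ^+ 2 + EyC t Q w ^+ 2.

Lemma expands_hC : expands hC.
Proof.
apply: expandsD; apply: expands_sqr; [exact: expands_ExC|exact: expands_EyC].
Qed.

Definition dphi (l : nat) : R -> R := (phi beta l)^`()%classic.

(** Points are ordered (z, y, x) since x and then y are integrated next. *)
Definition momC (l : 'I_N) (t : fn * fn) (Q : H) (w : R3) : R :=
  hC t Q (w.2, w.1.2, pi, w.1.1) * phi beta l pi -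
  hC t Q (w.2, w.1.2, 0, w.1.1) * phi beta l 0 -
  \int[mu]_(a in `[0, pi]) (hC t Q (w.2, w.1.2, a, w.1.1) * dphi l (c a)).

Lemma expands_momC l : expands (momC l).
Proof.
have eh (X : topologicalType) (f g h k : X -> R) : continuous f -> continuous g
  ->
    continuous h -> continuous k ->
    expands (fun t Q x => hC t Q (f x, g x, h x, k x)).
  move=> cf cg ch ck; apply: (expands_comp (F := hC)); last exact: expands_hC.
  by do 3 (apply: continuous_pair => //).
apply: expandsB; first apply: expandsB.
- apply: expandsM; last by apply: expands_bcont; exact: bcont_cst.
  by apply: eh; try (by proj_cont); exact: cst_continuous.
- apply: expandsM; last by apply: expands_bcont; exact: bcont_cst.
  by apply: eh; try (by proj_cont); exact: cst_continuous.
- apply: (expands_int (F := fun t Q (w : R3 * R) =>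
    hC t Q (w.1.2, w.1.1.2, w.2, w.1.1.1) * dphi l (c w.2))) => //.
  apply: expandsM; first by apply: eh; proj_cont.
  apply: expands_bcont; apply: clamp_pi_bcont; first by proj_cont.
  by have [_] := phi_smooth beta l.
Qed.

Definition qmomC (l : 'I_N) (t : fn * fn) (Q : H) (w : R3) : R :=
  \int[mu]_(a in `[0, pi]) (dq t 3%:R (row4 w.2 w.1.2 w.1.1 a) * phi beta l (c
    a)).

Lemma expands_qmomC l : expands (qmomC l).
Proof.
apply: (expands_int (F := fun t Q (w : R3 * R) =>
    dq t 3%:R (row4 w.1.2 w.1.1.2 w.1.1.1 w.2) * phi beta l (c w.2))) => //.
apply: expandsM; first by apply: expands_dq; proj_cont.
apply: expands_bcont; apply: clamp_pi_bcont; first by proj_cont.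
exact/smooth1_continuous/phi_smooth.
Qed.

Definition weightC (mom : 'I_N -> fn * fn -> H -> R3 -> R) k m l t Q (w : R3) :
  R :=
  sin (k.+1%:R * w.2) * sin (m.+1%:R * w.1.2) * mom l t Q w.

Definition solveC (mom : 'I_N -> fn * fn -> H -> R3 -> R) (i : idx) (t : fn *
  fn)
    (Q : H) (z : R) : R :=
  \sum_(l < N) invmx ((pi ^+ 2 / 4) *: phi_mx beta N) i.1.1 l *
    - \int[mu]_(y in `[0, pi]) \int[mu]_(x in `[0, pi])
        weightC mom i.1.2 i.2 l t Q (z, y, x).

Lemma expands_weightC mom k m l : expands (mom l) -> expands (weightC mom k m
  l).
Proof.
move=> em; apply: expandsM => //; apply: expandsM.
  by apply: expands_bcont; apply: (bcont_comp (g := fun w : R3 => w.2) (f :=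
    sink k));
    [proj_cont|exact: bcont_sin].
by apply: expands_bcont; apply: (bcont_comp (g := fun w : R3 => w.1.2) (f :=
  sink m));
    [proj_cont|exact: bcont_sin].
Qed.

Lemma expands_weightC_int mom k m l : expands (mom l) ->
  expands (fun t Q (w : R * R) => \int[mu]_(x in `[0,
    pi]) weightC mom k m l t Q (w, x)).
Proof. by move=> em; apply: expands_int => //; exact: expands_weightC. Qed.

Lemma expands_solveC mom i : (forall l,
  expands (mom l)) -> expands (solveC mom i).
Proof.
move=> em; apply: expands_sum => l; apply: expandsZ.
under eq_fun do under eq_fun do under eq_fun do rewrite -mulN1r.
apply: expandsZ; apply: (expands_int (F := fun t Q (w : R * R) =>
  \int[mu]_(x in `[0, pi]) weightC mom i.1.2 i.2 l t Q (w, x))) => //.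
exact: expands_weightC_int.
Qed.

Definition resC (i : idx) (t : fn * fn) (Q : H) (z : R) : R :=
  Q i (cz z) - solveC momC i t Q z - v0hat B1 beta i - solveC qmomC i t Q z.

Lemma expands_resC i : expands (resC i).
Proof.
apply: expandsB; last by apply: expands_solveC; exact: expands_qmomC.
apply: expandsB; last by apply: expands_bcont; exact: bcont_cst.
apply: expandsB; last by apply: expands_solveC; exact: expands_momC.
by apply: expands_Qi; proj_cont.
Qed.

Definition densC (t : fn * fn) (Q : H) (z : R) : R :=
  (\sum_i resC i t Q z ^+ 2) * expR (2 * lam * cz z).

Lemma expands_densC : expands densC.
Proof.
apply: expandsM.
  by apply: expands_sum => i; apply: expands_sqr; exact: expands_resC.
apply: expands_bcont; apply: (@bcont_clamp R B1 B2 (fun z =>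
  expR (2 * lam * z))) => //.
apply: (@continuous_comp_fun _ _ _ (fun z => 2 * lam * z));
  last exact: continuous_expR.
by apply: continuous_mul; [exact: cst_continuous|exact: continuous_idfun].
Qed.

(** The part of J without the regularization term, as a constant function on R:
    [expands] speaks of functions on a topological space. *)
Definition JC (t : fn * fn) (Q : H) (_ : R) : R :=
  expR (- 2 * lam * B1) * \int[mu]_(z in `[B1, B2]) densC t Q z.

(** J is built from V_Q by the operations that preserve uniform expansions:
    products, 1 / sqrt v with v >= eps, and integrals. *)
Theorem expands_JC : expands JC.
Proof.
apply: expandsZ; apply: (expands_int (F := fun t Q (w : R * R) =>
  densC t Q w.2)) => //.
by apply: (expands_comp (F := densC)); [proj_cont|exact: expands_densC].
Qed.

End ClampedProblem.

(** * The clamped functional agrees with J *)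

Section ClampedEquality.
Context (R : realType) (B1 B2 beta : R) (N K : nat).
Context (hB1 : 0 < B1) (hB12 : B1 < B2).
Context (A r eps lam : R) (hr : 0 <= r) (heps : 0 < eps).
Local Notation mu := (@lebesgue_measure R).
Local Notation idx := ('I_N * 'I_K * 'I_K)%type.
Local Notation H := (H10 B1 B2 idx).
Local Notation fn := (R -> R -> R -> R -> R).
Local Notation c := (clamp 0 pi).
Local Notation cz := (clamp B1 B2).
Context (p q : fn) (Q : H) (adm : admissible beta A r eps (p, q) Q).
Local Notation t := (p, q).

Lemma row4_line0 (x y z a s : R) :
  row4 x y z a + (s - x) *: delta_mx 0 0 = row4 s y z a.
Proof.
apply/rowP => j; rewrite !mxE; case: j => -[|[|[|[|j]]]] //= ?;
  by rewrite ?mulr1 ?mulr0 ?addr0 ?subrKC.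
Qed.

Lemma row4_line1 (x y z a s : R) :
  row4 x y z a + (s - y) *: delta_mx 0 1 = row4 x s z a.
Proof.
apply/rowP => j; rewrite !mxE; case: j => -[|[|[|[|j]]]] //= ?;
  by rewrite ?mulr1 ?mulr0 ?addr0 ?subrKC.
Qed.

Lemma row4_line3 (x y z a s : R) :
  row4 x y z a + (s - a) *: delta_mx 0 3%:R = row4 x y z s.
Proof.
apply/rowP => j; rewrite !mxE; case: j => -[|[|[|[|j]]]] //= ?;
  by rewrite ?mulr1 ?mulr0 ?addr0 ?subrKC.
Qed.

Lemma row3_line0 (x y a s : R) :
  row3 x y a + (s - x) *: delta_mx 0 0 = row3 s y a.
Proof.
apply/rowP => j; rewrite !mxE; case: j => -[|[|[|j]]] //= ?;
  by rewrite ?mulr1 ?mulr0 ?addr0 ?subrKC.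
Qed.

Lemma row3_line1 (x y a s : R) :
  row3 x y a + (s - y) *: delta_mx 0 1 = row3 x s a.
Proof.
apply/rowP => j; rewrite !mxE; case: j => -[|[|[|j]]] //= ?;
  by rewrite ?mulr1 ?mulr0 ?addr0 ?subrKC.
Qed.

Lemma row4_cbox (x y z a : R) : 0 <= x <= pi -> 0 <= y <= pi -> B1 <= z <= B2 ->
  0 <= a <= pi -> cbox (lo4 B1) (hi4 B2) (row4 x y z a).
Proof. by move=> hx hy hz ha j; rewrite !mxE; case: j => -[|[|[|[|j]]]]. Qed.

Lemma row3_cbox (x y a : R) : 0 <= x <= pi -> 0 <= y <= pi ->
  0 <= a <= pi -> cbox (lo3 R) (hi3 R) (row3 x y a).
Proof. by move=> hx hy ha j; rewrite !mxE; case: j => -[|[|[|j]]]. Qed.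

Lemma oo_cc (x : R) : 0 < x < pi -> 0 <= x <= pi.
Proof. by move=> /andP[/ltW -> /ltW ->]. Qed.

Lemma dq_x (x y z a : R) : 0 < x < pi -> 0 <= y <= pi -> B1 <= z <= B2 ->
  0 <= a <= pi ->
  is_derive x 1 (fun s : R => q s y z a) (dq B1 B2 A t 0 (row4 x y z a)).
Proof.
move=> hx hy hz ha; have [_ _ D] := dqP hB12 0 adm.
have h : lo4 B1 0 0 < (row4 x y z a) 0 0 < hi4 B2 0 0 by rewrite !mxE.
have E s : vec4 q (row4 x y z a + (s - x) *: delta_mx 0 0) = q s y z a.
  by rewrite row4_line0 vec4_row4.
by have := D _ x (row4_cbox (oo_cc hx) hy hz ha) h; rewrite /= (funext E).
Qed.

Lemma dq_y (x y z a : R) : 0 <= x <= pi -> 0 < y < pi -> B1 <= z <= B2 ->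
  0 <= a <= pi ->
  is_derive y 1 (fun s : R => q x s z a) (dq B1 B2 A t 1 (row4 x y z a)).
Proof.
move=> hx hy hz ha; have [_ _ D] := dqP hB12 1 adm.
have h : lo4 B1 0 1 < (row4 x y z a) 0 1 < hi4 B2 0 1 by rewrite !mxE.
have E s : vec4 q (row4 x y z a + (s - y) *: delta_mx 0 1) = q x s z a.
  by rewrite row4_line1 vec4_row4.
by have := D _ y (row4_cbox hx (oo_cc hy) hz ha) h; rewrite /= (funext E).
Qed.

Lemma dq_a (x y z a : R) : 0 <= x <= pi -> 0 <= y <= pi -> B1 <= z <= B2 ->
  0 < a < pi ->
  is_derive a 1 (fun s : R => q x y z s) (dq B1 B2 A t 3%:R (row4 x y z a)).
Proof.
move=> hx hy hz ha; have [_ _ D] := dqP hB12 3%:R adm.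
have h : lo4 B1 0 3%:R < (row4 x y z a) 0 3%:R < hi4 B2 0 3%:R by rewrite !mxE.
have E s : vec4 q (row4 x y z a + (s - a) *: delta_mx 0 3%:R) = q x y z s.
  by rewrite row4_line3 vec4_row4.
by have := D _ a (row4_cbox hx hy hz (oo_cc ha)) h; rewrite /= (funext E).
Qed.

Lemma dp_x (x y a : R) : 0 < x < pi -> 0 <= y <= pi -> 0 <= a <= pi ->
  is_derive x 1 (fun s : R => p s y B2 a) (dp B2 A t 0 (row3 x y a)).
Proof.
move=> hx hy ha; have [_ _ D] := dpP 0 adm.
have h : lo3 R 0 0 < (row3 x y a) 0 0 < hi3 R 0 0 by rewrite !mxE.
have E s : top3 B2 p (row3 x y a + (s - x) *: delta_mx 0 0) = p s y B2 a.
  by rewrite row3_line0 top3_row3.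
by have := D _ x (row3_cbox (oo_cc hx) hy ha) h; rewrite /= (funext E).
Qed.

Lemma dp_y (x y a : R) : 0 <= x <= pi -> 0 < y < pi -> 0 <= a <= pi ->
  is_derive y 1 (fun s : R => p x s B2 a) (dp B2 A t 1 (row3 x y a)).
Proof.
move=> hx hy ha; have [_ _ D] := dpP 1 adm.
have h : lo3 R 0 1 < (row3 x y a) 0 1 < hi3 R 0 1 by rewrite !mxE.
have E s : top3 B2 p (row3 x y a + (s - y) *: delta_mx 0 1) = p x s B2 a.
  by rewrite row3_line1 top3_row3.
by have := D _ y (row3_cbox hx (oo_cc hy) ha) h; rewrite /= (funext E).
Qed.

Lemma is_derive_finsum (I : Type) (s : seq I) (F : I -> R -> R) (dF : I -> R)
  (x : R) :
  (forall i, is_derive x 1 (F i) (dF i)) ->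
  is_derive x 1 (fun u => \sum_(i <- s) F i u) (\sum_(i <- s) dF i).
Proof.
move=> D; elim: s => [|i s IH].
  under eq_fun do rewrite big_nil; rewrite big_nil.
  exact: is_derive_cst.
under eq_fun do rewrite big_cons; rewrite big_cons.
exact: is_deriveD.
Qed.

Lemma is_derive_cmul (C : R) (f : R -> R) (df x : R) :
  is_derive x 1 f df -> is_derive x 1 (fun u => C * f u) (C * df).
Proof. by move=> D; exact: is_deriveZ. Qed.

Lemma is_derive_sink k (x : R) : is_derive x 1 (sink k) (dsink k x).
Proof.
have D1 : is_derive x 1 (fun u : R => k.+1%:R * u) (k.+1%:R * 1).
  by apply: is_derive_cmul; exact: is_derive_id.
have D2 := is_derive_sin (k.+1%:R * x).
have := @is_derive1_comp R sin (fun u => k.+1%:R * u) x _ _ D2 D1.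
by move=> D; apply: is_derive_eq D _; rewrite /dsink mulr1 mulrC.
Qed.

Lemma VQ_dx (x y z a : R) : 0 <= x <= pi -> 0 <= y <= pi -> B1 <= z <= B2 ->
  0 <= a <= pi ->
  is_derive x 1 (fun s : R => VQ beta Q s y z a)
    (Vgen beta (@dsink R) (@sink R) Q (x, y, a, z)).
Proof.
move=> hx hy hz ha; rewrite /Vgen /= !clamp_id//.
do 3 (apply: is_derive_finsum => ?).
have E (u v w w' : R) : u * v * w * w' = u * v * w' * w by ring.
under eq_fun do rewrite E; rewrite E.
by apply: is_derive_cmul; exact: is_derive_sink.
Qed.

Lemma VQ_dy (x y z a : R) : 0 <= x <= pi -> 0 <= y <= pi -> B1 <= z <= B2 ->
  0 <= a <= pi ->
  is_derive y 1 (fun s : R => VQ beta Q x s z a)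
    (Vgen beta (@sink R) (@dsink R) Q (x, y, a, z)).
Proof.
move=> hx hy hz ha; rewrite /Vgen /= !clamp_id//.
do 3 (apply: is_derive_finsum => ?).
by apply: is_derive_cmul; exact: is_derive_sink.
Qed.

(** The derivative of v0 in x, and by symmetry in y. *)
Lemma is_derive_inv_sq (u w C x : R) : 0 < C ->
  is_derive x 1 (fun s : R => C / ((s - u) ^+ 2 + w ^+ 2 + C))
   (- 2 * (x - u) / C * (C / ((x - u) ^+ 2 + w ^+ 2 + C)) ^+ 2).
Proof.
move=> C0; have D0 : (x - u) ^+ 2 + w ^+ 2 + C != 0.
  by rewrite gt_eqF// ltr_wpDl// addr_ge0 ?sqr_ge0.
have D1 : is_derive x 1 (fun s : R => s - u) (1 - 0).
  by apply: is_deriveB.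
have D2 : is_derive x 1 (fun s : R => (s - u) ^+ 2 + (w ^+ 2 + C))
    (((x - u) *: (1 - 0) + (x - u) *: (1 - 0)) + 0).
  apply: is_deriveD; under eq_fun do rewrite expr2.
  exact: is_deriveM.
have D0' : (x - u) ^+ 2 + (w ^+ 2 + C) != 0 by rewrite addrA.
have := @is_derive_cmul C _ _ _
  (is_deriveV (f := fun s : R => (s - u) ^+ 2 + (w ^+ 2 + C)) D0' D2).
rewrite /=; under eq_fun do rewrite addrA.
move=> D; apply: is_derive_eq D _.
rewrite /GRing.scale /=; field.
by rewrite D0 gt_eqF.
Qed.

Lemma v0_dx (x y a : R) : is_derive x 1 (fun s : R =>
  v0 B1 s y a) (v0x B1 x y a).
Proof. by apply: is_derive_inv_sq; rewrite // exprn_gt0. Qed.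

Lemma v0_dy (x y a : R) : is_derive y 1 (fun s : R =>
  v0 B1 x s a) (v0y B1 x y a).
Proof.
rewrite /v0y /v0; under eq_fun do rewrite [(x - a) ^+ 2 + _]addrC.
rewrite [(x - a) ^+ 2 + _]addrC.
by apply: is_derive_inv_sq; rewrite // exprn_gt0.
Qed.

Lemma vQq_dx (x y z a : R) : 0 < x < pi -> 0 <= y <= pi -> B1 <= z <= B2 ->
  0 <= a <= pi ->
  (fun s : R => vQq beta q Q s y z a)^`()%classic x = vxC beta A t Q (x, y, a,
    z).
Proof.
move=> hx hy hz ha; have hx' := oo_cc hx.
rewrite derive1E; apply: derive_val.
rewrite /vxC /= !clamp_id//.
apply: is_deriveD; last exact: VQ_dx.
by apply: is_deriveD; [exact: v0_dx|exact: dq_x].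
Qed.

Lemma vQq_dy (x y z a : R) : 0 <= x <= pi -> 0 < y < pi -> B1 <= z <= B2 ->
  0 <= a <= pi ->
  (fun s : R => vQq beta q Q x s z a)^`()%classic y = vyC beta A t Q (x, y, a,
    z).
Proof.
move=> hx hy hz ha; have hy' := oo_cc hy.
rewrite derive1E; apply: derive_val.
rewrite /vyC /= !clamp_id//.
apply: is_deriveD; last exact: VQ_dy.
by apply: is_deriveD; [exact: v0_dy|exact: dq_y].
Qed.

Lemma vC_id (x y z a : R) : 0 <= x <= pi -> 0 <= y <= pi -> B1 <= z <= B2 ->
  0 <= a <= pi -> vC beta t Q (x, y, a, z) = vQq beta q Q x y z a.
Proof. by move=> hx hy hz ha; rewrite /vC /= !clamp_id. Qed.

Lemma Ex_clamp (x y z a : R) : 0 < x < pi -> 0 < y < pi -> B1 <= z <= B2 ->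
  0 <= a <= pi -> Ex beta p q Q x y z a = ExC beta A t Q (x, y, a, z).
Proof.
move=> hx hy hz ha; have [hx' hy'] := (oo_cc hx, oo_cc hy).
rewrite /Ex /ExC /EC /= clamp_id//; congr (- _ + _).
  apply: eq_Rintegral => s; rewrite inE /= in_itv /= => /andP[s1 s2].
  have hs : B1 <= s <= B2 by case/andP: hz => z1 _; rewrite (le_trans z1 s1).
  by rewrite vQq_dx// vC_id.
by rewrite derive1E; apply: derive_val; exact: dp_x.
Qed.

Lemma Ey_clamp (x y z a : R) : 0 < x < pi -> 0 < y < pi -> B1 <= z <= B2 ->
  0 <= a <= pi -> Ey beta p q Q x y z a = EyC beta A t Q (x, y, a, z).
Proof.
move=> hx hy hz ha; have [hx' hy'] := (oo_cc hx, oo_cc hy).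
rewrite /Ey /EyC /EC /= clamp_id//; congr (- _ + _).
  apply: eq_Rintegral => s; rewrite inE /= in_itv /= => /andP[s1 s2].
  have hs : B1 <= s <= B2 by case/andP: hz => z1 _; rewrite (le_trans z1 s1).
  by rewrite vQq_dy// vC_id.
by rewrite derive1E; apply: derive_val; exact: dp_y.
Qed.

Lemma expands_continuous (X : topologicalType) (F : fn * fn -> H -> X -> R) :
  expands (admissible beta A r eps) F -> continuous (F t Q).
Proof. by move=> [M _ /(_ t Q adm)[L [[cF _] _ _ _ _]]]. Qed.

Lemma int0pi_eq (f g : R -> R) : continuous g ->
  (forall x, 0 < x < pi -> f x = g x) ->
  int0pi f = \int[mu]_(x in `[0, pi]) g x.
Proof.
move=> cg fg; rewrite /int0pi -Rintegral_oo_cc//.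
by apply: eq_Rintegral => x; rewrite inE /= in_itv /=; exact: fg.
Qed.

(** The open intervals of integration in x and y are where the extended partial
    derivatives are genuine derivatives; continuity of the clamped moments
    then allows integrating over the closed intervals. *)
Lemma Lambda_solve_clamp (mom : 'I_N -> R -> R -> R)
    (momc : 'I_N -> fn * fn -> H -> R * R * R -> R) (z : R) i :
  (forall l, expands (admissible beta A r eps) (momc l)) ->
  (forall l x y, 0 < x < pi -> 0 < y < pi -> mom l x y = momc l t Q (z, y,
    x)) ->
  Lambda_solve beta mom i = solveC beta momc i t Q z.
Proof.
move=> em E; case: i => [[n k] m]; rewrite /Lambda_solve mxE /solveC /=.
apply: eq_bigr => l _; rewrite !mxE; congr (_ * - _).
have ew := expands_weightC k m (em l).
have ewi := expands_weightC_int k m (em l).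
have cwi := expands_continuous ewi; have cw := expands_continuous ew.
apply: int0pi_eq.
  apply: (continuous_comp_fun (f := fun y => (z, y)) _ cwi).
  by apply: continuous_pair; [exact: cst_continuous|exact: continuous_idfun].
move=> y hy; apply: int0pi_eq.
  apply: (continuous_comp_fun (f := fun x => (z, y, x)) _ cw).
  by apply: continuous_pair; [exact: cst_continuous|exact: continuous_idfun].
by move=> x hx; rewrite /weightC /= E.
Qed.

Lemma Fpq_clamp z i : B1 <= z <= B2 ->
  Fpq beta p q Q z i = solveC beta (momC beta A) i t Q z.
Proof.
move=> hz; apply: Lambda_solve_clamp => [l|l x y hx hy].
  exact: expands_momC.
have pi0 : 0 <= pi :> R := pi_ge0 R.
have hE a : 0 <= a <= pi ->
    Ex beta p q Q x y z a ^+ 2 + Ey beta p q Q x y z a ^+ 2 = hC beta A t Q (x,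
      y, a, z).
  by move=> ha; rewrite Ex_clamp// Ey_clamp.
have pi1 : 0 <= (pi : R) <= pi by rewrite pi0 lexx.
have pi2 : 0 <= (0 : R) <= pi by rewrite lexx pi0.
have comb (u u' v v' w w' f g : R) : u = u' -> v = v' -> w = w' ->
    u * f - v * g - w = u' * f - v' * g - w' by move=> -> -> ->.
apply: comb; [exact: (hE pi pi1)|exact: (hE 0 pi2)|].
apply: int0pi_eq.
  apply: continuous_mul.
    apply: (@continuous_comp_fun _ _ _ (fun a => (x, y, a, z))).
      by repeat first [exact: cst_continuous | exact: continuous_idfun
        | apply: continuous_pair].
    by apply: expands_continuous; exact: expands_hC.
  apply: continuous_comp_fun (proj2 (phi_smooth beta l)).
  exact: clamp_continuous.
by move=> a ha; rewrite (hE a (oo_cc ha)) (clamp_id (oo_cc ha)).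
Qed.

Lemma qhat_clamp z i : B1 <= z <= B2 ->
  qhat beta q z i = solveC beta (qmomC beta A) i t Q z.
Proof.
move=> hz; apply: Lambda_solve_clamp => [l|l x y hx hy].
  exact: expands_qmomC.
apply: int0pi_eq.
  apply: continuous_mul.
    have [cd _ _] := dqP hB12 3%:R adm.
    apply: continuous_comp_fun cd.
    by apply: row4_continuous;
      first [exact: cst_continuous|exact: continuous_idfun].
  apply: continuous_comp_fun (smooth1_continuous (phi_smooth beta l)).
  exact: clamp_continuous.
move=> a ha; rewrite [in RHS]clamp_id ?oo_cc//; congr (_ * _).
by rewrite derive1E; apply: derive_val; apply: dq_a; rewrite ?oo_cc.
Qed.

Theorem Jfun_clamp al :
  Jfun beta lam al p q Q = JC beta A lam t Q 0 + al * `|Q| ^+ 2.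
Proof.
have comb (u u' f g : R) : u = u' -> f * u + g = f * u' + g by move=> ->.
apply: comb.
apply: eq_Rintegral => z; rewrite inE /= in_itv /= => hz.
rewrite /densC clamp_id//; congr (_ * _).
apply: eq_bigr => i _; congr (_ ^+ 2).
by rewrite /resC clamp_id// Fpq_clamp// qhat_clamp.
Qed.

End ClampedEquality.

(** * Convergence of the projected gradient method *)

Section CarlemanFunctional.
Context (R : realType) (B1 B2 beta : R) (N K : nat).
Context (hB1 : 0 < B1) (hB12 : B1 < B2).
Local Notation idx := ('I_N * 'I_K * 'I_K)%type.
Local Notation H := (H10 B1 B2 idx).
Local Notation fn := (R -> R -> R -> R -> R).

Lemma VQ_bound : exists2 C : R, 0 <= C & forall (Q : H) x y z a,
  0 <= a <= pi -> `|VQ beta Q x y z a| <= C * `|Q|.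
Proof.
have bphi (n : nat) : exists M, forall a, `|phi beta n (clamp 0 pi a)| <= M.
  have cphi := smooth1_continuous (phi_smooth beta n).
  by have [] := bcont_clamp (pi_ge0 R) cphi.
have [M MP] := choice bphi.
have M0 n : 0 <= M n by apply: le_trans (MP n 0).
pose s := Num.sqrt (B2 - B1).
have s0 : 0 <= s by exact: sqrtr_ge0.
exists (\sum_(n < N) \sum_(k < K) \sum_(m < K) s * M n).
  by do 3 (apply: sumr_ge0 => ? _); rewrite mulr_ge0.
move=> Q x y z a ha; rewrite /VQ.
rewrite mulr_suml; apply: le_trans (ler_norm_sum _ _ _) (ler_sum _ _) => n _.
rewrite mulr_suml; apply: le_trans (ler_norm_sum _ _ _) (ler_sum _ _) => k _.
rewrite mulr_suml; apply: le_trans (ler_norm_sum _ _ _) (ler_sum _ _) => m _.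
rewrite -[a](clamp_id ha) !normrM.
set u := `|Q _ z|; set w := `|phi _ _ _|.
have uQ : u <= s * `|Q| by exact: H10_sup.
have wM : w <= M n by exact: MP.
have s1 (c : R) : `|sin c| <= 1 by rewrite ler_norml sin_geN1 sin_le1.
apply: (@le_trans _ _ (u * w)).
  apply: le_trans (ler_piMr _ (s1 _)) _; first by rewrite !mulr_ge0 ?normr_ge0.
  by apply: ler_piMr (s1 _); rewrite mulr_ge0 ?normr_ge0.
by rewrite mulrAC ler_pM ?normr_ge0.
Qed.

Lemma VQ_linear (c : R) (Q P : H) x y z a :
  VQ beta (c *: Q + P) x y z a = c * VQ beta Q x y z a + VQ beta P x y z a.
Proof.
rewrite /VQ mulr_sumr -big_split; apply: eq_bigr => n _.
rewrite mulr_sumr -big_split; apply: eq_bigr => k _.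
rewrite mulr_sumr -big_split; apply: eq_bigr => m _ /=.
rewrite [X in X * _ * _ * _ = _](_ : _ = c * Q (n, k, m) z + P (n, k, m) z)//.
by move: (Q _ z) (P _ z) => u v; ring.
Qed.

Lemma VQD (Q P : H) x y z a :
  VQ beta (Q + P) x y z a = VQ beta Q x y z a + VQ beta P x y z a.
Proof. by have := VQ_linear 1 Q P x y z a; rewrite scale1r mul1r. Qed.

Lemma VQZ (c : R) (Q : H) x y z a :
  VQ beta (c *: Q) x y z a = c * VQ beta Q x y z a.
Proof.
have V0 : VQ beta (0 : H) x y z a = 0.
  by have := VQD 0 0 x y z a; rewrite addr0; lra.
by have := VQ_linear c Q 0 x y z a; rewrite addr0 V0 addr0.
Qed.

Lemma VQB (Q P : H) x y z a :
  VQ beta (Q - P) x y z a = VQ beta Q x y z a - VQ beta P x y z a.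
Proof. by rewrite -(scaleN1r P) VQD VQZ mulN1r. Qed.

Definition v0min : R := B1 ^+ 2 / (B1 ^+ 2 + 5 * pi ^+ 2 / 4).

Lemma v0_ge (x y a : R) : 0 <= x <= pi -> 0 <= y <= pi -> 0 <= a <= pi ->
  v0min <= v0 B1 x y a.
Proof.
move=> /andP[x0 x1] /andP[y0 y1] /andP[a0 a1].
have D0 := v0_den_gt0 hB1 x y a.
rewrite /v0min /v0 ler_wpM2l ?sqr_ge0// lef_pV2 ?posrE//; last first.
  by rewrite ltr_wpDr ?exprn_gt0// divr_ge0// mulr_ge0// sqr_ge0.
have h1 : (x - a) ^+ 2 <= pi ^+ 2.
  by rewrite -subr_ge0 subr_sqr mulr_ge0//; lra.
have h2 : (y - pi / 2) ^+ 2 <= (pi / 2) ^+ 2.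
  by rewrite -subr_ge0 subr_sqr mulr_ge0//; lra.
lra.
Qed.

Section FixedData.
Context (A rad d lam al : R) (p q : fn).
Context (hd : d < v0min) (hrad : 0 < rad) (hal : 0 < al < 1).
Context (data : data_pair B1 B2 p q).
Context (pA : C1norm (lo3 R) (hi3 R) (top3 B2 p) <= A).
Context (qA : C1norm (lo4 B1) (hi4 B2) (vec4 q) <= A).
Local Notation B := (ball_set beta rad q d : set H).
Local Notation eps := ((v0min - d) / 2).
Local Notation adm := (admissible beta A (rad + 1) eps (p, q)).
Local Notation J := (fun Q : H => Jfun beta lam al p q Q).

Lemma ball_convex : is_convex B.
Proof.
move=> u v t [nu ud] [nv vd] t01; split; first exact: convex_norm_lt.
have /andP[t0 t1] := t01.
have t1' : 0 <= 1 - t by rewrite subr_ge0.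
move=> x y z a hG ha.
have := ud x y z a hG ha; have := vd x y z a hG ha.
rewrite (VQD u) (VQZ t) (VQB v u).
move: (q x y z a) (VQ beta u x y z a) (VQ beta v x y z a) => w1 w2 w3 h1 h2.
have H1 : (1 - t) * - d <= (1 - t) * (w1 + w2) by rewrite ler_wpM2l// ltW.
have H2 : t * - d < t * (w1 + w3) by rewrite ltr_pM2l.
lra.
Qed.

Lemma closure_ball_bounds (Q : H) : closure B Q -> `|Q| <= rad /\
  forall x y z a, clG B1 B2 (x, y, z) -> 0 <= a <= pi ->
    - d <= q x y z a + VQ beta Q x y z a.
Proof.
move=> /closure_normP BQ; split.
  apply/ler_addgt0Pr => e e0; have [P [nP _] QP] := BQ e e0.
  have -> : Q = (Q - P) + P by rewrite subrK.
  by rewrite (le_trans (ler_normD _ _))// addrC lerD// ltW.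
move=> x y z a hG ha; apply/ler_addgt0Pr => e e0.
have [C C0 CP] := VQ_bound.
have C1 : 0 < C + 1 by lra.
have [P [_ Pd] QP] := BQ (e / (C + 1)) (divr_gt0 e0 C1).
have := Pd x y z a hG ha; have := CP (P - Q) x y z a ha.
rewrite VQB; rewrite distrC in QP.
rewrite ltr_pdivlMr// in QP.
have nQP : 0 <= `|P - Q| by exact: normr_ge0.
rewrite ler_norml => /andP[_].
move: (`|P - Q|) (VQ beta P x y z a) (VQ beta Q x y z a) QP nQP =>
  n w1 w2 QP nQP.
lra.
Qed.

(** The lower bound v0min - d of v on the closure of the ball exceeds the one
    required by admissibility, and V_h is small with h: J is therefore expanded
    on a full neighbourhood of every point of the closure. *)
Lemma closure_ball_admissible : exists2 D : R, 0 < D &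
  forall Q h : H, closure B Q -> `|h| < D -> adm (Q + h).
Proof.
have [C C0 CP] := VQ_bound.
have C1 : 0 < C + 1 by lra.
have e0 : 0 < eps by rewrite divr_gt0// subr_gt0.
exists (Num.min 1 (eps / (C + 1))); first by rewrite lt_min ltr01 divr_gt0.
move=> Q h /closure_ball_bounds[nQ Qd]; rewrite lt_min => /andP[h1 h2].
split=> //.
  by rewrite (le_trans (ler_normD _ _))// lerD// ltW.
move=> x y z a hG ha; rewrite /vQq (VQD Q h) [(p, q).2]/=.
have := Qd x y z a hG ha; have := CP h x y z a ha.
have [hx hy _] := hG.
have := v0_ge hx hy ha.
rewrite ltr_pdivlMr// in h2.
have nh : 0 <= `|h| by exact: normr_ge0.
rewrite ler_norml.
move: (`|h|) (VQ beta h x y z a) (VQ beta Q x y z a) (v0 B1 x y a) h2 nh =>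
  n w1 w2 w3 h2 nh.
move=> h3 /andP[h4 _] h5.
lra.
Qed.

Lemma closure_ball_adm (Q : H) : closure B Q -> adm Q.
Proof.
have [D D0 DP] := closure_ball_admissible.
by move=> BQ; rewrite -[Q]addr0; apply: DP; rewrite ?normr0.
Qed.

(** The expansion makes J differentiable, Riesz representation provides the
    gradient, and the remainder is the quadratic upper bound used by the
    gradient step. As al < 1 the constant M + 1 does not depend on al. *)
Lemma gradient_expansion (M : R) (F : fn * fn -> H -> R -> R) :
  (forall Q, adm Q -> J Q = F (p, q) Q 0 + al * `|Q| ^+ 2) ->
  (forall Q, adm Q -> exists L, quad_expansion M adm (F (p, q)) Q L) ->
  forall Q, closure B Q ->
    (forall h, 'd J Q h = H1dot (gradient J Q) h) /\
    forall P, closure B P ->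
      J P - J Q - H1dot (gradient J Q) (P - Q) <= (M + 1) * `|P - Q| ^+ 2.
Proof.
move=> JE FL Q BQ; have aQ := closure_ball_adm BQ.
have [L [_ _ lL LM rem]] := FL Q aQ.
pose l (h : H) := L h 0 + 2 * al * H1dot Q h.
have lE h : l h = L h 0 + 2 * al * H1dot Q h by [].
have /andP[al0 al1] := hal.
have ll c h k : l (c *: h + k) = c * l h + l k.
  rewrite !lE lL H1dotDr.
  by move: (L h 0) (L k 0) (H1dot Q h) (H1dot Q k) => ? ? ? ?; ring.
have lC h : `|l h| <= (M + 2 * `|Q|) * `|h|.
  rewrite lE (le_trans (ler_normD _ _))// [leRHS]mulrDl lerD// normrM.
  have dle := norm_dot_le (@H1dotC R B1 B2 idx) (@H1dotDl R B1 B2 idx)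
    (@H10_normsq R B1 B2 idx) Q h.
  rewrite -[leRHS]mulrA ger0_norm; last by rewrite mulr_ge0// ltW.
  rewrite ler_pM//; first by rewrite mulr_ge0// ltW.
  by rewrite -[leRHS]mulr1 ler_wpM2l// ltW.
have lrem h : adm (Q + h) -> `|J (Q + h) - J Q - l h| <= (M + 1) * `|h| ^+ 2.
  move=> aQh; have := rem h 0 aQh; rewrite (JE _ aQh) (JE _ aQ) lE.
  rewrite (normsqD (@H1dotC R B1 B2 idx) (@H1dotDl R B1 B2 idx) (@H10_normsq R
    B1 B2 idx) Q h).
  have := sqr_ge0 (`|h|).
  move: (F _ (Q + h) 0) (F _ Q 0) (L h 0) (H1dot Q h) (`|Q| ^+ 2) (`|h| ^+ 2).
  move=> f1 f2 l1 dQ nQ nh nh0 H1.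
  have -> : f1 + al * (nQ + 2 * dQ + nh) - (f2 + al * nQ) - (l1 + 2 * al * dQ) =
    (f1 - f2 - l1) + al * nh by ring.
  rewrite (le_trans (ler_normD _ _))// [leRHS]mulrDl lerD//.
  by rewrite ger0_norm ?mulr_ge0 ?(ltW al0)// ler_wpM2r// ltW.
have [D D0 DP] := closure_ball_admissible.
have [dJ dJE] := @differentiable_quadratic R H J Q l _ _ D ll lC D0
  (fun h hD => lrem h (DP Q h BQ hD)).
have [g gE] := H10_riesz hB12 ll lC.
have [_ gP] : [set g | differentiable J Q /\ forall h, 'd J Q h = H1dot g h]
    (gradient J Q).
  apply: (xgetPex 0); exists g; split => // h.
  by rewrite (dJE h) gE.
split=> // P BP.
have QP : Q + (P - Q) = P by rewrite addrC subrK.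
have := lrem (P - Q); rewrite QP -(gP (P - Q)) (dJE (P - Q)).
by move=> /(_ (closure_ball_adm BP)); apply: le_trans; exact: ler_norm.
Qed.

End FixedData.
End CarlemanFunctional.

Theorem theorem6p3 (R : realType) (B1 B2 beta : R) (N K : nat)
    (hB1 : 0 < B1) (hB12 : B1 < B2) (hN : (1 <= N)%N) (hK : (1 <= K)%N)
    (hbeta : 0 < beta)
    (rad A d : R) (hrad : 0 < rad) (hA : 0 < A)
    (hd : 0 < d < B1 ^+ 2 / (B1 ^+ 2 + 5 * pi ^+ 2 / 4))
    (lambar : R) (hlambar : 1 < lambar)
    (lam : R) (hlam : lambar <= lam) :
  exists2 kbar : R, 0 < kbar < 1 &
  forall (alpha : R) (p q : R -> R -> R -> R -> R),
  0 < alpha < 1 ->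
  data_pair B1 B2 p q ->
  C1norm (lo3 R) (hi3 R) (top3 B2 p) <= A ->
  C1norm (lo4 B1) (hi4 B2) (vec4 q) <= A ->
  let H := H10 B1 B2 ('I_N * 'I_K * 'I_K)%type in
  let J := fun l : R => @Jfun R B1 B2 beta N K l alpha p q in
  let B : set H := ball_set beta rad q d in
  (forall l : R, lambar <= l -> forall Q1 Q2 : H, closure B Q1 -> closure B Q2 ->
    J l Q2 - J l Q1 - 'd (J l) Q1 (Q2 - Q1)
      >= 1 / 8 * L2norm (Q2 - Q1) ^+ 2 + alpha * `|Q2 - Q1| ^+ 2) ->
  forall Qmin : H, unique_minimizer (J lam) (closure B) Qmin ->
  forall T : H -> H, orthogonal_projection (closure B) T ->
  forall kappa : R, 0 < kappa < kbar ->
  exists2 theta : R, 0 < theta < 1 &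
  forall Qn : nat -> H,
    B (Qn 0%N) ->
    (forall n : nat, Qn n.+1 = T (Qn n - kappa *: gradient (J lam) (Qn n))) ->
  forall n : nat, (1 <= n)%N ->
    `|Qn n - Qmin| <= theta ^+ n * `|Qn 0%N - Qmin|.
Proof.
have /andP[_ hd1] := hd.
have r0 : 0 <= rad + 1 by lra.
have e0 : 0 < (v0min B1 - d) / 2 by rewrite divr_gt0// subr_gt0.
have [M M0 MP] := expands_JC beta N K hB1 hB12 A lam r0 e0.
have M1 : 0 < M + 1 by lra.
(* the first bound gives 2 al k < 1, the second one k (M + 1) <= 1/2 *)
exists (Num.min 2^-1 (2^-1 / (M + 1))).
  have h2 : 2^-1 < 1 :> R by rewrite invf_lt1// ltr1n.
  have h1 : 0 < 2^-1 / (M + 1) by rewrite divr_gt0// invr_gt0.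
  by rewrite lt_min gt_min h1 h2 invr_gt0 ltr0n.
move=> al p q hal data pA qA H J B conv Qmin [BQmin Qmin_min _] T proj k.
rewrite lt_min => /and3P[k0 k1 k2]; have /andP[al0 al1] := hal.
have kM : k * (M + 1) <= 2^-1 by rewrite -ler_pdivlMr// ltW.
have alk0 : 0 < 2 * al * k by rewrite !mulr_gt0.
have alk1 : 2 * al * k < 1.
  have : al * k < al * 2^-1 by rewrite ltr_pM2l.
  by lra.
have FL (Q : H) := MP (p, q) Q.
have JE (Q : H) (aQ : admissible beta A (rad + 1) ((v0min B1 - d) / 2) (p,
  q) Q) :=
  Jfun_clamp hB1 hB12 lam r0 e0 aQ al.
have grad (Q : H) := gradient_expansion hB1 hB12 hd1 hal data pA qA JE FL (Q :=
  Q).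
exists (Num.sqrt (1 - 2 * al * k)).
  rewrite sqrtr_gt0 subr_gt0 alk1/= -[ltRHS]sqrtr1 ltr_sqrt//.
  by lra.
move=> Qn B0 QnE n _.
apply: (projected_gradient_converges (@H1dotC R B1 B2 _) (@H1dotDl R B1 B2 _)
  (@H10_normsq R B1 B2 _) (J := J lam) (S := closure B) (M := M + 1)
  (grad := gradient (J lam)) (T := T)) => //.
- exact/closure_convex/ball_convex.
- by move=> P P' BP BP'; have [_ /(_ P' BP')] := grad P BP.
- move=> P BP; have [dJ _] := grad P BP.
  rewrite -dJ; apply: le_trans (conv lam hlam P Qmin BP BQmin).
  by rewrite lerDr mulr_ge0// ?divr_ge0// sqr_ge0.
- by rewrite subr_ge0 ltW.
- exact: subset_closure.
Qed.
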